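(* Let $A_{\text{can}}=A_1\oplus\dots\oplus A_t$ be a canonical matrix for congruence (summands ordered as described in the context). A simplest miniversal deformation of $A_{\text{can}}$ can be taken in the form $A_{\text{can}}+\mathcal D(\vec\varepsilon)$, where $\mathcal D=[\mathcal D_{ij}]_{i,j=1}^t$ is the $(0,* )$ matrix partitioned conformably to $A_{\text{can}}$ whose blocks, with $\mathcal D(A_i):=\mathcal D_{ii}$ and $\mathcal D(A_i,A_j):=(\mathcal D_{ji},\mathcal D_{ij})$ for $i<j$, are defined as follows. (i) Diagonal blocks: $$\mathcal D(H_m(\lambda))=\begin{cases}\begin{bmatrix}0&0\\0^{SW}&0\end{bmatrix}&\text{if }\lambda\ne\pm1,\\[3mm] \begin{bmatrix}0^{NW,\mathrm{even}}&0\\0^{SW}&0^{SE,\mathrm{even}}\end{bmatrix}&\text{if }\lambda=1\ (\text{then } m \text{ is even}),\\[3mm] \begin{bmatrix}0^{NW,\mathrm{odd}}&0\\0^{SW}&0^{SE,\mathrm{odd}}\end{bmatrix}&\text{if }\lambda=-1\ (\text{then } m\text{ is odd}),\end{cases}$$ where all blocks are $m\times m$; $$\mathcal D(\Gamma_n)=\begin{cases}0^{NW,\mathrm{odd}}&\text{if } n\text{ is even},\\ 0^{NW,\mathrm{even}}&\text{if } n\text{ is odd};\end{cases}\qquad \mathcal D(J_n(0))=0^{SW,\mathrm{odd}}.$$ (ii) Off-diagonal blocks for summands of the same type: $$\mathcal D(H_m(\lambda),H_n(\mu))=\begin{cases}(0,0)&\text{if }\lambda\ne\mu^{\pm1},\\[1mm]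 \left(\begin{bmatrix}0^{NW}&0\\0&0^{SE}\end{bmatrix},0\right)&\text{if }\lambda=\mu^{-1}\ne\pm1,\\[3mm] \left(\begin{bmatrix}0&0^{NE}\\0^{SW}&0\end{bmatrix},0\right)&\text{if }\lambda=\mu\ne\pm1,\\[3mm] \left(\begin{bmatrix}0^{NW}&0^{NE}\\0^{SW}&0^{SE}\end{bmatrix},0\right)&\text{if }\lambda=\mu=\pm1,\end{cases}$$ where the displayed blocks are $n\times m$; $$\mathcal D(\Gamma_m,\Gamma_n)=\begin{cases}(0,0)&\text{if } m-n\text{ is odd},\\(0^{NW},0)&\text{if } m-n\text{ is even};\end{cases}$$ $$\mathcal D(J_m(0),J_n(0))=\begin{cases}(0^{SW,\mathrm{odd}},\,0^{SW,\mathrm{odd}})&\text{if } m\ge n\text{ and } n\text{ is even},\\(0^{SW,\mathrm{odd}}+\mathcal P_{nm},\,0^{SW,\mathrm{odd}})&\text{if } m\ge n\text{ and } n\text{ is odd}.\end{cases}$$ (iii) Off-diagonal blocks for summands of different types: $$\mathcal D(H_m(\lambda),\Gamma_n)=\begin{cases}(0,0)&\text{if }\lambda\ne(-1)^{n+1},\\ ([\,0^{NW}\ \ 0^{NE}\,],\,0)&\text{if }\lambda=(-1)^{n+1},\end{cases}$$ where $0^{NW}$ and $0^{NE}$ are $n\times m$; $$\mathcal D(H_m(\lambda),J_n(0))=\begin{cases}(0,0)&\text{if } n\text{ is even},\\(0^{\updownarrow},0)&\text{if } n\text{ is odd};\end{cases}\qquad \mathcal D(\Gamma_m,J_n(0))=\begin{cases}(0,0)&\text{if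 } n\text{ is even},\\(0^{\updownarrow},0)&\text{if } n\text{ is odd}.\end{cases}$$
   Context: All matrices are complex. Canonical matrices. $J_n(\lambda)$ is the $n\times n$ upper triangular Jordan block with eigenvalue $\lambda$ (ones on the superdiagonal). $\Gamma_n$ is the $n\times n$ matrix with $(i,n+1-i)$ entry $(-1)^{n-i}$ for $1\le i\le n$, with $(i,n+2-i)$ entry $(-1)^{n-i}$ for $2\le i\le n$, and all other entries $0$ (so $\Gamma_1=[1]$, $\Gamma_2=\begin{bmatrix}0&-1\\1&1\end{bmatrix}$). $H_m(\lambda):=\begin{bmatrix}0&I_m\\ J_m(\lambda)&0\end{bmatrix}$, a $2m\times 2m$ matrix. A canonical matrix for congruence is a direct sum of the form $A_{\text{can}}=\bigoplus_i H_{p_i}(\lambda_i)\oplus\bigoplus_j\Gamma_{q_j}\oplus\bigoplus_l J_{r_l}(0)$ with $\lambda_i\ne0$, $\lambda_i\ne(-1)^{p_i+1}$, and $r_1\ge r_2\ge\dots$ (any of the three groups may be empty; each $\lambda_i$ is determined up to replacement by $\lambda_i^{-1}$); $A_1,\dots,A_t$ denote these summands in this order. $(0,* )$ matrices. A $(0,* )$ matrix is a matrix whose entries are the symbols $0$ and $*$. For a corner $c\in\{NW,NE,SE,SW\}$ (upper left, upper right, lower right, lower left), define the following $p\times q$ $(0,* )$ matrices. Let $L$ be the outer column (first or last) containing the corner $c$ if $p\le q$, and the outer row (first or last) containing the corner $c$ if $p\ge q$; if $p=q$, either choice may be used. In $0^{c}$ the stars are exactly all entries of $L$. In $0^{c,\mathrm{odd}}$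 the stars are exactly the entries of $L$ in positions $1,3,5,\dots$ counted along $L$ starting from the corner $c$. In $0^{c,\mathrm{even}}$ the stars are exactly the entries of $L$ in positions $2,4,6,\dots$ counted along $L$ starting from the corner $c$. $0^{\updownarrow}$ is a $p\times q$ $(0,* )$ matrix whose stars are either exactly all entries of the first row or exactly all entries of the last row (either form may be taken). For $p\le q$, $\mathcal P_{pq}$ is the $p\times q$ $(0,* )$ matrix whose stars are exactly the entries $(p,j)$ with $p+2\le j\le q$ (so there are $q-p-1$ stars if $p<q$ and none if $p=q$). A sum of $(0,* )$ matrices has stars at the union of the star positions. The symbol $0$ as a block denotes a zero block of the appropriate size. Deformations. A deformation of $A\in\mathbb C^{n\times n}$ is a holomorphic map $\mathcal A:\Lambda\to\mathbb C^{n\times n}$, where $\Lambda\subset\mathbb C^k$ is a neighborhood of $\vec 0$ and $\mathcal A(\vec0)=A$; deformations coinciding near $\vec 0$ are considered equal. Two deformations $\mathcal A,\mathcal B$ of $A$ with the same parameter space $\mathbb C^k$ are equivalent if there is a deformation $\mathcal I$ of $I_n$ with $\mathcal B(\vec\lambda)=\mathcal I(\vec\lambda)^T\mathcal A(\vec\lambda)\mathcal I(\vec\lambda)$ for all $\vec\lambda$ near $\vec0$. A deformation $\mathcal A(\lambda_1,\dots,\lambda_k)$ of $A$ is versal if every deformation $\mathcal B(\mu_1,\dots,\mu_l)$ of $A$ is equivalent to one of the form $\mathcal A(\varphi_1(\vec\mu),\dots,\varphi_k(\vec\mu))$, where the $\varphi_i$ are power series convergent in a neighborhood of $\vec 0$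 with $\varphi_i(\vec0)=0$. A versal deformation with $k$ parameters is miniversal if there is no versal deformation of $A$ with fewer than $k$ parameters. For an $n\times n$ $(0,* )$ matrix $\mathcal D$, let $\mathcal I(\mathcal D)$ be the set of positions of its stars and $\mathcal D(\vec\varepsilon):=\sum_{(i,j)\in\mathcal I(\mathcal D)}\varepsilon_{ij}E_{ij}$, where $E_{ij}$ are the matrix units and $\varepsilon_{ij}$ are independent parameters. A deformation is simplest if it has the form $A+\mathcal D(\vec\varepsilon)$ for a $(0,* )$ matrix $\mathcal D$. *)

(* Defs.v *)
From HB Require Import structures.
From mathcomp Require Import all_boot all_order all_algebra finmap.
From mathcomp Require Import complex.
From mathcomp Require Import all_classical all_reals topology normedtype.
From mathcomp.analysis.showcase Require Import summability.

Set Implicit Arguments.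
Unset Strict Implicit.
Unset Printing Implicit Defensive.

Import Order.TTheory GRing.Theory Num.Theory.
Import numFieldNormedType.Exports.

Local Open Scope ring_scope.
Local Open Scope classical_set_scope.

(* The definitions are over any K : numClosedFieldType.  The field of complex
   numbers is R[i] with R : realType; the ascription R[i] : numClosedFieldType
   is what gives it its topology.  The parameter space C^k is 'rV[K]_k. *)

Section Deformations.
Variable K : numClosedFieldType.

(* h ^ a, for a multi-index a *)
Definition monomial (k : nat) (h : 'rV[K]_k) (a : {ffun 'I_k -> nat}) : K :=
  \prod_(i < k) h 0 i ^+ a i.

(* Near w, f is the sum of a power series in z - w.  A multiple power series
   has no preferred order of summation: convergence is that of the net of all
   finite partial sums, equivalently absolute convergence. *)
Definition power_series_at (k : nat) (f : 'rV[K]_k -> K) (w : 'rV[K]_k) :=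
  exists c : {ffun 'I_k -> nat} -> K,
    \forall h \near (0 : 'rV[K]_k),
      partial_sum (fun a => c a * monomial h a) @ totally --> f (w + h).

(* Holomorphy in several variables, in the sense of Weierstrass *)
Definition holomorphic_on (k m n : nat) (L : set 'rV[K]_k)
    (F : 'rV[K]_k -> 'M[K]_(m, n)) :=
  forall w, L w -> forall i j, power_series_at (fun z => F z i j) w.

(* Maps are total: the values of F outside the neighborhood L are irrelevant,
   and the notions below depend only on the germ of F at 0. *)
Definition deformation (k n : nat) (A : 'M[K]_n) (F : 'rV[K]_k -> 'M[K]_n) :=
  F 0 = A /\ exists2 L : set 'rV[K]_k, open_nbhs (0 : 'rV[K]_k) L & holomorphic_on L F.

Definition equivalent (k n : nat) (F G : 'rV[K]_k -> 'M[K]_n) :=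
  exists2 S : 'rV[K]_k -> 'M[K]_n, deformation 1%:M S &
    \forall z \near (0 : 'rV[K]_k), G z = (S z)^T *m F z *m S z.

Definition versal (k n : nat) (A : 'M[K]_n) (F : 'rV[K]_k -> 'M[K]_n) :=
  deformation A F /\
  forall (l : nat) (G : 'rV[K]_l -> 'M[K]_n), deformation A G ->
    exists phi : 'rV[K]_l -> 'rV[K]_k,
      [/\ forall i, power_series_at (fun z => phi z 0 i) 0,
          phi 0 = 0 &
          equivalent G (fun z => F (phi z))].

Definition miniversal (k n : nat) (A : 'M[K]_n) (F : 'rV[K]_k -> 'M[K]_n) :=
  versal A F /\
  forall (k' : nat) (F' : 'rV[K]_k' -> 'M[K]_n), versal A F' -> (k <= k')%N.

(* A matrix with entries 0 or star is a boolean matrix: true is a star. *)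
Definition stars (n : nat) (D : 'M[bool]_n) : {set 'I_n * 'I_n} :=
  [set ij | D ij.1 ij.2]%SET.

(* A + D(eps), with one parameter for each star of D *)
Definition simplest (n : nat) (A : 'M[K]_n) (D : 'M[bool]_n)
    (eps : 'rV[K]_#|stars D|) : 'M[K]_n :=
  A + \sum_(p < #|stars D|)
        eps 0 p *: delta_mx (enum_val p).1 (enum_val p).2.

End Deformations.

Arguments simplest {K n} A D eps.

Section ZeroStar.

Variant corner := NW | NE | SE | SW.

Definition north (c : corner) : bool :=
  match c with NW | NE => true | SE | SW => false end.
Definition west (c : corner) : bool :=
  match c with NW | SW => true | NE | SE => false end.

(* How the freedom left in the shapes is resolved within one block: tie_col c
   tells whether the outer line through the corner c of a square block is a
   column, and top tells whether the full row of stars of 0^updownarrow is the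
   first one. *)
Record choices := Choices { tie_col : corner -> bool; top : bool }.

Definition nostar (p q : nat) : 'M[bool]_(p, q) := const_mx false.

(* Stars in the positions k along the outer line L through c such that sel k;
   positions are numbered 1, 2, ... from the corner c. *)
Definition on_line (sel : pred nat) (c : corner) (o : choices) (p q : nat) :
    'M[bool]_(p, q) :=
  \matrix_(i < p, j < q)
    let row_pos := if north c then i.+1 else (p - i)%N in
    let col_pos := if west c then j.+1 else (q - j)%N in
    if (p < q)%N || (p == q) && tie_col o c
    then (col_pos == 1%N) && sel row_pos
    else (row_pos == 1%N) && sel col_pos.

Definition zs (c : corner) := on_line predT c.
Definition zs_odd (c : corner) := on_line odd c.
Definition zs_even (c : corner) := on_line (fun k => ~~ odd k) c.

Definition zs_updown (o : choices) (p q : nat) : 'M[bool]_(p, q) :=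
  \matrix_(i < p, j < q) if top o then i == 0%N :> nat else i.+1 == p.

(* With 1-based indices, the stars are the (p, j) with p + 2 <= j. *)
Definition zs_P (p q : nat) : 'M[bool]_(p, q) :=
  \matrix_(i < p, j < q) ((i.+1 == p) && (p.+2 <= j.+1)%N).

Definition zs_add (p q : nat) (X Y : 'M[bool]_(p, q)) : 'M[bool]_(p, q) :=
  map2_mx orb X Y.

End ZeroStar.

Arguments nostar {p q}.
Arguments zs c o {p q}.
Arguments zs_odd c o {p q}.
Arguments zs_even c o {p q}.
Arguments zs_updown o {p q}.
Arguments zs_P {p q}.

Section Canonical.
Variable K : numClosedFieldType.

Definition Jordan (n : nat) (lambda : K) : 'M[K]_n :=
  \matrix_(i < n, j < n)
    if i == j then lambda else if j == i.+1 :> nat then 1 else 0.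

(* With 0-based indices, the antidiagonals (i, n+1-i) and (i, n+2-i) are
   i + j = n - 1 and i + j = n, and the sign (-1)^(n-i) becomes
   (-1)^(n-1-i). *)
Definition Gam (n : nat) : 'M[K]_n :=
  \matrix_(i < n, j < n)
    if (i + j == n.-1)%N || (i + j == n)%N then (-1) ^+ (n.-1 - i) else 0.

Definition Hmx (m : nat) (lambda : K) : 'M[K]_(m + m) :=
  block_mx 0 1%:M (Jordan m lambda) 0.

Variant summand := SumH of nat & K | SumG of nat | SumJ of nat.

Definition sdim (s : summand) : nat :=
  match s with SumH m _ => m + m | SumG n => n | SumJ n => n end.

Definition smx (s : summand) : 'M[K]_(sdim s) :=
  match s return 'M[K]_(sdim s) with
  | SumH m lambda => Hmx m lambda
  | SumG n => Gam n
  | SumJ n => Jordan n 0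
  end.

Definition summands (hs : seq (nat * K)) (gs js : seq nat) : seq summand :=
  [seq SumH h.1 h.2 | h <- hs] ++ [seq SumG q | q <- gs]
  ++ [seq SumJ r | r <- js].

Definition canonical_data (hs : seq (nat * K)) (gs js : seq nat) : Prop :=
  [/\ forall p lambda, (p, lambda) \in hs ->
        [/\ (0 < p)%N, lambda != 0 & lambda != (-1) ^+ p.+1],
      forall q, q \in gs -> (0 < q)%N,
      forall r, r \in js -> (0 < r)%N &
      sorted geq js].

Definition D_diag (o : choices) (s : summand) : 'M[bool]_(sdim s) :=
  match s return 'M[bool]_(sdim s) with
  | SumH m lambda =>
      if lambda == 1 then
        block_mx (zs_even NW o) nostar
                 (zs SW o)      (zs_even SE o)
      else if lambda == -1 then
        block_mx (zs_odd NW o) nostar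
                 (zs SW o)     (zs_odd SE o)
      else
        block_mx nostar    nostar
                 (zs SW o) nostar
  | SumG n => if odd n then zs_even NW o else zs_odd NW o
  | SumJ n => zs_odd SW o
  end.

(* The pair D(s1, s2) = (D21, D12) for a summand s1 placed before s2, o21 and
   o12 being the choices made in the two blocks.  The orders of types that do
   not occur in a canonical matrix get a dummy value. *)
Definition D_off (o21 o12 : choices) (s1 s2 : summand) :
    'M[bool]_(sdim s2, sdim s1) * 'M[bool]_(sdim s1, sdim s2) :=
  match s1, s2 return
    'M[bool]_(sdim s2, sdim s1) * 'M[bool]_(sdim s1, sdim s2) with
  | SumH m lambda, SumH n mu =>
      if (lambda == mu) && ((lambda == 1) || (lambda == -1)) then
        (block_mx (zs NW o21) (zs NE o21)
                  (zs SW o21) (zs SE o21), nostar)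
      else if lambda == mu then
        (block_mx nostar      (zs NE o21)
                  (zs SW o21) nostar, nostar)
      else if lambda == mu^-1 then
        (block_mx (zs NW o21) nostar
                  nostar      (zs SE o21), nostar)
      else (nostar, nostar)
  | SumG m, SumG n =>
      if odd m == odd n then (zs NW o21, nostar) else (nostar, nostar)
  | SumJ m, SumJ n =>
      if odd n then (zs_add (zs_odd SW o21) zs_P, zs_odd SW o12)
      else (zs_odd SW o21, zs_odd SW o12)
  | SumH m lambda, SumG n =>
      if lambda == (-1) ^+ n.+1 then
        (row_mx (zs NW o21) (zs NE o21), nostar)
      else (nostar, nostar)
  | SumH _ _, SumJ n | SumG _, SumJ n =>
      if odd n then (zs_updown o21, nostar) else (nostar, nostar)
  | _, _ => (nostar, nostar)
  end.

Section DirectSum.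
Variable s : seq summand.
Local Notation t := (size s).

Definition nth_summand (i : 'I_t) : summand := tnth (in_tuple s) i.

Definition A_can : 'M[K]_(\sum_(i < t) sdim (nth_summand i)) :=
  \mxdiag_(i < t) smx (nth_summand i).

Variable o : 'I_t -> 'I_t -> choices.

(* conform_mx only transports D_diag (a square matrix) to the type of the block
   (i, j) when i = j. *)
Definition D_block (i j : 'I_t) :
    'M[bool]_(sdim (nth_summand i), sdim (nth_summand j)) :=
  if (i < j)%N then
    (D_off (o j i) (o i j) (nth_summand i) (nth_summand j)).2
  else if (j < i)%N then
    (D_off (o i j) (o j i) (nth_summand j) (nth_summand i)).1
  else conform_mx nostar (D_diag (o i i) (nth_summand i)).

Definition D_can : 'M[bool]_(\sum_(i < t) sdim (nth_summand i)) :=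
  \mxblock_(i < t, j < t) D_block i j.

End DirectSum.
End Canonical.

(* Main.v *)
Require Import Defs.
From HB Require Import structures.
From mathcomp Require Import all_boot all_order all_algebra perm finmap.
From mathcomp Require Import complex.
From mathcomp Require Import all_classical all_reals topology normedtype.
From mathcomp.analysis.showcase Require Import summability.
From mathcomp Require Import zify ring lra.

Set Implicit Arguments.
Unset Strict Implicit.
Unset Printing Implicit Defensive.

Import Order.TTheory GRing.Theory Num.Theory.
Import numFieldNormedType.Exports.

Local Open Scope ring_scope.

(** The tangent space at [A] to the congruence orbit of [A] consists of the
    matrices [X^T A + A X].  A deformation [A + D(eps)] is miniversal as soon as
    the matrices with zero entries outside the stars of [D] form a complement of
    that space ([simplest_miniversal]); and for a canonical matrix [A] and the
    pattern [D] of the theorem they do ([complementary_canonical]).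

    Complement implies miniversal.  Choose a linear map [X] such that
    [Y + X(Y)^T A + A X(Y)] is supported by [D] for every [Y].  For a
    deformation [G = A + E] of [A], look for a transforming matrix of the form
    [1 + X(Y)].  Expanding [(1 + X(Y))^T (A + E) (1 + X(Y))] shows that the
    result is [A] plus a matrix supported by [D] when [Y] is a fixed point of a
    quadratic map that depends on [E] ([newton_congr]).  Near the origin
    [E] is small and this map is a contraction, also for the norm given by the
    absolute values of the coefficients of power series; its fixed point is thus
    a convergent power series in the parameters ([newton_fixed_point]), and [G]
    is equivalent to [A + D(phi)].  Minimality is a first order argument: were
    [A + D(eps)] induced by a deformation with fewer parameters through [phi],
    some direction [h <> 0] would be killed by the derivative of [phi] at 0;
    along [h] the family is then congruent to [A] up to second order, so [D(h)]
    is tangent to the orbit, hence zero ([simplest_minimal]).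

    The complement.  The blocks [(i, j)] and [(j, i)] of [X^T A + A X] involve
    only the blocks [(i, j)] and [(j, i)] of [X], so the question splits into
    one about each pair of summands ([pair_map]) and one about each summand
    ([diag_map]); see [complementary_blocks].  If a summand [A] is nonsingular,
    with cosquare [Phi = A^-T A], one of the two blocks of a pair can be made
    zero and the other one is acted on by [R |-> B R - B^T R Phi]
    ([pair_reduce]); when [B] is nonsingular as well, this is a Sylvester
    operator [R |-> L R - R Phi], and [diag_map] becomes [Y |-> Y + Y^T Phi].
    The cosquares of [H_m(l)] and [Gamma_n] are made of triangular matrices with
    one Jordan block: [J_m(l)] and its inverse transpose for [H_m(l)], a single
    one with eigenvalue [(-1)^(n-1)] for [Gamma_n].  For such matrices the
    operators are triangular for the filtration by antidiagonals.  They are onto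
    unless the eigenvalues match; if they match, the leading term identifies the
    neighbouring matrix units of each antidiagonal up to scalars, so one star on
    each antidiagonal that does not reach the far sides of the block suffices
    ([sylvester_span]), and putting the stars on one outer line makes the sum
    direct ([sylvester_indep]).  For [Y + Y^T Phi] every second antidiagonal is
    reached by the symmetry of the operator, which gives the patterns with only
    odd or only even positions ([self_map_span], [self_map_indep]).

    Nilpotent Jordan blocks are treated combinatorially, because there every
    elementary matrix [X] is mapped to a sum of at most two matrix units.  Take
    the matrix units as vertices and these sums as edges: the graph is a union
    of paths, a path with a loose end (an edge with one vertex only) lies in the
    tangent space, and every other path needs, and contains, exactly one star
    ([JJ_span], [path_indep]). *)

(** * Entries indexed by natural numbers *)

Section Entries.
Variable K : fieldType.

(** With indices in [nat] and the value 0 outside the matrix, the boundary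
    cases of recurrences between neighbouring entries need no casts and no
    separate treatment. *)
Definition entry m n (A : 'M[K]_(m, n)) (i j : nat) : K :=
  if insub i is Some i' then if insub j is Some j' then A i' j' else 0 else 0.

Lemma entryE m n (A : 'M[K]_(m, n)) (i : 'I_m) (j : 'I_n) : entry A i j = A i j.
Proof. by rewrite /entry !valK. Qed.

Lemma entry_out m n (A : 'M[K]_(m, n)) i j : ~~ ((i < m) && (j < n))%N -> entry A i j = 0.
Proof.
rewrite /entry; case: insubP => // i' -> _; case: insubP => // j' -> _ //.
Qed.

Lemma entry_in m n (A : 'M[K]_(m, n)) i j (im : (i < m)%N) (jn : (j < n)%N) :
  entry A i j = A (Ordinal im) (Ordinal jn).
Proof. by rewrite -entryE. Qed.

Lemma entryP m n (A B : 'M[K]_(m, n)) :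
  (forall i j, (i < m)%N -> (j < n)%N -> entry A i j = entry B i j) -> A = B.
Proof. by move=> AB; apply/matrixP => i j; rewrite -!entryE; apply: AB. Qed.

Lemma entry_fun m n (F : nat -> nat -> K) i j :
  entry (\matrix_(i < m, j < n) F i j) i j = if ((i < m) && (j < n))%N then F i j else 0.
Proof.
case: ifP => [/andP[im jn]|/negbT/entry_out //].
by rewrite (entry_in _ im jn) mxE.
Qed.

Lemma entryD m n (A B : 'M[K]_(m, n)) i j : entry (A + B) i j = entry A i j + entry B i j.
Proof.
case: (boolP ((i < m) && (j < n))%N) => [/andP[im jn]|out].
  by rewrite !(entry_in _ im jn) mxE.
by rewrite !entry_out ?addr0.
Qed.

Lemma entryN m n (A : 'M[K]_(m, n)) i j : entry (- A) i j = - entry A i j.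
Proof.
case: (boolP ((i < m) && (j < n))%N) => [/andP[im jn]|out].
  by rewrite !(entry_in _ im jn) mxE.
by rewrite !entry_out ?oppr0.
Qed.

Lemma entryB m n (A B : 'M[K]_(m, n)) i j : entry (A - B) i j = entry A i j - entry B i j.
Proof. by rewrite entryD entryN. Qed.

Lemma entryZ m n a (A : 'M[K]_(m, n)) i j : entry (a *: A) i j = a * entry A i j.
Proof.
case: (boolP ((i < m) && (j < n))%N) => [/andP[im jn]|out].
  by rewrite !(entry_in _ im jn) mxE.
by rewrite !entry_out ?mulr0.
Qed.

Lemma entry0 m n i j : entry (0 : 'M[K]_(m, n)) i j = 0.
Proof.
case: (boolP ((i < m) && (j < n))%N) => [/andP[im jn]|out].
  by rewrite !(entry_in _ im jn) mxE.
by rewrite !entry_out.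
Qed.

Lemma entry_tr m n (A : 'M[K]_(m, n)) i j : entry A^T i j = entry A j i.
Proof.
case: (boolP ((i < n) && (j < m))%N) => [/andP[im jn]|out].
  by rewrite (entry_in _ im jn) (entry_in _ jn im) mxE.
by rewrite !entry_out // andbC.
Qed.

Lemma entry_mul m n p (A : 'M[K]_(m, n)) (B : 'M[K]_(n, p)) i j :
  entry (A *m B) i j = \sum_(k < n) entry A i k * entry B k j.
Proof.
case: (boolP ((i < m) && (j < p))%N) => [/andP[im jp]|out].
  rewrite !(entry_in _ im jp) mxE; apply: eq_bigr => k _.
  by rewrite (entry_in _ im (ltn_ord k)) (entry_in _ (ltn_ord k) jp); congr (A _ _ * B _ _); apply: val_inj.
rewrite entry_out // big1 // => k _; rewrite negb_and in out.
case/orP: out => out; first by rewrite (entry_out A) ?mul0r // negb_and out.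
by rewrite (entry_out B) ?mulr0 // negb_and out orbT.
Qed.

Lemma entry_sum m n (I : finType) (P : pred I) (F : I -> 'M[K]_(m, n)) i j :
  entry (\sum_(k | P k) F k) i j = \sum_(k | P k) entry (F k) i j.
Proof. by elim/big_rec2: _ => [|k y1 y2 _ <-]; rewrite ?entry0 ?entryD. Qed.

Definition unit_mx m n (i j : nat) : 'M[K]_(m, n) :=
  \matrix_(a < m, b < n) ((a == i :> nat) && (b == j :> nat))%:R.

Lemma entry_unit m n i j a b : entry (unit_mx m n i j) a b =
  if [&& (i < m)%N, (j < n)%N, a == i & b == j] then 1 else 0.
Proof.
rewrite /unit_mx (entry_fun _ _ (fun a b => ((a == i) && (b == j))%:R)).
by case: eqP => [->|_]; case: eqP => [->|_]; rewrite ?andbT ?andbF //=; case: ifP.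
Qed.

Lemma unit_mx_out m n i j : ~~ ((i < m) && (j < n))%N -> unit_mx m n i j = 0.
Proof.
move=> out; apply: entryP => a b _ _; rewrite entry_unit entry0 andbA.
by rewrite (negPf out).
Qed.

End Entries.

Arguments unit_mx {K m n} i j.

(** * Complements of the range of a linear map *)

Section Complementary.
Variable K : fieldType.

Definition supported p q (D : 'M[bool]_(p, q)) (U : 'M[K]_(p, q)) :=
  forall i j, ~~ D i j -> U i j = 0.

(** For linear [f] and a subspace [D], the target is the direct sum of [D]
    and the range of [f]; the second clause avoids a name for the range. *)
Definition complementary (W V : zmodType) (f : W -> V) (D : V -> Prop) :=
  (forall v, exists w, D (v - f w)) /\ (forall w, D (f w) -> f w = 0).

Definition lin_closed (V : lmodType K) (Q : V -> Prop) :=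
  Q 0 /\ forall a u v, Q u -> Q v -> Q (a *: u + v).

Lemma lin_closedD (V : lmodType K) (Q : V -> Prop) u v : lin_closed Q -> Q u -> Q v -> Q (u + v).
Proof. by move=> [_ Ql] Qu Qv; rewrite -[u]scale1r; apply: Ql. Qed.

Lemma lin_closedZ (V : lmodType K) (Q : V -> Prop) a u : lin_closed Q -> Q u -> Q (a *: u).
Proof. by move=> [Q0 Ql] Qu; rewrite -[_ *: _]addr0; apply: Ql. Qed.

Lemma lin_closedB (V : lmodType K) (Q : V -> Prop) u v : lin_closed Q -> Q u -> Q v -> Q (u - v).
Proof. by move=> Ql Qu Qv; apply: lin_closedD => //; rewrite -scaleN1r; apply: lin_closedZ. Qed.

Lemma lin_closed_sum (V : lmodType K) (Q : V -> Prop) (I : finType) (P : pred I) (F : I -> V) :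
  lin_closed Q -> (forall i, P i -> Q (F i)) -> Q (\sum_(i | P i) F i).
Proof.
move=> Ql QF; elim/big_ind: _ => //; first by case: Ql.
by move=> u v; exact: lin_closedD.
Qed.

Lemma supported_lin p q (D : 'M[bool]_(p, q)) : lin_closed (supported D).
Proof.
split=> [i j _|a u v Du Dv i j Dij]; first by rewrite mxE.
by rewrite !mxE Du // Dv // mulr0 addr0.
Qed.

Lemma range_lin (W V : lmodType K) (f : W -> V) (D : V -> Prop) :
  linear f -> lin_closed D -> lin_closed (fun v => exists w, D (v - f w)).
Proof.
move=> fl Dl; split=> [|a u v [w Dw] [w' Dw']].
  exists 0; have f0 : f 0 = 0.
    by have := fl (-1) 0 0; rewrite scaler0 addr0 scaleN1r addNr.
  by rewrite f0 subr0; case: Dl.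
exists (a *: w + w'); rewrite fl opprD addrACA -scalerBr.
by apply: lin_closedD => //; apply: lin_closedZ.
Qed.

End Complementary.

Arguments supported_lin {K p q} D.

(** * The filtration by antidiagonals *)

Section Filtration.
Variable K : fieldType.
Variables m n : nat.
Implicit Types (U V : 'M[K]_(m, n)) (i j s : nat).

(** The subspaces of the filtration: only the antidiagonals [i + j >= s]
    are occupied. *)
Definition deg_ge s U := forall i j, (i + j < s)%N -> entry U i j = 0.

Lemma deg_geW s t U : (s <= t)%N -> deg_ge t U -> deg_ge s U.
Proof. by move=> st Ut i j ij; apply: Ut; lia. Qed.

Lemma deg_ge_lin s : lin_closed (deg_ge s).
Proof.
split=> [i j _|a u v Du Dv i j Dij]; first by rewrite entry0.
by rewrite entryD entryZ Du // Dv // mulr0 addr0.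
Qed.

Lemma deg_ge_unit i j : deg_ge (i + j) (unit_mx i j : 'M[K]_(m, n)).
Proof.
move=> a b ab; rewrite entry_unit; case: ifP => // /and4P[_ _ /eqP ai /eqP bj].
by move: ab; rewrite ai bj ltnn.
Qed.

(** [Q] up to later antidiagonals: what a computation of leading terms
    yields. *)
Definition mod_deg (Q : 'M[K]_(m, n) -> Prop) s U := exists2 V, deg_ge s.+1 V & Q (U - V).

Lemma mod_deg_lin Q s : lin_closed Q -> lin_closed (mod_deg Q s).
Proof.
move=> Ql; split=> [|a u v [u' hu Qu] [v' hv Qv]].
  by exists 0; [case: (deg_ge_lin s.+1) | rewrite subr0; case: Ql].
exists (a *: u' + v'); first by case: (deg_ge_lin s.+1) => _; apply.
by rewrite opprD addrACA -scalerBr; case: Ql => _; apply.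
Qed.

Lemma mod_deg_high Q s U : lin_closed Q -> deg_ge s.+1 U -> mod_deg Q s U.
Proof. by move=> Ql hU; exists U => //; rewrite subrr; case: Ql. Qed.

Lemma mod_deg_sub (Q : 'M[K]_(m, n) -> Prop) s U : Q U -> mod_deg Q s U.
Proof. by exists 0; [case: (deg_ge_lin s.+1) | rewrite subr0]. Qed.

Lemma mod_deg_congr Q s U V : lin_closed Q -> deg_ge s.+1 (U - V) -> mod_deg Q s U -> mod_deg Q s V.
Proof.
move=> Ql UV QU; have -> : V = U - (U - V) by rewrite subKr.
by apply: lin_closedB => //; [exact: mod_deg_lin | exact: mod_deg_high].
Qed.

(** Elimination by descending induction on the antidiagonal: what is left
    over at one step lives on later antidiagonals. *)
Lemma filtered_span Q : lin_closed Q ->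
  (forall i j, (i < m)%N -> (j < n)%N -> mod_deg Q (i + j) (unit_mx i j)) -> forall U, Q U.
Proof.
move=> Ql hQ U.
suff H k : forall U, deg_ge (m + n - k) U -> Q U.
  by apply: (H (m + n)%N); rewrite subnn => i j; rewrite ltn0.
elim: k => [|k IH] {}U hU.
  have -> : U = 0; last by case: Ql.
  by apply: entryP => i j im jn; rewrite entry0 hU //; lia.
have [le|lt] := leqP (m + n) k; first by apply: IH; apply: deg_geW hU; lia.
set s := (m + n - k.+1)%N in hU; have sS : (m + n - k)%N = s.+1 by rewrite /s; lia.
pose P (ij : 'I_m * 'I_n) := (ij.1 + ij.2 == s)%N.
have : mod_deg Q s U.
  have : mod_deg Q s (\sum_(ij | P ij) U ij.1 ij.2 *: unit_mx ij.1 ij.2).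
    apply: lin_closed_sum; first exact: mod_deg_lin.
    move=> ij /eqP <-; apply: lin_closedZ; first exact: mod_deg_lin.
    by apply: hQ.
  apply: mod_deg_congr => // a b; rewrite ltnS => ab; rewrite entryB entry_sum.
  case: (boolP ((a < m) && (b < n))%N) => [/andP[am bn]|out]; last first.
    by rewrite (entry_out U out) subr0 big1 // => ij _; rewrite entry_out.
  have [ab'|ab'] := ltnP (a + b) s.
    rewrite hU // subr0 big1 // => ij /eqP ijs; rewrite entryZ entry_unit.
    case: ifP => [/and4P[_ _ /eqP ai /eqP bj]|_]; last by rewrite mulr0.
    by move: ab'; rewrite ai bj ijs ltnn.
  rewrite (bigD1 (Ordinal am, Ordinal bn)) /=; last by rewrite /P /=; lia.
  rewrite big1 ?addr0 => [|ij /andP[_ ij']]; rewrite entryZ entry_unit.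
    by rewrite am bn !eqxx mulr1 -(entry_in U am bn) subrr.
  case: ifP => [/and4P[_ _ /eqP ai /eqP bj]|_]; last by rewrite mulr0.
  case/negP: ij'; rewrite -pair_eqE /=; apply/andP; split; apply/eqP/val_inj => /=; lia.
move=> [V hV QUV]; rewrite -[U](subrK V); apply: lin_closedD => //.
by apply: IH; rewrite sS.
Qed.

(** An antidiagonal is a chain for the relation between neighbours, so the
    property spreads from one entry to all of them. *)
Lemma antidiagonal_connected (P : nat -> nat -> Prop) s :
  (forall i j, (i.+1 < m)%N -> (j.+1 < n)%N -> (i + j).+1 = s -> P i.+1 j <-> P i j.+1) ->
  forall i0 j0, (i0 < m)%N -> (j0 < n)%N -> (i0 + j0)%N = s -> P i0 j0 ->
  forall i j, (i < m)%N -> (j < n)%N -> (i + j)%N = s -> P i j.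
Proof.
move=> adj i0 j0 i0m j0n s0 P0 i j im jn sij.
have [le|lt] := leqP i0 i.
  have : exists d, i = (i0 + d)%N by exists (i - i0)%N; lia.
  move=> [d]; elim: d i j im jn sij le => [|d IH] i j im jn sij le id.
    have -> : i = i0 by lia.
    by have -> : j = j0 by lia.
  case: i im sij le id => [|i] im sij le id; first lia.
  by apply/adj; [lia | lia | lia | apply: IH; lia].
have : exists d, i0 = (i + d)%N by exists (i0 - i)%N; lia.
move=> [d]; elim: d i j im jn sij {lt} => [|d IH] i j im jn sij id.
  have -> : i = i0 by lia.
  by have -> : j = j0 by lia.
case: j jn sij => [|j] jn sij; first lia.
by apply/adj; [lia | lia | lia | apply: IH; lia].
Qed.

End Filtration.

Arguments deg_ge_unit {K m n} i j.
Arguments deg_ge_lin {K m n} s.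

(** * Triangular matrices similar to one Jordan block *)

Section Triangular.
Variable K : fieldType.

(** What the leading term computations use of a Jordan block; unlike the
    Jordan form itself, this shape is kept by inversion ([utri_inv]). *)
Definition utri n (c : K) (M : 'M[K]_n) :=
  [/\ forall i j, (j < i)%N -> entry M i j = 0,
      forall i, (i < n)%N -> entry M i i = c &
      forall i, (i.+1 < n)%N -> entry M i i.+1 != 0].

Definition prd (i : nat) (F : nat -> K) := if i is i'.+1 then F i' else 0.

(** Products with a matrix of shape [utri] only have two terms of lowest
    degree: the diagonal one and its neighbour. *)
Lemma sum_two_last n (F : nat -> K) j : (forall k, (n <= k)%N -> F k = 0) ->
  (forall k, (k < n)%N -> k != j -> k.+1 != j -> F k = 0) ->
  \sum_(k < n) F k = F j + prd j F.
Proof.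
move=> Fout F0; pose N := maxn n j.+1.
have -> : \sum_(k < n) F k = \sum_(k < N) F k.
  rewrite (big_ord_widen N F) ?leq_maxl // big_mkcond /=; apply: eq_bigr => k _.
  by case: ltnP => // /Fout.
have F0' k : k != j -> k.+1 != j -> F k = 0.
  by case: (ltnP k n) => [kn|/Fout //]; apply: F0.
have jN : (j < N)%N by rewrite /N; lia.
rewrite (bigD1 (Ordinal jN)) //=; congr (_ + _).
case: j {F0} N jN F0' => [|j] N jN F0' /=.
  by apply: big1 => k /eqP kj; apply: F0' => //; apply/eqP => k0; apply: kj; apply: val_inj.
rewrite (bigD1 (Ordinal (ltnW jN))) /=; last by apply/eqP => /(congr1 val) /=; lia.
rewrite big1 ?addr0 // => k /andP[/eqP kj /eqP kj']; apply: F0'; apply/eqP => k0.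
  by apply: kj; apply: val_inj.
by apply: kj'; apply: val_inj => /=; lia.
Qed.

Lemma mulmx_utri_lead m n c (Z : 'M[K]_(m, n)) (M : 'M[K]_n) s : utri c M -> deg_ge s Z ->
  forall i j, (i + j <= s.+1)%N -> entry (Z *m M) i j =
    c * entry Z i j + prd j (fun j' => entry Z i j' * entry M j' j'.+1).
Proof.
move=> [M0 Mc _] hZ i j ij; rewrite entry_mul.
rewrite (@sum_two_last n (fun k => entry Z i k * entry M k j) j) /=; last first.
- move=> k kn kj kj'; have [kj2|jk] := ltnP k j; last by rewrite M0 ?mulr0 //; lia.
  by rewrite hZ ?mul0r //; lia.
- by move=> k nk; rewrite [entry M _ _]entry_out ?mulr0 //; lia.
congr (_ + _); last by case: (j).
have [jn|nj] := ltnP j n; first by rewrite Mc // mulrC.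
by rewrite [entry Z _ _]entry_out ?mul0r ?mulr0 //; lia.
Qed.

Lemma ltri_mulmx_lead m n c (Z : 'M[K]_(m, n)) (L : 'M[K]_m) s : utri c L^T -> deg_ge s Z ->
  forall i j, (i + j <= s.+1)%N -> entry (L *m Z) i j =
    c * entry Z i j + prd i (fun i' => entry L i'.+1 i' * entry Z i' j).
Proof.
move=> hL hZ i j ij; rewrite -entry_tr trmx_mul.
rewrite (mulmx_utri_lead (s := s) hL) => [|a b ab|]; last by rewrite addnC.
  rewrite entry_tr; congr (_ + _); case: i {ij} => //= i.
  by rewrite !entry_tr mulrC.
by rewrite entry_tr hZ // addnC.
Qed.

Lemma utri_unit n c (M : 'M[K]_n) : utri c M -> c != 0 -> M \in unitmx.
Proof.
move=> [M0 Mc _] c0; rewrite -unitmx_tr unitmxE det_trig.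
  rewrite unitfE; apply/prodf_neq0 => i _.
  by rewrite mxE -entryE Mc.
by apply/is_trig_mxP => i j ij; rewrite mxE -entryE M0.
Qed.

Lemma utri_mul_right m n c (M : 'M[K]_n) (V : 'M[K]_(m, n)) i j : utri c M ->
  entry (V *m M) i j = c * entry V i j + \sum_(k < n | (k < j)%N) entry V i k * entry M k j.
Proof.
move=> [M0 Mc _]; have [jn|nj] := ltnP j n; last first.
  rewrite entry_out ?[entry V i j]entry_out; try lia.
  rewrite mulr0 add0r big1 // => k _; rewrite [entry M _ _]entry_out ?mulr0 //; lia.
rewrite entry_mul (bigD1 (Ordinal jn)) //= Mc // mulrC; congr (_ + _).
rewrite (bigID (fun k : 'I_n => (k < j)%N)) /= [X in _ + X]big1 ?addr0 => [|k /andP[kj jk]].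
  apply: eq_bigl => k; case: ltnP => kj; rewrite ?andbF ?andbT //.
  by apply/eqP => /(congr1 val) /=; lia.
rewrite M0 ?mulr0 //; have : (k : nat) != j by apply: contraNneq kj => kj; apply/eqP/val_inj.
by lia.
Qed.

Lemma utri_inv n c (M : 'M[K]_n) : utri c M -> c != 0 -> utri c^-1 (invmx M).
Proof.
move=> hM c0; have hu := utri_unit hM c0; have [M0 Mc M1] := hM.
have VM i j : entry (invmx M *m M) i j = ((i < n)%N && (i == j))%:R.
  rewrite mulVmx //; case: (boolP ((i < n) && (j < n))%N) => [/andP[im jn]|out].
    by rewrite (entry_in _ im jn) mxE im.
  rewrite entry_out //; case: eqP => [ij|_]; rewrite ?andbF // andbT.
  by move: out; rewrite -ij andbb => /negPf ->.
have V0 i j : (j < i)%N -> entry (invmx M) i j = 0.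
  elim/ltn_ind: j => j IH ji; apply: (mulfI c0); rewrite mulr0.
  have := VM i j; rewrite (utri_mul_right _ _ _ hM) big1 => [|k kj]; last by rewrite IH ?mul0r //; lia.
  by rewrite addr0 => ->; rewrite [i == j]gtn_eqF ?andbF.
have Vc i : (i < n)%N -> entry (invmx M) i i = c^-1.
  move=> im; apply: (mulfI c0); rewrite divff //.
  have := VM i i; rewrite (utri_mul_right _ _ _ hM) big1 => [|k kj]; last by rewrite V0 ?mul0r.
  by rewrite addr0 => ->; rewrite eqxx im.
split=> // i im; have im' := ltnW im.
have := VM i i.+1; rewrite (utri_mul_right _ _ _ hM) [i == i.+1]ltn_eqF // andbF.
rewrite (bigD1 (Ordinal im')) //= Vc // big1 ?addr0 => [H|k /andP[kj ki]]; last first.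
  rewrite V0 ?mul0r //; have : (k : nat) != i by apply: contraNneq ki => ki; apply/eqP/val_inj.
  by lia.
apply: contraTneq isT => V1; move: H; rewrite V1 mulr0 add0r => /eqP.
by rewrite mulf_eq0 invr_eq0 (negPf c0) (negPf (M1 i im)).
Qed.

End Triangular.

Section Transfer.
Variable K : fieldType.

(** Complements of ranges only depend on the ranges, so [f] and [f'] may be
    parametrized differently. *)
Lemma complementary_transfer (W W' V V' : zmodType) (f : W -> V) (f' : W' -> V')
    (D : V -> Prop) (D' : V' -> Prop) (h : V -> V') :
  (forall u v, h (u - v) = h u - h v) -> injective h ->
  (forall w', exists w, f' w' = h (f w)) -> (forall w, exists w', h (f w) = f' w') ->
  (forall v, D v <-> D' (h v)) -> complementary f' D' -> complementary f D.
Proof.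
move=> hB hi f'f ff' DD' [span indep]; split=> [v|w].
  have [w' Dw'] := span (h v); have [w fw] := f'f w'; exists w.
  by apply/DD'; rewrite hB -fw.
have [w' fw] := ff' w; move=> /DD'; rewrite fw => /indep; rewrite -fw => h0.
by apply: hi; rewrite h0 -(subrr (0 : V)) hB subrr.
Qed.

Lemma supported_tr p q (D : 'M[bool]_(p, q)) (U : 'M[K]_(p, q)) :
  supported D U <-> supported D^T U^T.
Proof.
split=> [DU i j|DU i j Dij]; first by rewrite !mxE; exact: DU.
by have := DU j i; rewrite !mxE; exact.
Qed.

Lemma supported_unit p q (D : 'M[bool]_(p, q)) i j : D i j -> supported D (unit_mx i j : 'M[K]_(p, q)).
Proof.
move=> Dij a b; rewrite -entryE entry_unit !ltn_ord /=.
by case: eqP => [/val_inj ->|_ //]; case: eqP => [/val_inj ->|_ //]; rewrite Dij.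
Qed.

Lemma supported_nostar p q (D : 'M[bool]_(p, q)) : (forall i j, ~~ D i j) ->
  forall U : 'M[K]_(p, q), supported D U <-> U = 0.
Proof.
by move=> D0 U; split=> [DU|-> i j _]; [apply/matrixP => i j; rewrite DU ?mxE | rewrite mxE].
Qed.

End Transfer.

(** * Sylvester operators *)

Section Sylvester.
Variable K : fieldType.
Variables (n m : nat) (L : 'M[K]_n) (M : 'M[K]_m) (c d : K).
Hypotheses (hL : utri c L^T) (hM : utri d M).

Definition sylvester n m (L : 'M[K]_n) (M : 'M[K]_m) (R : 'M[K]_(n, m)) := L *m R - R *m M.

Lemma sylvester_linear : linear (sylvester L M).
Proof.
move=> a R S; rewrite /sylvester mulmxDr mulmxDl -scalemxAr -scalemxAl scalerBr.
by rewrite opprD addrACA.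
Qed.

(** On the first two antidiagonals that are possibly occupied, [sylvester L M]
    acts through the diagonals of [L] and [M] and the entries next to them. *)
Lemma sylvester_lead s (R : 'M[K]_(n, m)) : deg_ge s R ->
  forall i j, (i + j <= s.+1)%N -> entry (sylvester L M R) i j =
    (c - d) * entry R i j + prd i (fun i' => entry L i'.+1 i' * entry R i' j)
    - prd j (fun j' => entry R i j' * entry M j' j'.+1).
Proof.
move=> hR i j ij; rewrite entryB (ltri_mulmx_lead hL hR) // (mulmx_utri_lead hM hR) //.
by rewrite mulrBl; ring.
Qed.

Lemma sub_diag_neq0 i : (i.+1 < n)%N -> entry L i.+1 i != 0.
Proof. by case: hL => _ _ h /h; rewrite entry_tr. Qed.

Lemma super_diag_neq0 j : (j.+1 < m)%N -> entry M j j.+1 != 0.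
Proof. by case: hM => _ _ h /h. Qed.

(** With distinct eigenvalues the leading term is multiplication by the
    nonzero scalar [c - d]. *)
Lemma sylvester_onto : c != d -> forall U, exists R, U = sylvester L M R.
Proof.
move=> cd; have cd0 : c - d != 0 by rewrite subr_eq0.
have Ql := range_lin sylvester_linear (supported_lin (const_mx false : 'M[bool]_(n, m))).
suff H U : exists R, supported (const_mx false : 'M[bool]_(n, m)) (U - sylvester L M R).
  move=> U; have [R DR] := H U; exists R; apply/eqP; rewrite -subr_eq0; apply/eqP.
  by apply/(supported_nostar (D := const_mx false)) => // i j; rewrite mxE.
apply: (filtered_span Ql) => i j im jn.
have h1 : mod_deg (fun U => exists R, supported (const_mx false : 'M[bool]_(n, m)) (U - sylvester L M R))
    (i + j) (sylvester L M ((c - d)^-1 *: unit_mx i j)).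
  by apply: mod_deg_sub; exists ((c - d)^-1 *: unit_mx i j); rewrite subrr; case: (supported_lin (K := K) (const_mx false : 'M[bool]_(n, m))).
apply: mod_deg_congr h1 => // a b; rewrite ltnS => ab.
have hU : deg_ge (i + j) ((c - d)^-1 *: unit_mx i j : 'M[K]_(n, m)).
  exact: lin_closedZ (deg_ge_lin _) (deg_ge_unit i j).
rewrite entryB (sylvester_lead hU) ?(leqW ab) // entryZ mulrA divff // mul1r.
rewrite addrAC addrC -addrA; case: a ab => [|a] ab /=; case: b ab => [|b] ab /=; rewrite ?hU ?mulr0 ?mul0r; try lia; ring.
Qed.

Hypothesis cd : c = d.

(** The image of [unit_mx i j] has as leading term a combination with nonzero
    coefficients of [unit_mx i.+1 j] and [unit_mx i j.+1].  Hence all units of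
    an antidiagonal are multiples of each other modulo the range, and they lie
    in it as soon as the antidiagonal leaves the matrix, since then one of the
    two is absent.  The other antidiagonals are those with [s < minn n m]. *)
Lemma sylvester_span (D : 'M[bool]_(n, m)) :
  (forall s, (s < minn n m)%N -> exists (i : 'I_n) (j : 'I_m), (i + j)%N = s /\ D i j) ->
  forall U, exists R, supported D (U - sylvester L M R).
Proof.
move=> stars; pose Q U := exists R, supported D (U - sylvester L M R).
have Ql : lin_closed Q := range_lin sylvester_linear (supported_lin D).
have Qf R : Q (sylvester L M R) by exists R; rewrite subrr; case: (supported_lin (K := K) D).
have lead i j s : (i + j).+1 = s -> mod_deg Q s
    (entry L i.+1 i *: unit_mx i.+1 j - entry M j j.+1 *: unit_mx i j.+1).
  move=> ijs; have [/andP[im jn]|out] := boolP ((i < n) && (j < m))%N; last first.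
    rewrite !unit_mx_out ?scaler0 ?subr0; try by move: out; lia.
    by case: (mod_deg_lin s Ql).
  apply: (mod_deg_congr (U := sylvester L M (unit_mx i j))) => //; last exact: mod_deg_sub.
  move=> a b; rewrite ltnS => ab.
  rewrite entryB (sylvester_lead (deg_ge_unit _ _)) ?ijs // entryB !entryZ !entry_unit cd subrr mul0r add0r.
  have -> : prd a (fun i' => entry L i'.+1 i' * entry (unit_mx i j : 'M_(n, m)) i' b) =
      entry L i.+1 i * (if [&& (i.+1 < n)%N, (j < m)%N, a == i.+1 & b == j] then 1 else 0).
    case: a ab => [|a] ab /=; first by rewrite !andbF mulr0.
    rewrite entry_unit im jn eqSS /=; case: (eqVneq a i) => [->|_]; rewrite ?andbF ?mulr0 //=.
    case: (ltnP i.+1 n) => [//|ni]; rewrite entry_out ?mul0r //; lia.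
  have -> : prd b (fun j' => entry (unit_mx i j : 'M_(n, m)) a j' * entry M j' j'.+1) =
      entry M j j.+1 * (if [&& (i < n)%N, (j.+1 < m)%N, a == i & b == j.+1] then 1 else 0).
    case: b ab => [|b] ab /=; first by rewrite !andbF mulr0.
    rewrite entry_unit im jn eqSS /=; case: (eqVneq b j) => [->|_]; rewrite ?andbF ?mulr0 ?mul0r //=.
    rewrite mulrC; case: (ltnP j.+1 m) => [//|ni]; rewrite entry_out ?mul0r //; lia.
  by rewrite subrr.
have Ql' s := mod_deg_lin s Ql.
apply: (filtered_span Ql) => i0 j0 i0n j0m; set s := (i0 + j0)%N.
have adj i j : (i.+1 < n)%N -> (j.+1 < m)%N -> (i + j).+1 = s ->
    mod_deg Q s (unit_mx i.+1 j) <-> mod_deg Q s (unit_mx i j.+1).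
  move=> im jn ijs; have := lead i j s ijs.
  have l0 := sub_diag_neq0 im; have m0 := super_diag_neq0 jn; set X := _ - _ => QX.
  split=> QU.
    have -> : unit_mx i j.+1 = (entry M j j.+1)^-1 *: (entry L i.+1 i *: unit_mx i.+1 j - X).
      by rewrite /X subKr scalerA mulVf // scale1r.
    by apply: lin_closedZ => //; apply: lin_closedB => //; apply: lin_closedZ.
  have -> : unit_mx i.+1 j = (entry L i.+1 i)^-1 *: (X + entry M j j.+1 *: unit_mx i j.+1).
    by rewrite /X subrK scalerA mulVf // scale1r.
  by apply: lin_closedZ => //; apply: lin_closedD => //; apply: lin_closedZ.
suff [i1 [j1 [i1n j1m ij1 Q1]]] : exists i1 j1, [/\ (i1 < n)%N, (j1 < m)%N, (i1 + j1)%N = s &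
    mod_deg Q s (unit_mx i1 j1)].
  exact: (@antidiagonal_connected n m (fun i j => mod_deg Q s (unit_mx i j)) s adj
    i1 j1 i1n j1m ij1 Q1).
have [smin|sge] := ltnP s (minn n m).
  have [i [j [ij Dij]]] := stars s smin; exists i, j; split=> //.
  apply: mod_deg_sub; exists 0; have [S0 _] := range_lin sylvester_linear (supported_lin (K := K) D).
  have -> : sylvester L M 0 = 0 by rewrite /sylvester mulmx0 mul0mx subr0.
  by rewrite subr0; exact: supported_unit.
have [ns|ms] : (n <= s)%N \/ (m <= s)%N by lia.
  exists n.-1, (s - n.-1)%N; split; try lia.
  have := lead n.-1 (s - n)%N s; rewrite prednK ?(leq_ltn_trans _ i0n) // => /(_ ltac:(lia)).
  rewrite (@unit_mx_out K n m n _) ?ltnn // scaler0 sub0r -scaleNr.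
  have -> : ((s - n).+1 = s - n.-1)%N by lia.
  have m0 : - entry M (s - n)%N (s - n.-1)%N != 0.
    rewrite oppr_eq0 (_ : s - n.-1 = (s - n).+1)%N; last by lia.
    by apply: super_diag_neq0; lia.
  by move=> /(lin_closedZ (- entry M (s - n)%N (s - n.-1)%N)^-1 (Ql' s)); rewrite scalerA mulVf // scale1r.
exists (s - m.-1)%N, m.-1; split; try lia.
have := lead (s - m)%N m.-1 s; rewrite prednK ?(leq_ltn_trans _ j0m) // => /(_ ltac:(lia)).
rewrite (@unit_mx_out K n m _ m) ?ltnn ?andbF // scaler0 subr0.
have -> : ((s - m).+1 = s - m.-1)%N by lia.
have l0 : entry L (s - m.-1)%N (s - m)%N != 0.
  rewrite (_ : s - m.-1 = (s - m).+1)%N; last by lia.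
  by apply: sub_diag_neq0; lia.
by move=> /(lin_closedZ (entry L (s - m.-1)%N (s - m)%N)^-1 (Ql' s)); rewrite scalerA mulVf // scale1r.
Qed.

(** If the image vanishes outside the first column, column [j.+1] of the
    image determines column [j] of [R] from earlier entries, which kills [R]
    on the antidiagonals up to [m - 2].  The first column of [L R - R M] only
    involves those entries, thanks to [n <= m]. *)
Lemma sylvester_indep (D : 'M[bool]_(n, m)) : (n <= m)%N -> (forall i j, D i j -> j = 0%N :> nat) ->
  forall R, supported D (sylvester L M R) -> sylvester L M R = 0.
Proof.
move=> nm Dcol R DR; set U := sylvester L M R in DR *.
have U0 i j : (0 < j)%N -> entry U i j = 0.
  move=> j0; have [/andP[im jn]|] := boolP ((i < n) && (j < m))%N; last exact: entry_out.
  rewrite (entry_in _ im jn) DR //; apply/negP => /Dcol /=; lia.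
have UE i j : entry U i j = \sum_(k < n | (k < i)%N) entry L i k * entry R k j
     - \sum_(k < m | (k < j)%N) entry R i k * entry M k j.
  rewrite /U /sylvester entryB (utri_mul_right _ _ _ hM) -[entry (L *m R) i j]entry_tr trmx_mul.
  rewrite (utri_mul_right _ _ _ hL) cd entry_tr opprD addrACA subrr add0r; congr (_ - _).
  by apply: eq_bigr => k _; rewrite !entry_tr mulrC.
have R0 i j : (i + j <= m - 2)%N -> (1 < m)%N -> entry R i j = 0.
  move=> ij m1; elim/ltn_ind: i j ij => i IHi j; elim/ltn_ind: j => j IHj ij.
  have jm : (j.+1 < m)%N by lia.
  have := U0 i j.+1 isT; rewrite UE big1 => [|k ki]; last by rewrite IHi ?mulr0 //; lia.
  rewrite (bigD1 (Ordinal (ltnW jm))) //= big1 => [|k /andP[kj kj']]; last first.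
    have kj2 : (k : nat) != j by apply: contraNneq kj' => kj'; apply/eqP/val_inj.
    by rewrite IHj ?mul0r //; lia.
  rewrite addr0 sub0r => /eqP; rewrite oppr_eq0 mulf_eq0 (negPf (super_diag_neq0 jm)) orbF.
  by move=> /eqP.
apply: entryP => i j im jn; rewrite entry0; case: j jn => [|j] jn; last exact: U0.
rewrite UE [X in _ - X]big1 // subr0 big1 // => k ki.
by rewrite R0 ?mulr0 //; lia.
Qed.

End Sylvester.

Section SylvesterLines.
Variable K : fieldType.

Lemma sylvester_col n m (L : 'M[K]_n) (M : 'M[K]_m) c (D : 'M[bool]_(n, m)) :
  utri c L^T -> utri c M -> (n <= m)%N -> (forall i j, D i j = (j == 0%N :> nat)) ->
  complementary (sylvester L M) (supported D).
Proof.
move=> hL hM nm DE; split; last by apply: (sylvester_indep hL hM) => // i j; rewrite DE => /eqP.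
apply: (sylvester_span hL hM) => // s smin.
have sn : (s < n)%N by lia.
have m0 : (0 < m)%N by lia.
by exists (Ordinal sn), (Ordinal m0); rewrite DE /= addn0.
Qed.

(** Transposition exchanges the two factors, hence rows and columns. *)
Lemma sylvester_row n m (L : 'M[K]_n) (M : 'M[K]_m) c (D : 'M[bool]_(n, m)) :
  utri c L^T -> utri c M -> (m <= n)%N -> (forall i j, D i j = (i == 0%N :> nat)) ->
  complementary (sylvester L M) (supported D).
Proof.
move=> hL hM nm DE.
have T R : (sylvester L M R)^T = sylvester M^T L^T (- R^T).
  by rewrite /sylvester raddfB /= !trmx_mul mulmxN mulNmx opprK addrC.
apply: (complementary_transfer (h := @trmx K n m) (f' := sylvester M^T L^T) (D' := supported D^T)).
- by move=> u v; rewrite raddfB.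
- exact: trmx_inj.
- by move=> w; exists (- w^T); rewrite T raddfN /= trmxK opprK.
- by move=> w; exists (- w^T); rewrite T.
- exact: supported_tr.
- by apply: (sylvester_col (c := c)); rewrite ?trmxK // => i j; rewrite mxE DE.
Qed.

End SylvesterLines.

(** * The operator Y + Y^T Phi *)

Lemma half_double (K : numFieldType) (V : lmodType K) (v : V) : 2%:R^-1 *: (v + v) = v.
Proof. by rewrite -{1 2}[v]scale1r -scalerDl scalerA mulVf ?scale1r ?pnatr_eq0. Qed.

Section SelfCongruence.
Variable K : numFieldType.
Variables (n : nat) (Phi : 'M[K]_n) (eta : K).
Hypothesis hPhi : utri eta Phi.

Definition self_map n (Phi : 'M[K]_n) (Y : 'M[K]_n) := Y + Y^T *m Phi.

Lemma self_map_linear (P : 'M[K]_n) : linear (self_map P).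
Proof.
move=> a Y Z; rewrite /self_map linearD linearZ /= mulmxDl -scalemxAl scalerDr.
by rewrite addrACA.
Qed.

Lemma deg_ge_tr s (Y : 'M[K]_n) : deg_ge s Y -> deg_ge s Y^T.
Proof. by move=> hY i j ij; rewrite entry_tr hY // addnC. Qed.

Lemma self_map_lead s (Y : 'M[K]_n) : deg_ge s Y ->
  forall i j, (i + j <= s.+1)%N -> entry (self_map Phi Y) i j =
    entry Y i j + eta * entry Y j i + prd j (fun j' => entry Y j' i * entry Phi j' j'.+1).
Proof.
move=> hY i j ij; rewrite entryD (mulmx_utri_lead hPhi (deg_ge_tr hY)) // entry_tr addrA.
by congr (_ + _); case: j {ij} => //= j; rewrite entry_tr.
Qed.

Lemma conj_utri_lead s (Y : 'M[K]_n) : deg_ge s Y ->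
  forall i j, (i + j <= s.+1)%N -> entry (Phi^T *m Y *m Phi) i j =
    eta ^+ 2 * entry Y i j + eta * (prd i (fun i' => entry Phi i' i'.+1 * entry Y i' j)
       + prd j (fun j' => entry Phi j' j'.+1 * entry Y i j')).
Proof.
move=> hY i j ij; have hPT : utri eta Phi^T^T by rewrite trmxK.
have hZ : deg_ge s (Phi^T *m Y).
  move=> a b ab; rewrite (ltri_mulmx_lead hPT hY); last by lia.
  rewrite hY // mulr0 add0r; case: a ab => //= a ab; rewrite hY ?mulr0 //; lia.
rewrite (mulmx_utri_lead hPhi hZ) // (ltri_mulmx_lead hPT hY) //.
have -> : prd j (fun j' => entry (Phi^T *m Y) i j' * entry Phi j' j'.+1) =
   eta * prd j (fun j' => entry Phi j' j'.+1 * entry Y i j').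
  case: j ij => [|j] ij /=; first by rewrite mulr0.
  rewrite (ltri_mulmx_lead hPT hY); last by lia.
  have -> : prd i (fun i' => entry Phi^T i'.+1 i' * entry Y i' j) = 0.
    by case: i ij => //= i ij; rewrite [entry Y _ _]hY ?mulr0 //; lia.
  by rewrite addr0; ring.
have -> : prd i (fun i' => entry Phi^T i'.+1 i' * entry Y i' j) =
   prd i (fun i' => entry Phi i' i'.+1 * entry Y i' j).
  by case: (i) => //= i'; rewrite entry_tr.
by ring.
Qed.

(** The symmetry of the operator: its range contains the values of
    [Y |-> Phi^T Y Phi - Y], which identifies neighbours on an antidiagonal just
    as a Sylvester operator does. *)
Lemma self_map_twice (Y : 'M[K]_n) :
  Phi^T *m Y *m Phi - Y = self_map Phi (Y^T *m Phi) - self_map Phi Y.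
Proof.
rewrite /self_map trmx_mul trmxK.
by apply/matrixP => i j; rewrite ![in LHS]mxE ![in RHS]mxE; ring.
Qed.

(** Modulo later antidiagonals the operator is [Y |-> Y + eta Y^T], which is
    invertible when [eta ^+ 2 != 1]. *)
Lemma self_map_onto : eta ^+ 2 != 1 -> forall U, exists Y, U = self_map Phi Y.
Proof.
move=> e2; have e0 : 1 - eta ^+ 2 != 0 by rewrite subr_eq0 eq_sym.
have SL := supported_lin (K := K) (const_mx false : 'M[bool]_n).
have Ql := range_lin (self_map_linear Phi) SL.
suff H U : exists R, supported (const_mx false : 'M[bool]_n) (U - self_map Phi R).
  move=> U; have [R DR] := H U; exists R; apply/eqP; rewrite -subr_eq0; apply/eqP.
  by apply/(supported_nostar (D := const_mx false)) => // i j; rewrite mxE.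
apply: (filtered_span Ql) => i j im jn.
set Q := (fun U => _) in Ql *.
have Qf R s : mod_deg Q s (self_map Phi R).
  by apply: mod_deg_sub; exists R; rewrite subrr; case: SL.
pose V : 'M[K]_n := (1 - eta ^+ 2)^-1 *: (unit_mx i j - eta *: unit_mx j i).
have hV : deg_ge (i + j) V.
  apply: (lin_closedZ _ (deg_ge_lin _)); apply: (lin_closedB (deg_ge_lin _)); first exact: deg_ge_unit.
  by apply: (lin_closedZ _ (deg_ge_lin _)); rewrite addnC; exact: deg_ge_unit.
apply: mod_deg_congr (Qf V _) => // a b; rewrite ltnS => ab.
rewrite entryB (self_map_lead hV) ?(leqW ab) //.
have -> : prd b (fun j' => entry V j' a * entry Phi j' j'.+1) = 0.
  by case: b ab => //= b ab; rewrite hV ?mul0r //; lia.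
rewrite addr0 !entryZ !entryB !entryZ !entry_unit im jn /= [a == j]eq_sym [b == i]eq_sym.
rewrite [b == j]eq_sym [a == i]eq_sym.
move: e0; set d := 1 - _ => d0.
have aux (x y : K) : d^-1 * (x - eta * y) + eta * (d^-1 * (y - eta * x)) - x = 0.
  by apply: (mulfI d0); rewrite mulr0 mulrBr mulrDr mulVKf // mulrCA mulVKf // /d; ring.
by rewrite [(i == b) && _]andbC [(j == b) && _]andbC; exact: aux.
Qed.

Hypothesis eta2 : eta ^+ 2 = 1.

Let eta0 : eta != 0. Proof. by rewrite -sqrf_eq0 eta2 oner_eq0. Qed.

Lemma super_neq0 i : (i.+1 < n)%N -> entry Phi i i.+1 != 0.
Proof. by case: hPhi => _ _ h /h. Qed.

(** By [self_map_twice] all units of an antidiagonal are equivalent up to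
    nonzero scalars modulo the range, and lie in it if the antidiagonal leaves
    the matrix.  The leading term [unit_mx i j + eta *: unit_mx j i]
    at the middle of the antidiagonal then shows that they lie in the range as
    well, except when [eta * (-1) ^+ s = -1], where it gives nothing new. *)
Lemma self_map_span (D : 'M[bool]_n) :
  (forall s, (s < n)%N -> eta * (-1) ^+ s = -1 -> exists i j : 'I_n, (i + j)%N = s /\ D i j) ->
  forall U, exists Y, supported D (U - self_map Phi Y).
Proof.
move=> stars; pose Q U := exists R, supported D (U - self_map Phi R).
have Ql : lin_closed Q := range_lin (self_map_linear Phi) (supported_lin D).
have Qf R : Q (self_map Phi R) by exists R; rewrite subrr; case: (supported_lin (K := K) D).
have Ql' s := mod_deg_lin s Ql.
have lead i j s : (i + j).+1 = s -> mod_deg Q s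
    (entry Phi i i.+1 *: unit_mx i.+1 j + entry Phi j j.+1 *: unit_mx i j.+1).
  move=> ijs; have [/andP[im jn]|out] := boolP ((i < n) && (j < n))%N; last first.
    rewrite !unit_mx_out ?scaler0 ?addr0; try by move: out; lia.
    by case: (Ql' s).
  have QY : mod_deg Q s (eta *: (Phi^T *m unit_mx i j *m Phi - unit_mx i j)).
    apply: lin_closedZ => //; rewrite self_map_twice; apply: mod_deg_sub.
    exact: lin_closedB.
  apply: mod_deg_congr QY => // a b; rewrite ltnS => ab.
  rewrite entryB entryZ entryB (conj_utri_lead (deg_ge_unit _ _)) ?ijs // eta2 mul1r.
  have cancel_eta (x p : K) : eta * (x + eta * p - x) = p.
    by transitivity (eta ^+ 2 * p); [ring | rewrite eta2 mul1r].
  rewrite cancel_eta entryD !entryZ !entry_unit.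
  have -> : prd a (fun i' => entry Phi i' i'.+1 * entry (unit_mx i j : 'M_n) i' b) =
      entry Phi i i.+1 * (if [&& (i.+1 < n)%N, (j < n)%N, a == i.+1 & b == j] then 1 else 0).
    case: a ab => [|a] ab /=; first by rewrite !andbF mulr0.
    rewrite entry_unit im jn eqSS /=; case: (eqVneq a i) => [->|_]; rewrite ?andbF ?mulr0 //=.
    by case: (ltnP i.+1 n) => [//|ni]; rewrite entry_out ?mul0r //; lia.
  have -> : prd b (fun j' => entry Phi j' j'.+1 * entry (unit_mx i j : 'M_n) a j') =
      entry Phi j j.+1 * (if [&& (i < n)%N, (j.+1 < n)%N, a == i & b == j.+1] then 1 else 0).
    case: b ab => [|b] ab /=; first by rewrite !andbF mulr0.
    rewrite entry_unit im jn eqSS /=; case: (eqVneq b j) => [->|_]; rewrite ?andbF ?mulr0 //=.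
    by case: (ltnP j.+1 n) => [//|ni]; rewrite entry_out ?mul0r //; lia.
  by rewrite subrr.
apply: (filtered_span Ql) => i0 j0 i0n j0n; set s := (i0 + j0)%N.
have adj i j : (i.+1 < n)%N -> (j.+1 < n)%N -> (i + j).+1 = s ->
    mod_deg Q s (unit_mx i.+1 j) <-> mod_deg Q s (unit_mx i j.+1).
  move=> im jn ijs; have := lead i j s ijs.
  have l0 := super_neq0 im; have m0 := super_neq0 jn; set X := _ + _ => QX.
  split=> QU.
    have -> : unit_mx i j.+1 = (entry Phi j j.+1)^-1 *: (X - entry Phi i i.+1 *: unit_mx i.+1 j).
      by rewrite /X addrC addKr scalerA mulVf // scale1r.
    by apply: lin_closedZ => //; apply: lin_closedB => //; apply: lin_closedZ.
  have -> : unit_mx i.+1 j = (entry Phi i i.+1)^-1 *: (X - entry Phi j j.+1 *: unit_mx i j.+1).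
    by rewrite /X addrK scalerA mulVf // scale1r.
  by apply: lin_closedZ => //; apply: lin_closedB => //; apply: lin_closedZ.
suff [i1 [j1 [i1n j1n ij1 Q1]]] : exists i1 j1, [/\ (i1 < n)%N, (j1 < n)%N, (i1 + j1)%N = s &
    mod_deg Q s (unit_mx i1 j1)].
  exact: (@antidiagonal_connected n n (fun i j => mod_deg Q s (unit_mx i j)) s adj
    i1 j1 i1n j1n ij1 Q1).
have [sn|ns] := ltnP s n; last first.
  exists n.-1, (s - n.-1)%N; split; try lia.
  have := lead n.-1 (s - n)%N s; rewrite prednK ?(leq_ltn_trans _ i0n) // => /(_ ltac:(lia)).
  rewrite (@unit_mx_out K n n n _) ?ltnn // scaler0 add0r.
  have -> : ((s - n).+1 = s - n.-1)%N by lia.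
  have m0 : entry Phi (s - n)%N (s - n.-1)%N != 0.
    rewrite (_ : s - n.-1 = (s - n).+1)%N; last by lia.
    by apply: super_neq0; lia.
  by move=> /(lin_closedZ (entry Phi (s - n)%N (s - n.-1)%N)^-1 (Ql' s)); rewrite scalerA mulVf // scale1r.
have [es|es] : eta * (-1) ^+ s = -1 \/ eta * (-1) ^+ s = 1.
  have /eqP : (eta * (-1) ^+ s) ^+ 2 = 1 by rewrite exprMn eta2 mul1r -exprM mulnC exprM sqrrN !expr1n.
  by rewrite sqrf_eq1 => /orP[/eqP|/eqP] ->; [right | left].
  have [i [j [ij Dij]]] := stars s sn es; exists i, j; split=> //.
  apply: mod_deg_sub; exists 0.
  have -> : self_map Phi 0 = 0 by rewrite /self_map trmx0 mul0mx addr0.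
  by rewrite subr0; exact: supported_unit.
(* the relation that [self_map] itself gives on the antidiagonal, used at its middle *)
have mid i j : (i < n)%N -> (j < n)%N -> (i + j)%N = s ->
    mod_deg Q s (unit_mx i j + eta *: unit_mx j i).
  move=> im jn ijs; apply: mod_deg_congr (mod_deg_sub s (Qf (unit_mx i j))) => // a b; rewrite ltnS => ab.
  rewrite entryB (self_map_lead (deg_ge_unit _ _)) ?ijs ?(leqW ab) // entryD entryZ.
  have -> : prd b (fun j' => entry (unit_mx i j : 'M_n) j' a * entry Phi j' j'.+1) = 0.
    by case: b ab => //= b ab; rewrite (deg_ge_unit i j) ?mul0r //; lia.
  rewrite addr0 !entry_unit im jn /= [(b == i) && _]andbC subrr //.
have [se|so] := boolP (odd s).
  have e1 : eta = -1 by move: es; rewrite -signr_odd se expr1 mulrN1 => <-; rewrite opprK.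
  exists s./2.+1, s./2; split; try lia.
  have hadj := lead s./2 s./2 s ltac:(lia); have hmid := mid s./2.+1 s./2 ltac:(lia) ltac:(lia) ltac:(lia).
  rewrite -scalerDr in hadj; rewrite e1 scaleN1r in hmid.
  have p0 : entry Phi s./2 s./2.+1 != 0 by apply: super_neq0; lia.
  have := lin_closedZ (entry Phi s./2 s./2.+1)^-1 (Ql' s) hadj; rewrite scalerA mulVf // scale1r => hadj'.
  have := lin_closedZ 2^-1 (Ql' s) (lin_closedD (Ql' s) hadj' hmid).
  by rewrite addrACA subrr addr0 half_double.
have e1 : eta = 1 by move: es; rewrite -signr_odd (negPf so) expr0 mulr1.
exists s./2, s./2; split; try lia.
have := mid s./2 s./2 ltac:(lia) ltac:(lia) ltac:(lia).
rewrite e1 scale1r => /(lin_closedZ 2^-1 (Ql' s)).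
by rewrite half_double.
Qed.

(** The converse elimination: the vanishing of the columns other than the
    first kills [Y] on the antidiagonals before the main one, so that the first
    column and the first row of the image are given by the first column and the
    first row of [Y] alone, and determine each other. *)
Lemma self_map_indep (D : 'M[bool]_n) :
  (forall i j : 'I_n, D i j -> j = 0%N :> nat /\ eta * (-1) ^+ i = -1) ->
  forall Y, supported D (self_map Phi Y) -> self_map Phi Y = 0.
Proof.
move=> Dcol Y DY; set U := self_map Phi Y in DY *.
have two0 : (2 : K) != 0 by rewrite pnatr_eq0.
have U0 i j : (0 < j)%N -> entry U i j = 0.
  move=> j0; have [/andP[im jn]|] := boolP ((i < n) && (j < n))%N; last exact: entry_out.
  by rewrite (entry_in _ im jn) DY //; apply/negP => /Dcol[/=]; lia.
have Ui i : eta * (-1) ^+ i = 1 -> entry U i 0 = 0.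
  move=> ei; have [/andP[im jn]|] := boolP ((i < n) && (0 < n))%N; last exact: entry_out.
  rewrite (entry_in _ im jn) DY //; apply/negP => /Dcol[/= _]; rewrite ei => /eqP.
  by rewrite -subr_eq0 opprK -[1 + 1]/(2 : K) (negPf two0).
have rel i j : (0 < i)%N -> entry (Phi^T *m Y *m Phi) i j - entry Y i j = - entry U i j.
  move=> i0; have -> : entry (Phi^T *m Y *m Phi) i j - entry Y i j = entry (U^T *m Phi - U) i j.
    rewrite -entryB; congr (entry _ i j); rewrite /U /self_map raddfD /= trmx_mul trmxK mulmxDl.
    by apply/matrixP => a b; rewrite ![in LHS]mxE ![in RHS]mxE; ring.
  rewrite entryB entry_mul big1 ?sub0r // => k _.
  by rewrite entry_tr U0 ?mul0r.
have degY t : (t < n)%N -> deg_ge t Y.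
  elim: t => [|t IH] tn; first by move=> i j; rewrite ltn0.
  have hY := IH (ltnW tn).
  have adj i j : (i.+1 < n)%N -> (j.+1 < n)%N -> (i + j).+1 = t ->
      entry Y i.+1 j = 0 <-> entry Y i j.+1 = 0.
    move=> im jn ijt; have := rel i.+1 j.+1 isT.
    rewrite (conj_utri_lead hY) ?eta2 ?mul1r; last by lia.
    rewrite U0 // oppr0 addrAC subrr add0r /= => /eqP; rewrite mulf_eq0 (negPf eta0) /= => /eqP H.
    split=> Y0; move: H; rewrite Y0 mulr0 ?add0r ?addr0 => /eqP.
      by rewrite mulf_eq0 (negPf (super_neq0 im)) => /eqP.
    by rewrite mulf_eq0 (negPf (super_neq0 jn)) => /eqP.
  suff [i1 [j1 [i1n j1n ij1 Y1]]] : exists i1 j1, [/\ (i1 < n)%N, (j1 < n)%N, (i1 + j1)%N = t &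
      entry Y i1 j1 = 0].
    have H := @antidiagonal_connected n n (fun i j => entry Y i j = 0) t adj i1 j1 i1n j1n ij1 Y1.
    move=> i j; rewrite ltnS leq_eqVlt => /orP[/eqP ij|]; last exact: hY.
    by apply: H; lia.
  have [et|et] : eta * (-1) ^+ t = -1 \/ eta * (-1) ^+ t = 1.
    have /eqP : (eta * (-1) ^+ t) ^+ 2 = 1 by rewrite exprMn eta2 mul1r -exprM mulnC exprM sqrrN !expr1n.
    by rewrite sqrf_eq1 => /orP[/eqP|/eqP] ->; [right | left].
    exists t, 0%N; split; try lia.
    have := rel t.+1 0%N isT; rewrite (conj_utri_lead hY) ?eta2 ?mul1r; last by lia.
    rewrite Ui ?exprS; last by rewrite mulN1r mulrN et opprK.
    rewrite oppr0 addrAC subrr add0r /= addr0 => /eqP.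
    by rewrite !mulf_eq0 (negPf eta0) (negPf (super_neq0 tn)) => /eqP.
  have sym i j : (i + j)%N = t -> entry Y i j + eta * entry Y j i = 0.
    move=> ijt; have := self_map_lead hY (i := i) (j := j); rewrite ijt => /(_ (leqW (leqnn _))).
    have -> : prd j (fun j' => entry Y j' i * entry Phi j' j'.+1) = 0.
      by case: j ijt => //= j ijt; rewrite hY ?mul0r //; lia.
    rewrite addr0 -/U => <-; case: j ijt => [|j] ijt; last exact: U0.
    by apply: Ui; rewrite -(addn0 i) ijt.
  have [se|so] := boolP (odd t).
    have e1 : eta = -1 by move: et; rewrite -signr_odd se expr1 mulrN1 => <-; rewrite opprK.
    exists t./2.+1, t./2; split; try lia.
    have := sym t./2.+1 t./2 ltac:(lia); rewrite e1 mulN1r => /subr0_eq Ysym.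
    have := rel t./2.+1 t./2.+1 isT; rewrite (conj_utri_lead hY) ?eta2 ?mul1r; last by lia.
    rewrite U0 // oppr0 addrAC subrr add0r /= -Ysym -mulr2n -mulr_natl => /eqP.
    rewrite !mulf_eq0 (negPf eta0) (negPf two0) /= (negPf (super_neq0 _)); last by lia.
    by move=> /eqP.
  have e1 : eta = 1 by move: et; rewrite -signr_odd (negPf so) expr0 mulr1.
  exists t./2, t./2; split; try lia.
  have := sym t./2 t./2 ltac:(lia); rewrite e1 mul1r -mulr2n -mulr_natl => /eqP.
  by rewrite mulf_eq0 (negPf two0) => /eqP.
apply: entryP => i j im jn; rewrite entry0; case: j jn => [|j] jn; last exact: U0.
have hY : deg_ge n.-1 Y by apply: degY; lia.
have Ui0 : entry U i 0 = entry Y i 0 + eta * entry Y 0 i.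
  by rewrite (self_map_lead hY) /= ?addr0 //; lia.
have U0i : entry U 0 i = entry Y 0 i + eta * entry Y i 0.
  rewrite (self_map_lead hY); last by lia.
  rewrite -[RHS]addr0; congr (_ + _).
  by case: (i) im => [|i'] im //=; rewrite hY ?mul0r //; lia.
case: i im Ui0 U0i => [|i] im Ui0 U0i.
  have /eqP : eta ^+ 2 = 1 by [].
  rewrite sqrf_eq1 => /orP[/eqP e1|/eqP e1]; first by apply: Ui; rewrite e1 mul1r.
  by rewrite Ui0 e1 mulN1r subrr.
rewrite U0 // in U0i; rewrite Ui0; apply: (mulfI eta0).
by rewrite mulr0 [RHS]U0i mulrDr mulrA -expr2 eta2 mul1r addrC.
Qed.

End SelfCongruence.

Section SelfCongruenceLines.
Variable K : numFieldType.

Lemma self_map_col n (Phi : 'M[K]_n) eta (D : 'M[bool]_n) : utri eta Phi -> eta ^+ 2 = 1 ->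
  (forall i j, D i j <-> j = 0%N :> nat /\ eta * (-1) ^+ i = -1) ->
  complementary (self_map Phi) (supported D).
Proof.
move=> hP e2 DE; split; last by apply: (self_map_indep hP e2) => i j /DE.
apply: (self_map_span hP e2) => s sn es.
have n0 : (0 < n)%N by lia.
by exists (Ordinal sn), (Ordinal n0); rewrite addn0; split=> //; apply/DE.
Qed.

(** Transposition turns [Phi] into its inverse, which has the same
    eigenvalue because [eta ^+ 2 = 1]. *)
Lemma self_map_row n (Phi : 'M[K]_n) eta (D : 'M[bool]_n) : utri eta Phi -> eta ^+ 2 = 1 ->
  (forall i j, D i j <-> i = 0%N :> nat /\ eta * (-1) ^+ j = -1) ->
  complementary (self_map Phi) (supported D).
Proof.
move=> hP e2 DE; have e0 : eta != 0 by rewrite -sqrf_eq0 e2 oner_eq0.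
have uP := utri_unit hP e0.
have uPT : Phi^T \in unitmx by rewrite unitmx_tr.
have T Y : (self_map Phi Y)^T = self_map (invmx Phi) (Phi^T *m Y).
  rewrite /self_map raddfD /= !trmx_mul !trmxK -mulmxA mulmxV // mulmx1 addrC.
  by [].
have eV : eta^-1 = eta by apply: (mulfI e0); rewrite divff // -expr2 e2.
apply: (complementary_transfer (h := @trmx K n n) (f' := self_map (invmx Phi)) (D' := supported D^T)).
- by move=> u v; rewrite raddfB.
- exact: trmx_inj.
- by move=> w; exists (invmx Phi^T *m w); rewrite T mulKVmx.
- by move=> w; exists (Phi^T *m w); rewrite T.
- exact: supported_tr.
- apply: (self_map_col (eta := eta)) => //; first by rewrite -{1}eV; exact: utri_inv.
  by move=> i j; rewrite mxE; exact: DE.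
Qed.

End SelfCongruenceLines.

(** * Moving the stars to another corner *)

Section Flips.

Definition flip (b : bool) n : 'I_n -> 'I_n := if b then @rev_ord n else id.

Lemma flipK b n : involutive (@flip b n).
Proof. by case: b => // i; exact: rev_ordK. Qed.

(** Reversing the order of the rows and of the columns moves any corner to
    the upper left one, for which the stars have been studied. *)
Definition flipmx (bi bj : bool) T p q (U : 'M[T]_(p, q)) : 'M[T]_(p, q) :=
  mxsub (@flip bi p) (@flip bj q) U.

Lemma flipmxK bi bj T p q : involutive (@flipmx bi bj T p q).
Proof. by move=> U; apply/matrixP => i j; rewrite !mxE !flipK. Qed.

Lemma flipmx_tr bi bj T p q (U : 'M[T]_(p, q)) : (flipmx bi bj U)^T = flipmx bj bi U^T.
Proof. by apply/matrixP => i j; rewrite !mxE. Qed.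

Lemma flipmx_mul (K : fieldType) bi bk bj p q r (A : 'M[K]_(p, q)) (B : 'M[K]_(q, r)) :
  flipmx bi bj (A *m B) = flipmx bi bk A *m flipmx bk bj B.
Proof.
apply/matrixP => i j; rewrite !mxE (reindex_inj (inv_inj (@flipK bk q))) /=.
by apply: eq_bigr => k _; rewrite !mxE.
Qed.

Lemma flipmxB (K : fieldType) bi bj p q (A B : 'M[K]_(p, q)) :
  flipmx bi bj (A - B) = flipmx bi bj A - flipmx bi bj B.
Proof. by apply/matrixP => i j; rewrite !mxE. Qed.

Lemma flipmxD (K : fieldType) bi bj p q (A B : 'M[K]_(p, q)) :
  flipmx bi bj (A + B) = flipmx bi bj A + flipmx bi bj B.
Proof. by apply/matrixP => i j; rewrite !mxE. Qed.

Lemma supported_flip (K : fieldType) bi bj p q (D : 'M[bool]_(p, q)) (U : 'M[K]_(p, q)) :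
  supported D U <-> supported (flipmx bi bj D) (flipmx bi bj U).
Proof.
split=> [DU i j|DU i j Dij]; first by rewrite !mxE; exact: DU.
by have := DU (flip bi i) (flip bj j); rewrite !mxE !flipK; exact.
Qed.

Lemma utri_flip (K : fieldType) n (c : K) (M : 'M[K]_n) :
  utri c M -> utri c (flipmx true true M)^T.
Proof.
move=> [M0 Mc M1].
have E i j : (i < n)%N -> (j < n)%N -> entry (flipmx true true M)^T i j = entry M (n - j.+1) (n - i.+1).
  move=> im jn; rewrite (entry_in _ im jn) !mxE /= -entryE //.
split=> [i j ji|i im|i im].
- have [im|im] := ltnP i n; last by rewrite entry_out //; lia.
  by rewrite E ?M0 //; lia.
- by rewrite E // Mc //; lia.
- rewrite E //; last by lia.
  have -> : (n - i.+1 = (n - i.+2).+1)%N by lia.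
  by apply: M1; lia.
Qed.

(** In flipped coordinates the four corners give the same pattern, with the
    positions counted from 0. *)
Lemma on_lineE sel c o p q (i : 'I_p) (j : 'I_q) :
  flipmx (~~ north c) (~~ west c) (on_line sel c o p q) i j =
  if (p < q)%N || (p == q) && tie_col o c then (j == 0%N :> nat) && sel i.+1
  else (i == 0%N :> nat) && sel j.+1.
Proof.
have ri : (if north c then (flip (~~ north c) i).+1 else p - flip (~~ north c) i)%N = i.+1.
  by case: (north c) => //=; have := ltn_ord i; lia.
have rj : (if west c then (flip (~~ west c) j).+1 else q - flip (~~ west c) j)%N = j.+1.
  by case: (west c) => //=; have := ltn_ord j; lia.
by rewrite !mxE ri rj.
Qed.

Lemma sylvester_corner (K : fieldType) c o n m (L : 'M[K]_n) (M : 'M[K]_m) a :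
  utri a (if north c then L^T else L) -> utri a (if west c then M else M^T) ->
  complementary (sylvester L M) (supported (zs c o)).
Proof.
move=> hL hM; set s := ~~ north c; set e := ~~ west c.
have F R : flipmx s e (sylvester L M R) = sylvester (flipmx s s L) (flipmx e e M) (flipmx s e R).
  by rewrite /sylvester flipmxB (flipmx_mul s s e) (flipmx_mul s e e).
apply: (complementary_transfer (h := @flipmx s e K n m)
    (f' := sylvester (flipmx s s L) (flipmx e e M)) (D' := supported (flipmx s e (zs c o)))).
- by move=> u v; rewrite flipmxB.
- exact: inv_inj (@flipmxK _ _ _ _ _).
- by move=> w; exists (flipmx s e w); rewrite F flipmxK.
- by move=> w; exists (flipmx s e w); rewrite F.
- by move=> v; exact: supported_flip.
have hL' : utri a (flipmx s s L)^T.
  rewrite /s; case: (north c) hL => hL /=; last exact: utri_flip.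
  by have -> : flipmx false false L = L by apply/matrixP => i j; rewrite mxE.
have hM' : utri a (flipmx e e M).
  rewrite /e; case: (west c) hM => hM /=; last by rewrite -[M]trmxK -flipmx_tr; exact: utri_flip.
  by have -> : flipmx false false M = M by apply/matrixP => i j; rewrite mxE.
have [nm|mn] := boolP ((n < m)%N || (n == m) && tie_col o c).
  apply: (sylvester_col hL' hM'); first by move: nm; lia.
  by move=> i j; rewrite on_lineE nm andbT.
apply: (sylvester_row hL' hM'); first by move: mn; lia.
by move=> i j; rewrite on_lineE (negPf mn) andbT.
Qed.

Lemma self_map_corner (K : numFieldType) (sel : pred nat) c o n (Phi : 'M[K]_n) eta :
  north c = west c -> utri eta (if north c then Phi else Phi^T) -> eta ^+ 2 = 1 ->
  (forall i, sel i.+1 <-> eta * (-1) ^+ i = -1) ->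
  complementary (self_map Phi) (supported (on_line sel c o n n)).
Proof.
move=> nw hP e2 hsel; set s := ~~ north c.
have F Y : flipmx s s (self_map Phi Y) = self_map (flipmx s s Phi) (flipmx s s Y).
  by rewrite /self_map flipmxD (flipmx_mul s s s) -flipmx_tr.
apply: (complementary_transfer (h := @flipmx s s K n n)
    (f' := self_map (flipmx s s Phi)) (D' := supported (flipmx s s (on_line sel c o n n)))).
- by move=> u v; rewrite flipmxB.
- exact: inv_inj (@flipmxK _ _ _ _ _).
- by move=> w; exists (flipmx s s w); rewrite F flipmxK.
- by move=> w; exists (flipmx s s w); rewrite F.
- by move=> v; exact: supported_flip.
have hP' : utri eta (flipmx s s Phi).
  rewrite /s; case: (north c) hP => hP /=; last by rewrite -[Phi]trmxK -flipmx_tr; exact: utri_flip.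
  by have -> : flipmx false false Phi = Phi by apply/matrixP => i j; rewrite mxE.
have E i j : flipmx s s (on_line sel c o n n) i j = if tie_col o c then (j == 0%N :> nat) && sel i.+1
  else (i == 0%N :> nat) && sel j.+1.
  by rewrite /s {2}nw on_lineE ltnn eqxx.
case: (tie_col o c) E => E.
  apply: (self_map_col hP' e2) => i j; rewrite E; split=> [/andP[/eqP -> /hsel]|[-> /hsel ->]] //.
apply: (self_map_row hP' e2) => i j; rewrite E; split=> [/andP[/eqP -> /hsel]|[-> /hsel ->]] //.
Qed.

End Flips.

(** * The cosquare of Gamma *)

Section CanonicalBlocks.
Variable K : numClosedFieldType.

Lemma utri_Jordan n (l : K) : utri l (Jordan n l).
Proof.
have E i j : (i < n)%N -> (j < n)%N -> entry (Jordan n l) i j =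
    if i == j then l else if j == i.+1 then 1 else 0.
  by move=> im jn; rewrite (entry_in _ im jn) mxE -val_eqE.
split=> [i j ji|i im|i im].
- have [/andP[im jn]|] := boolP ((i < n) && (j < n))%N; last exact: entry_out.
  rewrite E //; case: eqP => [|_]; first lia.
  by case: eqP => //; lia.
- by rewrite E // eqxx.
- rewrite E //; last by lia.
  by rewrite eqxx ltn_eqF // oner_eq0.
Qed.

Lemma eq_sign a b : odd a = odd b -> (-1) ^+ a = (-1) ^+ b :> K.
Proof. by move=> ab; rewrite -signr_odd ab signr_odd. Qed.

Lemma entry_Gam n i j : (i < n)%N -> (j < n)%N ->
  entry (Gam K n) i j = if (i + j == n.-1)%N || (i + j == n)%N then (-1) ^+ (n.-1 - i) else 0.
Proof. by move=> im jn; rewrite (entry_in _ im jn) mxE. Qed.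

Lemma entry_Gam_mul n p (Z : 'M[K]_(n, p)) i j : (i < n)%N ->
  entry (Gam K n *m Z) i j = (-1) ^+ (n.-1 - i) * (entry Z (n.-1 - i) j + entry Z (n - i) j).
Proof.
move=> im; rewrite entry_mul.
rewrite (@sum_two_last _ n (fun k => entry (Gam K n) i k * entry Z k j) (n - i)%N) /=; last first.
- move=> k kn k1 k2; rewrite entry_Gam // ifF ?mul0r //.
  by apply/negbTE; rewrite negb_or; apply/andP; split; lia.
- by move=> k nk; rewrite [entry Z _ _]entry_out ?mulr0 // negb_and -leqNgt nk.
rewrite (_ : n - i = (n.-1 - i).+1)%N /=; last by lia.
rewrite mulrDr addrC; congr (_ + _).
  by rewrite entry_Gam ?ifT //; try lia; apply/orP; left; lia.
have [lt|ge] := ltnP (n.-1 - i).+1 n; last by rewrite [entry Z _ _]entry_out ?mulr0 // negb_and -leqNgt ge.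
by rewrite entry_Gam ?ifT //; apply/orP; right; lia.
Qed.

Lemma entry_GamT_mul n p (Z : 'M[K]_(n, p)) i j : (i < n)%N ->
  entry ((Gam K n)^T *m Z) i j = (-1) ^+ i * (entry Z (n.-1 - i) j - entry Z (n - i) j).
Proof.
move=> im; rewrite entry_mul.
rewrite (@sum_two_last _ n (fun k => entry (Gam K n)^T i k * entry Z k j) (n - i)%N) /=; last first.
- move=> k kn k1 k2; rewrite entry_tr entry_Gam // ifF ?mul0r //.
  by apply/negbTE; rewrite negb_or; apply/andP; split; lia.
- by move=> k nk; rewrite [entry Z _ _]entry_out ?mulr0 // negb_and -leqNgt nk.
rewrite (_ : n - i = (n.-1 - i).+1)%N /=; last by lia.
rewrite mulrBr addrC; congr (_ + _).
  rewrite entry_tr entry_Gam; [|lia|lia].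
  rewrite ifT; last by apply/orP; left; lia.
  by congr ((-1) ^+ _ * _); lia.
have [lt|ge] := ltnP (n.-1 - i).+1 n; last first.
  by rewrite [entry Z _ _]entry_out ?mulr0 ?oppr0 // negb_and -leqNgt ge.
rewrite entry_tr entry_Gam ?ifT //; last by apply/orP; right; lia.
rewrite -mulNr; congr (_ * _); rewrite -[RHS]mulN1r -exprS.
by apply: eq_sign; lia.
Qed.

Lemma Gam_unit n : Gam K n \in unitmx.
Proof.
have inj : injective (@rev_ord n) by exact: rev_ord_inj.
have : row_perm (perm inj) (Gam K n) \in unitmx.
  rewrite -unitmx_tr unitmxE det_trig.
    rewrite unitfE; apply/prodf_neq0 => i _; rewrite !mxE permE /=.
    rewrite (_ : _ || _ = true) ?signr_eq0 //; apply/orP; left; apply/eqP; have := ltn_ord i; lia.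
  apply/is_trig_mxP => i j ij; rewrite !mxE permE /=.
  by case: orP => [[/eqP|/eqP]|_] //; have := ltn_ord j; lia.
by rewrite row_permE unitmx_mul unitmx_perm.
Qed.

(** The recurrence expresses row [i] by row [i.+1], starting from the zero
    row below the matrix. *)
Lemma utri_rec n (s : K) e (F : 'M[K]_n) : s != 0 -> (e = 1 \/ e = -1) ->
  (forall i j, (i < n)%N -> (j < n)%N ->
     entry F i j - e * entry F i.+1 j = s * ((i == j)%:R + e * (i.+1 == j)%:R)) ->
  utri s F.
Proof.
move=> s0 he rec.
have e0 : e != 0 by case: he => ->; rewrite ?oppr_eq0 oner_eq0.
have low i j : (j < i)%N -> entry F i j = 0.
  move=> ji; have [k ik] : exists k, (n - i)%N = k by eexists.
  elim: k i ji ik => [|k IH] i ji ik; first by rewrite entry_out //; lia.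
  have [jn|nj] := ltnP j n; last by rewrite entry_out //; lia.
  have := rec i j ltac:(lia) jn; rewrite (IH i.+1) ?mulr0 ?subr0 => [-> | |]; try lia.
  by rewrite gtn_eqF // gtn_eqF ?mulr0 ?addr0 ?mulr0 //; lia.
have dia i : (i < n)%N -> entry F i i = s.
  move=> im; have := rec i i im im; rewrite (low i.+1 i (ltnSn i)) mulr0 subr0 => ->.
  by rewrite eqxx gtn_eqF // mulr0 addr0 mulr1.
split=> // i im; have := rec i i.+1 (ltnW im) im; rewrite dia // eqxx ltn_eqF // add0r mulr1.
move=> /eqP; rewrite subr_eq => /eqP ->; rewrite mulrC -mulrDr mulf_neq0 //.
by rewrite -mulr2n mulrn_eq0 (negPf s0).
Qed.

(** The equation [Gam^T Phi = Gam], row by row, is a recurrence between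
    consecutive rows of [Phi]. *)
Lemma Gam_cosquare n : exists Phi, (Gam K n)^T *m Phi = Gam K n /\ utri ((-1) ^+ n.-1) Phi.
Proof.
have uT : (Gam K n)^T \in unitmx by rewrite unitmx_tr Gam_unit.
exists (invmx (Gam K n)^T *m Gam K n); split; first by rewrite mulKVmx.
set Phi := _ *m _; have E : (Gam K n)^T *m Phi = Gam K n by rewrite mulKVmx.
apply: (@utri_rec _ _ 1); [by rewrite signr_eq0 | by left|] => i j im jn.
have := congr1 (fun M : 'M_n => entry M (n.-1 - i)%N j) E; rewrite entry_GamT_mul; last by lia.
rewrite entry_Gam //; last by lia.
rewrite (_ : n.-1 - (n.-1 - i) = i)%N; last by lia.
rewrite (_ : n - (n.-1 - i) = i.+1)%N; last by lia.
rewrite !mul1r => H; apply: (mulfI (negbT (signr_eq0 K (n.-1 - i)))); rewrite H.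
rewrite mulrA -exprD.
have [ij|ij] := eqVneq i j.
  rewrite ifT; last by apply/orP; left; lia.
  by rewrite -ij gtn_eqF // addr0 mulr1; apply: eq_sign; lia.
have [ij'|ij'] := eqVneq i.+1 j.
  rewrite ifT; last by apply/orP; right; lia.
  by rewrite add0r mulr1; apply: eq_sign; lia.
by rewrite ifF ?addr0 ?mulr0 //; apply/negbTE; rewrite negb_or; apply/andP; split; lia.
Qed.

Lemma Gam_left_cosquare n : exists L, L *m (Gam K n)^T = Gam K n /\ utri ((-1) ^+ n.-1) L^T.
Proof.
have uT : (Gam K n)^T \in unitmx by rewrite unitmx_tr Gam_unit.
exists (Gam K n *m invmx (Gam K n)^T); split; first by rewrite mulmxKV.
set L := _ *m _; have E : Gam K n *m L^T = (Gam K n)^T.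
  have /(congr1 trmx) : L *m (Gam K n)^T = Gam K n by rewrite mulmxKV.
  by rewrite trmx_mul trmxK.
apply: (@utri_rec _ _ (-1)); [by rewrite signr_eq0 | by right|] => i j im jn.
have := congr1 (fun M : 'M_n => entry M (n.-1 - i)%N j) E; rewrite entry_Gam_mul; last by lia.
rewrite [entry (Gam K n)^T _ _]entry_tr entry_Gam //; last by lia.
rewrite (_ : n.-1 - (n.-1 - i) = i)%N; last by lia.
rewrite (_ : n - (n.-1 - i) = i.+1)%N; last by lia.
rewrite !mulN1r opprK => H; apply: (mulfI (negbT (signr_eq0 K i))); rewrite H.
rewrite mulrA -exprD.
have [ij|ij] := eqVneq i j.
  rewrite ifT; last by apply/orP; left; lia.
  by rewrite -ij gtn_eqF // subr0 mulr1; apply: eq_sign; lia.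
have [ij'|ij'] := eqVneq i.+1 j.
  rewrite ifT; last by apply/orP; right; lia.
  by rewrite sub0r mulrN1 -[RHS]mulN1r -exprS; apply: eq_sign; lia.
by rewrite ifF ?subr0 ?mulr0 //; apply/negbTE; rewrite negb_or; apply/andP; split; lia.
Qed.

End CanonicalBlocks.

(** * Tangent maps of the blocks *)

Section Pairs.
Variable K : numFieldType.

(** The blocks (2,1) and (1,2) of [X^T (A + B) + (A + B) X] for the direct
    sum of [A] and [B], where [S] and [R] are the blocks (1,2) and (2,1) of
    [X]. *)
Definition pair_map m n (A : 'M[K]_m) (B : 'M[K]_n) (SR : 'M[K]_(m, n) * 'M[K]_(n, m)) :
    'M[K]_(n, m) * 'M[K]_(m, n) :=
  (SR.1^T *m A + B *m SR.2, SR.2^T *m B + A *m SR.1).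

Definition diag_map n (A : 'M[K]_n) (X : 'M[K]_n) := X^T *m A + A *m X.

Definition pair_supported m n (D : 'M[bool]_(n, m) * 'M[bool]_(m, n)) (UV : 'M[K]_(n, m) * 'M[K]_(m, n)) :=
  supported D.1 UV.1 /\ supported D.2 UV.2.

(** When [A] is nonsingular, [S] can be chosen to give the block (1,2) any
    value; what [R] does to the other block once (1,2) is kept fixed is
    [B R - B^T R Phi], [Phi] being the cosquare of [A]. *)
Lemma pair_reduce m n (A Phi : 'M[K]_m) (B : 'M[K]_n) (D1 : 'M[bool]_(n, m)) (D2 : 'M[bool]_(m, n)) :
  A \in unitmx -> A^T *m Phi = A -> (forall i j, ~~ D2 i j) ->
  complementary (fun R : 'M[K]_(n, m) => B *m R - B^T *m R *m Phi) (supported D1) ->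
  complementary (pair_map A B) (pair_supported (D1, D2)).
Proof.
move=> uA AP D20 [span indep]; have D2E := supported_nostar (K := K) D20.
have key R S0 : (S0 - invmx A *m (R^T *m B))^T *m A = S0^T *m A - B^T *m R *m Phi.
  rewrite raddfB /= mulmxBl !trmx_mul trmxK; congr (_ - _).
  have APi : invmx A^T *m A = Phi by rewrite -{2}AP mulKmx // unitmx_tr.
  by rewrite trmx_inv -(mulmxA (B^T *m R)) APi.
split=> [[U V]|[S R] [/= DU /D2E V0]].
  have [R DR] := span (U - (invmx A *m V)^T *m A).
  exists (invmx A *m V - invmx A *m (R^T *m B), R); split=> /=.
    rewrite key; move: DR; congr (supported D1 _).
    by apply/matrixP => i j; rewrite ![in LHS]mxE ![in RHS]mxE; ring.
  by apply/D2E; rewrite mulmxBr !mulKVmx // [R^T *m B + _]addrC subrK subrr.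
have SE : S = - (invmx A *m (R^T *m B)).
  by apply/eqP; rewrite -addr_eq0 addrC -[S](mulKmx uA) -mulmxDr V0 mulmx0.
rewrite /pair_map /= V0; congr (_, _).
have := key R 0; rewrite sub0r -SE trmx0 mul0mx sub0r => E.
by move: DU; rewrite E addrC; exact: indep.
Qed.

(** For nonsingular [B] the substitution [R' = B^T R] gives a Sylvester
    operator. *)
Lemma pair_sylvester m n (A Phi : 'M[K]_m) (B L : 'M[K]_n)
    (D1 : 'M[bool]_(n, m)) (D2 : 'M[bool]_(m, n)) :
  A \in unitmx -> A^T *m Phi = A -> B \in unitmx -> L *m B^T = B -> (forall i j, ~~ D2 i j) ->
  complementary (sylvester L Phi) (supported D1) ->
  complementary (pair_map A B) (pair_supported (D1, D2)).
Proof.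
move=> uA AP uB LB D20 H; apply: (pair_reduce (Phi := Phi)) => //.
have E R : B *m R - B^T *m R *m Phi = sylvester L Phi (B^T *m R) by rewrite /sylvester mulmxA LB.
have [span indep] := H; split=> [U|R].
  have [W DW] := span U; exists (invmx B^T *m W).
  by rewrite E mulKVmx // unitmx_tr.
by rewrite E; exact: indep.
Qed.

(** The substitution [Y = A X] and [A = A^T Phi] turn [X^T A + A X] into
    [Y + Y^T Phi]. *)
Lemma diag_self_map n (A Phi : 'M[K]_n) D : A \in unitmx -> A^T *m Phi = A ->
  complementary (self_map Phi) D -> complementary (diag_map A) D.
Proof.
move=> uA AP [span indep].
have E X : diag_map A X = self_map Phi (A *m X).
  by rewrite /diag_map /self_map trmx_mul -mulmxA AP addrC.
split=> [U|X]; last by rewrite E; exact: indep.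
by have [Y DY] := span U; exists (invmx A *m Y); rewrite E mulKVmx.
Qed.

Lemma supported_block p1 p2 q1 q2 (D1 : 'M[bool]_(p1, q1)) (D2 : 'M[bool]_(p1, q2))
    (D3 : 'M[bool]_(p2, q1)) (D4 : 'M[bool]_(p2, q2)) (U : 'M[K]_(p1 + p2, q1 + q2)) :
  supported (block_mx D1 D2 D3 D4) U <->
  [/\ supported D1 (ulsubmx U), supported D2 (ursubmx U), supported D3 (dlsubmx U) & supported D4 (drsubmx U)].
Proof.
split=> [DU|[H1 H2 H3 H4] i j].
  split=> i j Dij; rewrite !mxE; apply: DU.
  - by rewrite block_mxEul.
  - by rewrite block_mxEur.
  - by rewrite block_mxEdl.
  - by rewrite block_mxEdr.
rewrite -[U]submxK; case: (split_ordP i) => i' ->; case: (split_ordP j) => j' ->.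
- by rewrite !block_mxEul; exact: H1.
- by rewrite !block_mxEur; exact: H2.
- by rewrite !block_mxEdl; exact: H3.
- by rewrite !block_mxEdr; exact: H4.
Qed.

Lemma supported_row p q1 q2 (D1 : 'M[bool]_(p, q1)) (D2 : 'M[bool]_(p, q2)) (U : 'M[K]_(p, q1 + q2)) :
  supported (row_mx D1 D2) U <-> supported D1 (lsubmx U) /\ supported D2 (rsubmx U).
Proof.
split=> [DU|[H1 H2] i j].
  split=> i j Dij; rewrite !mxE; apply: DU; first by rewrite row_mxEl.
  by rewrite row_mxEr.
rewrite -[U]hsubmxK; case: (split_ordP j) => j' ->.
  by rewrite !row_mxEl; exact: H1.
by rewrite !row_mxEr; exact: H2.
Qed.

Lemma sylvester_block n1 n2 m1 m2 (L1 : 'M[K]_n1) (L2 : 'M[K]_n2) (M1 : 'M[K]_m1) (M2 : 'M[K]_m2) D1 D2 D3 D4 :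
  complementary (sylvester L1 M1) (supported D1) -> complementary (sylvester L1 M2) (supported D2) ->
  complementary (sylvester L2 M1) (supported D3) -> complementary (sylvester L2 M2) (supported D4) ->
  complementary (sylvester (block_mx L1 0 0 L2) (block_mx M1 0 0 M2)) (supported (block_mx D1 D2 D3 D4)).
Proof.
move=> [s1 i1] [s2 i2] [s3 i3] [s4 i4].
have E R1 R2 R3 R4 : sylvester (block_mx L1 0 0 L2) (block_mx M1 0 0 M2) (block_mx R1 R2 R3 R4) =
    block_mx (sylvester L1 M1 R1) (sylvester L1 M2 R2) (sylvester L2 M1 R3) (sylvester L2 M2 R4).
  rewrite /sylvester !mulmx_block !mul0mx !mulmx0 !addr0 !add0r.
  by rewrite opp_block_mx add_block_mx.
split=> [U|R].
  have [R1 D1R] := s1 (ulsubmx U); have [R2 D2R] := s2 (ursubmx U).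
  have [R3 D3R] := s3 (dlsubmx U); have [R4 D4R] := s4 (drsubmx U).
  exists (block_mx R1 R2 R3 R4); rewrite E -[U]submxK opp_block_mx add_block_mx.
  by apply/supported_block; rewrite block_mxKul block_mxKur block_mxKdl block_mxKdr.
rewrite -[R]submxK E => /supported_block; rewrite block_mxKul block_mxKur block_mxKdl block_mxKdr.
by move=> [/i1 -> /i2 -> /i3 -> /i4 ->]; rewrite block_mx0.
Qed.

Lemma sylvester_row_block n m1 m2 (L : 'M[K]_n) (M1 : 'M[K]_m1) (M2 : 'M[K]_m2) D1 D2 :
  complementary (sylvester L M1) (supported D1) -> complementary (sylvester L M2) (supported D2) ->
  complementary (sylvester L (block_mx M1 0 0 M2)) (supported (row_mx D1 D2)).
Proof.
move=> [s1 i1] [s2 i2].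
have E R1 R2 : sylvester L (block_mx M1 0 0 M2) (row_mx R1 R2) = row_mx (sylvester L M1 R1) (sylvester L M2 R2).
  by rewrite /sylvester mul_mx_row mul_row_block !mulmx0 addr0 add0r opp_row_mx add_row_mx.
split=> [U|R].
  have [R1 D1R] := s1 (lsubmx U); have [R2 D2R] := s2 (rsubmx U).
  exists (row_mx R1 R2); rewrite E -[U]hsubmxK opp_row_mx add_row_mx.
  by apply/supported_row; rewrite row_mxKl row_mxKr.
rewrite -[R]hsubmxK E => /supported_row; rewrite row_mxKl row_mxKr.
by move=> [/i1 -> /i2 ->]; rewrite row_mx0.
Qed.

Lemma sylvester_nostar n m (L : 'M[K]_n) (M : 'M[K]_m) c d (D : 'M[bool]_(n, m)) :
  utri c L \/ utri c L^T -> utri d M \/ utri d M^T -> c != d -> (forall i j, ~~ D i j) ->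
  complementary (sylvester L M) (supported D).
Proof.
move=> hL hM cd D0; have D0E := supported_nostar (K := K) D0.
suff onto : forall U, exists R, U = sylvester L M R.
  split=> [U|R /D0E //]; have [R ->] := onto U; exists R; apply/D0E; rewrite subrr //.
have [s hs] : exists s, utri c (flipmx s s L)^T.
  case: hL => hL; first by exists true; exact: utri_flip.
  by exists false; have -> : flipmx false false L = L by apply/matrixP => i j; rewrite mxE.
have [e he] : exists e, utri d (flipmx e e M).
  case: hM => hM; last by exists true; rewrite -[M]trmxK -flipmx_tr; exact: utri_flip.
  by exists false; have -> : flipmx false false M = M by apply/matrixP => i j; rewrite mxE.
move=> U; have [R HR] := sylvester_onto hs he cd (flipmx s e U).
exists (flipmx s e R); apply: (inv_inj (@flipmxK s e _ _ _)); rewrite HR.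
by rewrite /sylvester flipmxB (flipmx_mul s s e) (flipmx_mul s e e) flipmxK.
Qed.

End Pairs.

(** * Nonsingular summands *)

Section Nonsingular.
Variable K : numClosedFieldType.
Implicit Types l mu : K.

Lemma Jordan_unit n l : l != 0 -> Jordan n l \in unitmx.
Proof. exact: utri_unit (utri_Jordan n l). Qed.

Definition H_cosquare m l : 'M[K]_(m + m) := block_mx (Jordan m l) 0 0 (invmx (Jordan m l)^T).
Definition H_left_cosquare m l : 'M[K]_(m + m) := block_mx (invmx (Jordan m l)^T) 0 0 (Jordan m l).

Lemma Hmx_unit m l : l != 0 -> Hmx m l \in unitmx.
Proof.
move=> l0; have uJ := Jordan_unit m l0.
have : Hmx m l *m block_mx 0 (invmx (Jordan m l)) 1%:M 0 = 1%:M.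
  rewrite /Hmx mulmx_block !mul0mx !mulmx0 !mulmx1 ?mul1mx !add0r !addr0 mulmxV //.
  by rewrite -scalar_mx_block.
by move=> /mulmx1_unit[].
Qed.

Lemma H_cosquareE m l : l != 0 -> (Hmx m l)^T *m H_cosquare m l = Hmx m l.
Proof.
move=> l0; have uJ : (Jordan m l)^T \in unitmx by rewrite unitmx_tr Jordan_unit.
rewrite /Hmx /H_cosquare tr_block_mx !trmx0 trmx1 mulmx_block.
by rewrite !mul0mx !mulmx0 !mul1mx !add0r !addr0 mulmxV.
Qed.

Lemma H_left_cosquareE m l : l != 0 -> H_left_cosquare m l *m (Hmx m l)^T = Hmx m l.
Proof.
move=> l0; have uJ : (Jordan m l)^T \in unitmx by rewrite unitmx_tr Jordan_unit.
rewrite /Hmx /H_left_cosquare tr_block_mx !trmx0 trmx1 mulmx_block.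
by rewrite !mul0mx !mulmx0 !mulmx1 !add0r !addr0 mulVmx.
Qed.

Lemma utri_Jordan_inv n l : l != 0 -> utri l^-1 (invmx (Jordan n l)^T)^T.
Proof. by move=> l0; rewrite -trmx_inv trmxK; apply: utri_inv => //; exact: utri_Jordan. Qed.

Lemma nostarN p q (i : 'I_p) (j : 'I_q) : ~~ (nostar : 'M[bool]_(p, q)) i j.
Proof. by rewrite mxE. Qed.

Lemma sign_pred n : (-1) ^+ n.-1 = (-1) ^+ n.+1 :> K \/ n = 0%N.
Proof. by case: n => [|n]; [right | left; rewrite !exprS !mulN1r opprK]. Qed.

Lemma pair_HH m n l mu o21 o12 : l != 0 -> mu != 0 ->
  complementary (pair_map (Hmx m l) (Hmx n mu)) (pair_supported (D_off o21 o12 (SumH m l) (SumH n mu))).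
Proof.
move=> l0 mu0.
have J := utri_Jordan; have Ji k z z0 := @utri_Jordan_inv k z z0.
have red D1 : complementary (sylvester (H_left_cosquare n mu) (H_cosquare m l)) (supported D1) ->
    complementary (pair_map (Hmx m l) (Hmx n mu)) (pair_supported (D1, nostar)).
  move=> H; apply: pair_sylvester H; rewrite ?Hmx_unit ?H_cosquareE ?H_left_cosquareE //.
  by move=> i j; exact: nostarN.
have b0 : nostar = block_mx nostar nostar nostar nostar :> 'M_(n + n, m + m).
  by apply/matrixP => i j; rewrite mxE; case: (split_ordP i) => i' ->; case: (split_ordP j) => j' ->;
    rewrite ?block_mxEul ?block_mxEur ?block_mxEdl ?block_mxEdr mxE.
have nw : mu^-1 != l -> complementary (sylvester (invmx (Jordan n mu)^T) (Jordan m l)) (supported nostar).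
  move=> neq; apply: sylvester_nostar neq _; [by right; exact: Ji | by left; exact: J | exact: nostarN].
have ne : mu^-1 != l^-1 -> complementary (sylvester (invmx (Jordan n mu)^T) (invmx (Jordan m l)^T)) (supported nostar).
  move=> neq; apply: sylvester_nostar neq _; [by right; exact: Ji | by right; exact: Ji | exact: nostarN].
have sw : mu != l -> complementary (sylvester (Jordan n mu) (Jordan m l)) (supported nostar).
  move=> neq; apply: sylvester_nostar neq _; [by left; exact: J | by left; exact: J | exact: nostarN].
have se : mu != l^-1 -> complementary (sylvester (Jordan n mu) (invmx (Jordan m l)^T)) (supported nostar).
  move=> neq; apply: sylvester_nostar neq _; [by left; exact: J | by right; exact: Ji | exact: nostarN].
have NWc : mu^-1 = l -> complementary (sylvester (invmx (Jordan n mu)^T) (Jordan m l)) (supported (zs NW o21)).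
  by move=> e; apply: (@sylvester_corner _ _ _ _ _ _ _ (l)) => /=; [rewrite -e; exact: Ji | exact: J].
have NEc : mu = l -> complementary (sylvester (invmx (Jordan n mu)^T) (invmx (Jordan m l)^T)) (supported (zs NE o21)).
  by move=> ->; apply: (@sylvester_corner _ _ _ _ _ _ _ (l^-1)) => /=; exact: Ji.
have SWc : mu = l -> complementary (sylvester (Jordan n mu) (Jordan m l)) (supported (zs SW o21)).
  by move=> ->; apply: (@sylvester_corner _ _ _ _ _ _ _ (l)) => /=; exact: J.
have SEc : mu = l^-1 -> complementary (sylvester (Jordan n mu) (invmx (Jordan m l)^T)) (supported (zs SE o21)).
  by move=> ->; apply: (@sylvester_corner _ _ _ _ _ _ _ (l^-1)) => /=; [exact: J | exact: Ji].
have inv_pm : l = 1 \/ l = -1 -> l^-1 = l by case=> ->; rewrite ?invrN invr1.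
rewrite /D_off; have [lmu|lmu] /= := eqVneq l mu.
  case: ifP => [pm|npm].
    have {}pm : l^-1 = l by apply: inv_pm; case/orP: pm => /eqP; [left|right].
    apply: red; rewrite /H_left_cosquare /H_cosquare; apply: sylvester_block.
    - by apply: NWc; rewrite -lmu.
    - exact: NEc.
    - exact: SWc.
    - by apply: SEc; rewrite -lmu pm.
  have lV : l != l^-1.
    apply: contraFneq npm => lV; have : l ^+ 2 == 1 by rewrite expr2 {2}lV divff.
    by rewrite sqrf_eq1.
  apply: red; rewrite /H_left_cosquare /H_cosquare; apply: sylvester_block.
  - by apply: nw; rewrite -lmu eq_sym.
  - exact: NEc.
  - exact: SWc.
  - by apply: se; rewrite -lmu.
have [lV|lV] := eqVneq l mu^-1.
  apply: red; rewrite /H_left_cosquare /H_cosquare; apply: sylvester_block.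
  - exact: NWc.
  - by apply: ne; rewrite (inj_eq invr_inj) eq_sym.
  - by apply: sw; rewrite eq_sym.
  - by apply: SEc; rewrite lV invrK.
apply: red; rewrite b0 /H_left_cosquare /H_cosquare; apply: sylvester_block.
- by apply: nw; rewrite eq_sym.
- by apply: ne; rewrite (inj_eq invr_inj) eq_sym.
- by apply: sw; rewrite eq_sym.
- by apply: se; apply: contraNneq lV => ->; rewrite invrK.
Qed.

Lemma pair_HG m n l o21 o12 : l != 0 -> (0 < n)%N ->
  complementary (pair_map (Hmx m l) (Gam K n)) (pair_supported (D_off o21 o12 (SumH m l) (SumG K n))).
Proof.
move=> l0 n0; have [L [LE hL]] := Gam_left_cosquare K n.
have {}hL : utri ((-1) ^+ n.+1) L^T by have [<- //|n00] := sign_pred n; rewrite n00 in n0.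
have red D1 : complementary (sylvester L (H_cosquare m l)) (supported D1) ->
    complementary (pair_map (Hmx m l) (Gam K n)) (pair_supported (D1, nostar)).
  move=> H; apply: pair_sylvester H; rewrite ?Hmx_unit ?H_cosquareE ?Gam_unit //.
  by move=> i j; exact: nostarN.
have b0 : nostar = row_mx nostar nostar :> 'M_(n, m + m).
  by apply/matrixP => i j; rewrite mxE; case: (split_ordP j) => j' ->; rewrite ?row_mxEl ?row_mxEr mxE.
have sV : (-1) ^+ n.+1 = ((-1) ^+ n.+1)^-1 :> K by rewrite -exprVn invrN1.
rewrite /D_off; case: ifP => [/eqP ls|/negbT ls].
  apply: red; apply: sylvester_row_block; apply: (@sylvester_corner _ _ _ _ _ _ _ ((-1) ^+ n.+1)) => //=.
    by rewrite -ls; exact: utri_Jordan.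
  by rewrite sV -ls; exact: utri_Jordan_inv.
apply: red; rewrite b0; apply: sylvester_row_block.
  apply: (sylvester_nostar (c := (-1) ^+ n.+1) (d := l)); [by right | by left; exact: utri_Jordan | | exact: nostarN].
  by rewrite eq_sym.
apply: (sylvester_nostar (c := (-1) ^+ n.+1) (d := l^-1)); [by right | by right; exact: utri_Jordan_inv | | exact: nostarN].
by rewrite sV (inj_eq invr_inj) eq_sym.
Qed.

Lemma pair_GG m n o21 o12 : (0 < m)%N -> (0 < n)%N ->
  complementary (pair_map (Gam K m) (Gam K n)) (pair_supported (D_off o21 o12 (SumG K m) (SumG K n))).
Proof.
move=> m0 n0; have [L [LE hL]] := Gam_left_cosquare K n; have [Phi [PE hP]] := Gam_cosquare K m.
have red D1 : complementary (sylvester L Phi) (supported D1) ->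
    complementary (pair_map (Gam K m) (Gam K n)) (pair_supported (D1, nostar)).
  move=> H; apply: pair_sylvester H; rewrite ?Gam_unit //.
  by move=> i j; exact: nostarN.
rewrite /D_off; case: eqVneq => mn; apply: red.
  apply: (@sylvester_corner _ _ _ _ _ _ _ ((-1) ^+ n.-1)) => //=.
  by rewrite (eq_sign K (b := m.-1)) //; lia.
apply: (sylvester_nostar (c := (-1) ^+ n.-1) (d := (-1) ^+ m.-1)); [by right | by left | | exact: nostarN].
rewrite -signr_odd -[X in _ != X]signr_odd.
have : odd n.-1 != odd m.-1 by move: mn; lia.
case: (odd n.-1); case: (odd m.-1) => // _; rewrite expr0 expr1.
  by rewrite eqNr oner_eq0.
by rewrite eq_sym eqNr oner_eq0.
Qed.

Lemma diag_G n o : (0 < n)%N -> complementary (diag_map (Gam K n)) (supported (D_diag o (SumG K n))).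
Proof.
move=> n0; have [Phi [PE hP]] := Gam_cosquare K n.
apply: (diag_self_map (Gam_unit K n) PE).
have e2 : ((-1) ^+ n.-1) ^+ 2 = 1 :> K by rewrite -exprM mulnC exprM sqrrN !expr1n.
have key i : (-1) ^+ n.-1 * (-1) ^+ i = (-1) ^+ (odd n == odd i) :> K.
  rewrite -exprD -[RHS]signr_odd; apply: eq_sign; rewrite oddb; lia.
have neg (b : bool) : (-1) ^+ b = -1 :> K <-> b.
  by case: b; split=> // /eqP; rewrite expr0 eq_sym eqNr oner_eq0.
rewrite /D_diag; case: ifP => on; apply: (@self_map_corner _ _ NW _ _ _ ((-1) ^+ n.-1)) => // i; rewrite key neg; split; lia.
Qed.

(** The diagonal blocks of [Y + Y^T Phi] are operators of the same kind for
    the two parts of the cosquare; the off-diagonal blocks of [Y] are coupled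
    with each other, and eliminating one of them leaves a Sylvester operator
    with twice the same eigenvalue, whatever [l] is: this is why a full line of
    stars always stands in the lower left block. *)
Lemma diag_H m l o : l != 0 -> complementary (diag_map (Hmx m l)) (supported (D_diag o (SumH m l))).
Proof.
move=> l0; apply: (diag_self_map (Hmx_unit m l0) (H_cosquareE m l0)).
set J := Jordan m l; set V := invmx J^T.
have hJ : utri l J := utri_Jordan m l; have hV : utri l^-1 V^T := utri_Jordan_inv m l0.
have uJ : J \in unitmx := Jordan_unit m l0.
have E Y1 Y2 Y3 Y4 : self_map (H_cosquare m l) (block_mx Y1 Y2 Y3 Y4) =
    block_mx (self_map J Y1) (Y2 + Y3^T *m V) (Y3 + Y2^T *m J) (self_map V Y4).
  rewrite /self_map /H_cosquare tr_block_mx mulmx_block !mulmx0 !addr0 !add0r.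
  by rewrite add_block_mx.
(* the value of one off-diagonal block of the image when the other one is kept at 0 *)
have F Y3 : Y3 + (- (Y3^T *m V))^T *m J = sylvester J J (invmx J *m Y3).
  rewrite /sylvester mulKVmx // raddfN /= trmx_mul trmxK mulNmx /V -trmx_inv trmxK.
  by [].
have [s3 i3] : complementary (sylvester J J) (supported (zs SW o)).
  exact: (@sylvester_corner _ _ _ _ _ _ _ l).
have gen (D1 D4 : 'M[bool]_m) : complementary (self_map J) (supported D1) ->
    complementary (self_map V) (supported D4) ->
    complementary (self_map (H_cosquare m l)) (supported (block_mx D1 nostar (zs SW o) D4)).
  move=> [s1 i1] [s4 i4]; have n0 := supported_nostar (K := K) (@nostarN m m).
  split=> [U|Y].
    have [Y1 D1Y] := s1 (ulsubmx U); have [Y4 D4Y] := s4 (drsubmx U).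
    have [W DW] := s3 (dlsubmx U - (ursubmx U)^T *m J).
    (* Y2 is chosen so that the upper right block is matched exactly *)
    pose Y3 := J *m W; exists (block_mx Y1 (ursubmx U - Y3^T *m V) Y3 Y4).
    rewrite E -{1}[U]submxK opp_block_mx add_block_mx; apply/supported_block.
    rewrite block_mxKul block_mxKur block_mxKdl block_mxKdr; split=> //.
      by apply/n0; rewrite subrK subrr.
    have -> : Y3 + (ursubmx U - Y3^T *m V)^T *m J = sylvester J J W + (ursubmx U)^T *m J.
      rewrite -[W](mulKmx uJ) -/Y3 -F raddfB /= mulmxBl raddfN /= mulNmx.
      by rewrite addrCA addrC.
    by rewrite [_ + (ursubmx U)^T *m J]addrC opprD addrA.
  rewrite -[Y]submxK E => /supported_block; rewrite block_mxKul block_mxKur block_mxKdl block_mxKdr.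
  move=> [/i1 -> /n0 Y20 D3 /i4 ->]; rewrite Y20.
  have Y2E : ursubmx Y = - ((dlsubmx Y)^T *m V) by apply/eqP; rewrite -addr_eq0 Y20.
  by move: D3; rewrite Y2E F => /i3 ->; rewrite block_mx0.
have neg (b : bool) : (-1) ^+ b = -1 :> K <-> b.
  by case: b; split=> // /eqP; rewrite expr0 eq_sym eqNr oner_eq0.
have nst (D : 'M[K]_m) : (forall U, exists Y, U = self_map D Y) -> complementary (self_map D) (supported (nostar : 'M[bool]_m)).
  have n0 := supported_nostar (K := K) (@nostarN m m).
  by move=> onto; split=> [U|Y /n0 //]; have [Y ->] := onto U; exists Y; rewrite subrr; apply/n0.
rewrite /D_diag; case: ifP => [/eqP l1|l1].
  apply: gen.
    apply: (@self_map_corner _ _ NW _ _ _ l); [by []|exact: hJ|by rewrite l1 expr1n|].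
    by move=> i /=; rewrite l1 mul1r -signr_odd neg; lia.
  apply: (@self_map_corner _ _ SE _ _ _ l^-1); [by []|exact: hV|by rewrite l1 invr1 expr1n|].
  by move=> i /=; rewrite l1 invr1 mul1r -signr_odd neg; lia.
case: ifP => [/eqP l1'|l1'].
  apply: gen.
    apply: (@self_map_corner _ _ NW _ _ _ l); [by []|exact: hJ|by rewrite l1' sqrrN expr1n|].
    by move=> i /=; rewrite l1' -exprS -signr_odd neg; lia.
  apply: (@self_map_corner _ _ SE _ _ _ l^-1); [by []|exact: hV|by rewrite l1' invrN1 sqrrN expr1n|].
  by move=> i /=; rewrite l1' invrN1 -exprS -signr_odd neg; lia.
have l2 : l ^+ 2 != 1 by rewrite sqrf_eq1 l1 l1'.
apply: gen; apply: nst; first exact: self_map_onto hJ l2.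
have hV' : utri l^-1 (flipmx true true V) by rewrite -[V]trmxK -flipmx_tr; exact: utri_flip.
have lV2 : l^-1 ^+ 2 != 1 by rewrite exprVn invr_eq1.
move=> U; have [Y HY] := self_map_onto hV' lV2 (flipmx true true U).
exists (flipmx true true Y); apply: (inv_inj (@flipmxK true true _ _ _)).
by rewrite HY /self_map flipmxD (flipmx_mul true true true) -flipmx_tr !flipmxK.
Qed.

End Nonsingular.

(** * A nonsingular summand and a nilpotent Jordan block *)

Section Nilpotent.
Variable K : numClosedFieldType.

Lemma entry_J0 n i j : entry (Jordan n (0 : K)) i j = ((j == i.+1) && (j < n)%N)%:R.
Proof.
have [/andP[im jn]|out] := boolP ((i < n) && (j < n))%N.
  rewrite (entry_in _ im jn) mxE -val_eqE /= jn andbT.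
  by case: (eqVneq i j) => [->|_]; [rewrite ltn_eqF | case: ifP].
rewrite entry_out //; case: eqP => //= ji; case: ltnP => //= jn; case/negP: out; lia.
Qed.

Lemma entry_J0_mul n p (Z : 'M[K]_(n, p)) i j : entry (Jordan n 0 *m Z) i j = entry Z i.+1 j.
Proof.
rewrite entry_mul; have [lt|ge] := ltnP i.+1 n; last first.
  rewrite [RHS]entry_out ?negb_and -?leqNgt ?ge // big1 // => k _.
  by rewrite entry_J0; case: eqP => [ki|_]; rewrite ?mul0r //; have := ltn_ord k; lia.
rewrite (bigD1 (Ordinal lt)) //= entry_J0 eqxx lt mul1r big1 ?addr0 // => k ki.
rewrite entry_J0; case: eqP => [ki'|_]; rewrite ?mul0r //.
by case/eqP: ki; apply: val_inj.
Qed.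

Lemma entry_mul_J0 n p (Z : 'M[K]_(p, n)) i j : (j < n)%N ->
  entry (Z *m Jordan n 0) i j = prd j (fun j' => entry Z i j').
Proof.
move=> jn; rewrite entry_mul; case: j jn => [|j] jn /=.
  by rewrite big1 // => k _; rewrite entry_J0 mulr0.
rewrite (bigD1 (Ordinal (ltnW jn))) //= entry_J0 eqxx jn mulr1 big1 ?addr0 // => k ki.
rewrite entry_J0 eqSS; case: eqP => [ki'|_]; rewrite ?mulr0 //.
by case/eqP: ki; apply: val_inj.
Qed.

Lemma entry_J0T_mul n p (Z : 'M[K]_(n, p)) i j : (i < n)%N ->
  entry ((Jordan n 0)^T *m Z) i j = prd i (fun i' => entry Z i' j).
Proof.
move=> im; rewrite -entry_tr trmx_mul trmxK entry_mul_J0 //.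
by case: (i) => //= i'; rewrite entry_tr.
Qed.

Section Ladder.
Variables (n m : nat) (Phi : 'M[K]_m).
Hypothesis uPhi : Phi \in unitmx.
Hypothesis n0 : (0 < n)%N.

(** What [pair_reduce] leaves of a pair with a nilpotent Jordan block: each
    row of [R] contributes to the row above it and to the row below it. *)
Definition ladder (R : 'M[K]_(n, m)) := Jordan n 0 *m R - (Jordan n 0)^T *m R *m Phi.

Lemma ladder_linear : linear ladder.
Proof.
move=> a R S; rewrite /ladder !mulmxDr !mulmxDl -!scalemxAr -!scalemxAl scalerBr.
by rewrite opprD addrACA.
Qed.

(** Rows are handled as wholes, because [Phi] is invertible and acts on them
    from the right. *)
Definition at_row (i : nat) (v : 'rV[K]_m) : 'M[K]_(n, m) := \matrix_(a < n, b < m) (if a == i :> nat then v 0 b else 0).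

Definition nat_row (R : 'M[K]_(n, m)) (i : nat) : 'rV[K]_m := \row_(b < m) entry R i b.

Lemma nat_row_out R i : (n <= i)%N -> nat_row R i = 0.
Proof. by move=> ni; apply/rowP => b; rewrite !mxE entry_out // negb_and -leqNgt ni. Qed.

Lemma nat_rowP R S : (forall i, (i < n)%N -> nat_row R i = nat_row S i) -> R = S.
Proof.
move=> RS; apply: entryP => i j im jm; have /rowP/(_ (Ordinal jm)) := RS i im.
by rewrite !mxE.
Qed.

Lemma nat_row_ladder R i : (i < n)%N ->
  nat_row (ladder R) i = nat_row R i.+1 - (if i is i'.+1 then nat_row R i' *m Phi else 0).
Proof.
move=> im; apply/rowP => b; rewrite [LHS]mxE entryB entry_J0_mul [RHS]mxE.
congr (_ + _); first by rewrite mxE.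
rewrite [RHS]mxE; congr (- _); rewrite -mulmxA entry_J0T_mul //; case: i im => [|i] im /=; first by rewrite mxE.
rewrite (_ : nat_row R i = row (Ordinal (ltnW im)) R); last first.
  by apply/rowP => a; rewrite !mxE -entryE.
rewrite -row_mul mxE -entryE //.
Qed.

Lemma nat_row_at_row i j v : nat_row (at_row i v) j = if (j == i) && (i < n)%N then v else 0.
Proof.
apply/rowP => b; rewrite mxE; have [jn|nj] := ltnP j n; last first.
  by rewrite entry_out ?negb_and -?leqNgt ?nj // ; case: ifP => [|_]; rewrite ?mxE //; lia.
rewrite (entry_in _ jn (ltn_ord b)) mxE /=; have -> : Ordinal (ltn_ord b) = b by apply: val_inj.
case: eqP => [<-|_]; last by rewrite mxE.
by rewrite jn.
Qed.

Lemma ladder_at_row i v : (i < n)%N ->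
  ladder (at_row i v) = (if i is i'.+1 then at_row i' v else 0) - at_row i.+1 (v *m Phi).
Proof.
move=> im; apply: nat_rowP => j jn; rewrite nat_row_ladder //.
have row0 k : nat_row (0 : 'M[K]_(n, m)) k = 0 by apply/rowP => b; rewrite !mxE entry0.
have rowB P S k : nat_row (P - S) k = nat_row P k - nat_row S k.
  by apply/rowP => b; rewrite !mxE entryB.
rewrite rowB nat_row_at_row im andbT; congr (_ - _).
  case: i im => [|i] im; first by rewrite row0.
  by rewrite nat_row_at_row eqSS (ltnW im) andbT.
case: j jn => [|j] jn; rewrite nat_row_at_row.
  by [].
rewrite nat_row_at_row im andbT eqSS; case: eqP => [ji|_]; last by rewrite mul0mx.
by rewrite -ji jn.
Qed.

Lemma sum_at_row (U : 'M[K]_(n, m)) : U = \sum_(i < n) at_row i (row i U).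
Proof.
apply/matrixP => a b; rewrite summxE (bigD1 a) //= !mxE eqxx big1 ?addr0 // => i ia.
by rewrite mxE; case: eqP => // ai; case/eqP: ia; apply: val_inj.
Qed.

Lemma at_row_out i v : (n <= i)%N -> at_row i v = 0.
Proof.
by move=> ni; apply/matrixP => a b; rewrite !mxE; case: eqP => // ai; have := ltn_ord a; lia.
Qed.

(** Modulo the range, row [i] and row [i.+2] have the same span.  The odd
    rows are linked to the range by row 1, since row 0 of [R] has no row above
    it; the even rows need one full row of stars, unless they are linked to the
    row of index [n], outside the matrix, that is unless [n] is even. *)
Lemma ladder_span (Q : 'M[K]_(n, m) -> Prop) : lin_closed Q -> (forall R, Q (ladder R)) ->
  (exists i, [/\ ~~ odd i, (i < n.+1)%N & forall v, Q (at_row i v)]) -> forall U, Q U.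
Proof.
move=> Ql Qf [i0 [ev0 i0n Q0]] U.
have Qz : Q 0 by case: Ql.
have step i : (i.+1 < n)%N -> (forall v, Q (at_row i v)) <-> (forall v, Q (at_row i.+2 v)).
  move=> im; split=> QH v.
    have := lin_closedB Ql (QH (v *m invmx Phi)) (Qf (at_row i.+1 (v *m invmx Phi))).
    by rewrite ladder_at_row // mulmxKV // subKr.
  have := lin_closedD Ql (Qf (at_row i.+1 v)) (QH (v *m Phi)).
  by rewrite ladder_at_row // subrK.
have odd_rows i : odd i -> forall v, Q (at_row i v).
  elim/ltn_ind: i => -[|[|i]] IH // oi.
    move=> v; have := Qf (at_row 0 (- (v *m invmx Phi))); rewrite ladder_at_row // sub0r mulNmx mulmxKV //.
    by congr Q; apply/matrixP => a b; rewrite !mxE; case: ifP; rewrite ?opprK ?oppr0 // mxE opprK.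
  have [im|im] := ltnP i.+1 n; last by move=> v; rewrite at_row_out //; lia.
  apply/(step i im); apply: IH => //; move: oi; rewrite /= negbK //.
have even_rows i : ~~ odd i -> forall v, Q (at_row i v).
  have up k : forall v, Q (at_row (i0 + k.*2) v).
    elim: k => [|k IH]; first by rewrite addn0.
    rewrite doubleS !addnS; have [im|im] := ltnP (i0 + k.*2).+1 n; first by apply/(step _ im).
    by move=> v; rewrite at_row_out //; lia.
  (* the given row may be anywhere among the even ones: go down from it as well *)
  have down k : (k.*2 <= i0)%N -> forall v, Q (at_row (i0 - k.*2) v).
    elim: k => [|k IH] ki; first by rewrite subn0.
    have im : ((i0 - k.+1.*2).+1 < n)%N by lia.
    apply/(step _ im); rewrite (_ : (i0 - k.+1.*2).+2 = i0 - k.*2)%N; last by lia.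
    by apply: IH; lia.
  move=> ei; have [le|lt] := leqP i0 i.
    by have := up (i - i0)./2; rewrite (_ : i0 + _ = i)%N //; lia.
  by have := down (i0 - i)./2; rewrite (_ : i0 - _.*2 = i)%N; [apply; lia | lia].
rewrite [U]sum_at_row; apply: lin_closed_sum => // i _.
by case: (boolP (odd i)) => oi; [apply: odd_rows | apply: even_rows].
Qed.

(** Either end of the chain of even rows can carry the stars, whence the
    freedom in the choice of the full row. *)
Lemma ladder_complementary o :
  complementary ladder (supported (if odd n then zs_updown o else nostar : 'M[bool]_(n, m))).
Proof.
set D := (X in supported X).
have Ql := range_lin ladder_linear (supported_lin (K := K) D).
have Qf R : exists S, supported D (ladder R - ladder S).
  by exists R; rewrite subrr; case: (supported_lin (K := K) D).
have Qs U : supported D U -> exists S, supported D (U - ladder S).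
  move=> DU; exists 0; rewrite (_ : ladder 0 = 0) ?subr0 //.
  by rewrite /ladder !mulmx0 mul0mx subr0.
split.
  apply: (ladder_span Ql Qf); case on: (odd n); last first.
    (* the row of index n is zero and needs no stars *)
    exists n; split=> //; first by rewrite on.
    by move=> v; apply: Qs; rewrite at_row_out //; case: (supported_lin (K := K) D).
  exists (if top o then 0 else n.-1)%N; split; try by case: (top o) => //; lia.
  move=> v; apply: Qs; rewrite /D on => a b; rewrite !mxE; case: (top o); first by case: eqP.
  by move=> an; case: eqP => // ai; case/negP: an; apply/eqP; have := ltn_ord a; lia.
move=> R; rewrite /D; case: ifP => on; last first.
  move=> DU; apply/matrixP => a b; rewrite DU ?mxE //.
move=> DU; set U := ladder R in DU *.
pose r := (if top o then 0 else n.-1)%N.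
have U0 i : (i < n)%N -> i != r -> nat_row U i = 0.
  move=> im ir; apply/rowP => b; rewrite !mxE (entry_in _ im (ltn_ord b)) DU // !mxE /=.
  by move: ir; rewrite /r; case: (top o) => //; lia.
have UE i : (i < n)%N -> nat_row U i = nat_row R i.+1 - (if i is i'.+1 then nat_row R i' *m Phi else 0).
  exact: nat_row_ladder.
suff Rodd k : nat_row R k.*2.+1 = 0.
  apply: nat_rowP => i im; rewrite (_ : nat_row 0 i = 0); last by apply/rowP => b; rewrite !mxE entry0.
  have [ir|ir] := eqVneq i r; last exact: U0.
  have ei : ~~ odd i by rewrite ir /r; case: (top o) => //; lia.
  rewrite UE // (_ : i.+1 = i./2.*2.+1); last by lia.
  rewrite Rodd sub0r; case: i {ir} im ei => [|i] im ei; first by rewrite oppr0.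
  by rewrite (_ : i = (i.-1)./2.*2.+1); [rewrite Rodd mul0mx oppr0 | lia].
rewrite /r in U0; case: (top o) U0 => U0; last first.
  elim: k => [|k IH].
    have [n1|n1] := ltnP 1 n; last by rewrite nat_row_out.
    have /= E := UE 0%N n0; rewrite -[nat_row R _]subr0 -E U0 //; lia.
  have [im|im] := ltnP k.+1.*2.+1 n; last by rewrite nat_row_out.
  have := UE k.+1.*2 (ltnW im); rewrite U0; [|lia|lia].
  by rewrite doubleS IH mul0mx subr0.
have [le|lt] := leqP n k.*2.+1; first by rewrite nat_row_out.
have [d dk] : exists d, (n - k.*2.+1)%N = d by eexists.
elim/ltn_ind: d k lt dk => d IH k lt dk.
have im : (k.*2.+2 < n)%N by lia.
have := UE k.*2.+2 im; rewrite U0 //.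
have -> : nat_row R k.*2.+3 = 0.
  have [im'|im'] := ltnP k.*2.+3 n; last by rewrite nat_row_out.
  by have := IH (n - k.+1.*2.+1)%N _ k.+1; rewrite doubleS; apply; lia.
rewrite sub0r => /esym/eqP; rewrite oppr_eq0 => /eqP H.
by rewrite -[nat_row R _](mulmxK uPhi) H mul0mx.
Qed.

End Ladder.

(** The blocks paired with [J_n(0)] only enter through the invertibility of
    their cosquare, so that [H_m(l)] and [Gamma_m] give the same answer. *)
Lemma pair_XJ m n (A Phi : 'M[K]_m) o : (0 < n)%N -> A \in unitmx -> A^T *m Phi = A ->
  complementary (pair_map A (Jordan n 0))
    (pair_supported (if odd n then (zs_updown o, nostar) else (nostar, nostar))).
Proof.
move=> n0 uA AP; have uPhi : Phi \in unitmx.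
  by have := uA; rewrite -{1}AP unitmx_mul => /andP[].
have := pair_reduce uA AP (@nostarN m n) (ladder_complementary uPhi n0 o).
by case: (odd n).
Qed.

Lemma pair_HJ m n l o21 o12 : l != 0 -> (0 < n)%N ->
  complementary (pair_map (Hmx m l) (Jordan n 0)) (pair_supported (D_off o21 o12 (SumH m l) (SumJ K n))).
Proof. by move=> l0 n0; apply: pair_XJ (H_cosquareE m l0); rewrite ?Hmx_unit. Qed.

Lemma pair_GJ m n o21 o12 : (0 < n)%N ->
  complementary (pair_map (Gam K m) (Jordan n 0)) (pair_supported (D_off o21 o12 (SumG K m) (SumJ K n))).
Proof. by move=> n0; have [Phi [PE _]] := Gam_cosquare K m; apply: pair_XJ PE; rewrite ?Gam_unit. Qed.

End Nilpotent.

(** * Two nilpotent Jordan blocks *)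

Lemma pair_eqP (T1 T2 : Type) (p q : T1 * T2) : p.1 = q.1 -> p.2 = q.2 -> p = q.
Proof. by case: p q => [? ?] [? ?] /= -> ->. Qed.

Section NilpotentPair.
Variable K : numClosedFieldType.
Variables m n : nat.
Implicit Types (S V : 'M[K]_(m, n)) (R U : 'M[K]_(n, m)).

Local Notation f := (pair_map (Jordan m (0 : K)) (Jordan n (0 : K))).

Lemma pair_map_linear (A : 'M[K]_m) (B : 'M[K]_n) : linear (pair_map A B).
Proof.
move=> a [S R] [S' R']; rewrite /pair_map /=; congr (_, _).
  by rewrite linearD linearZ /= mulmxDl mulmxDr -scalemxAl -scalemxAr scalerDr addrACA.
by rewrite linearD linearZ /= mulmxDl mulmxDr -scalemxAl -scalemxAr scalerDr addrACA.
Qed.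

Lemma entry_JJ1 S R i j : (i < n)%N -> (j < m)%N ->
  entry (f (S, R)).1 i j = prd j (fun j' => entry S j' i) + entry R i.+1 j.
Proof.
move=> im jn; rewrite /pair_map /= entryD entry_J0_mul entry_mul_J0 //; congr (_ + _).
by case: (j) => //= j'; rewrite entry_tr.
Qed.

Lemma entry_JJ2 S R i j : (i < n)%N -> (j < m)%N ->
  entry (f (S, R)).2 j i = prd i (fun i' => entry R i' j) + entry S j.+1 i.
Proof.
move=> im jn; rewrite /pair_map /= entryD entry_J0_mul entry_mul_J0 //; congr (_ + _).
by case: (i) => //= i'; rewrite entry_tr.
Qed.

(** Both matrices of a pair are indexed by [(i, j)] with [i < n] and [j < m]:
    the second one is transposed. *)
Definition unit1 i j : 'M[K]_(n, m) * 'M[K]_(m, n) := (unit_mx i j, 0).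
Definition unit2 i j : 'M[K]_(n, m) * 'M[K]_(m, n) := (0, unit_mx j i).

(** This is one kind of edge of the graph on the matrix units; the vertex
    [unit1 i j.+1] is zero when [j.+1 = m]. *)
Lemma JJ_unit_S i j : (i < n)%N -> (j < m)%N ->
  f (unit_mx j i, 0) = unit1 i j.+1 + (if j is j'.+1 then unit2 i j' else 0).
Proof.
move=> im jm; apply: pair_eqP; apply: entryP => a b am bm.
  rewrite entry_JJ1 // entry0 addr0 entryD.
  have -> : entry ((if j is j'.+1 then unit2 i j' else 0).1) a b = 0.
    by case: (j) => [|j']; rewrite entry0.
  rewrite addr0 [RHS]entry_unit im; case: b bm => [|b] bm /=; first by rewrite !andbF.
  by rewrite entry_unit eqSS jm im /=; case: (eqVneq b j) => [<-|_]; rewrite ?bm ?andbT ?andbF.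
rewrite entry_JJ2 // (_ : prd b _ = 0) ?add0r; last by case: (b) => //= ?; rewrite entry0.
rewrite entryD entry0 add0r entry_unit; case: j jm => [|j] jm; first by rewrite !andbF entry0.
by rewrite entry_unit eqSS (ltnW jm) jm.
Qed.

Lemma JJ_unit_R i j : (i < n)%N -> (j < m)%N ->
  f (0, unit_mx i j) = unit2 i.+1 j + (if i is i'.+1 then unit1 i' j else 0).
Proof.
move=> im jm; apply: pair_eqP; apply: entryP => a b am bm.
  rewrite entry_JJ1 // (_ : prd b _ = 0) ?add0r; last by case: (b) => //= ?; rewrite entry0.
  rewrite entryD entry0 add0r entry_unit; case: i im => [|i] im; first by rewrite !andbF entry0.
  by rewrite entry_unit eqSS (ltnW im) im.
rewrite entry_JJ2 // entry0 addr0 entryD.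
have -> : entry ((if i is i'.+1 then unit1 i' j else 0).2) a b = 0.
  by case: (i) => [|i']; rewrite entry0.
rewrite addr0 [RHS]entry_unit jm; case: b bm => [|b] bm /=; first by rewrite !andbF.
by rewrite entry_unit eqSS im jm /=; case: (eqVneq b i) => [<-|_]; rewrite ?bm ?andbT ?andbF.
Qed.

(** The edges make [unit1 i j] equivalent to [unit2 i.+2 j], and [unit2 i j]
    to [unit1 i j.+2].  Going up along a path, every vertex leads to one in the
    last row or in the last column, or out of the matrix.  The vertices there
    are stars, or are reached from a star at the other end of the path, or from
    a loose end at [unit1 i 1] or [unit2 1 j].  The two alternatives for the
    stars are the two ends of the same paths, and those with [n < j] lie on
    paths which begin with a loose end when [n] is even. *)
Lemma JJ_span (Q : 'M[K]_(n, m) * 'M[K]_(m, n) -> Prop) : (0 < n)%N -> (n <= m)%N ->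
  lin_closed Q -> (forall SR, Q (f SR)) ->
  ((forall k, (k.*2 < n)%N -> Q (unit1 (n.-1 - k.*2) 0)) \/
   (forall k, (k.*2 < n)%N -> Q (unit1 n.-1 k.*2))) ->
  (odd n -> forall j, (n < j)%N -> (j < m)%N -> Q (unit1 n.-1 j)) ->
  ((forall k, (k.*2 < n)%N -> Q (unit2 k.*2 m.-1)) \/
   (forall k, (k.*2 < n)%N -> Q (unit2 0 (m.-1 - k.*2)))) ->
  forall UV, Q UV.
Proof.
move=> n0 nm Ql Qf Q1 QP Q2.
have Q0 : Q 0 by case: Ql.
have out1 i j : ~~ ((i < n) && (j < m))%N -> Q (unit1 i j).
  by move=> out; rewrite /unit1 unit_mx_out.
have out2 i j : ~~ ((i < n) && (j < m))%N -> Q (unit2 i j).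
  by move=> out; rewrite /unit2 unit_mx_out // andbC.
have sumQ u v : Q (u + v) -> Q u <-> Q v.
  move=> Quv; split=> H; first by have := lin_closedB Ql Quv H; rewrite addrC addKr.
  by have := lin_closedB Ql Quv H; rewrite addrK.
have e1 i j : (i.+1 < n)%N -> Q (unit1 i j) <-> Q (unit2 i.+2 j).
  move=> im; have [jm|mj] := ltnP j m; last first.
    by split=> _; [apply: out2 | apply: out1]; rewrite negb_and -!leqNgt mj orbT.
  by apply: iff_sym; apply: sumQ; rewrite -(JJ_unit_R im jm).
have e2 i j : (j.+1 < m)%N -> Q (unit2 i j) <-> Q (unit1 i j.+2).
  move=> jm; have [im|mi] := ltnP i n; last first.
    by split=> _; [apply: out1 | apply: out2]; rewrite negb_and -!leqNgt mi.
  by apply: iff_sym; apply: sumQ; rewrite -(JJ_unit_S im jm).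
have u1 i : Q (unit1 i 1).
  have [im|mi] := ltnP i n; last by apply: out1; rewrite negb_and -leqNgt mi.
  by have := Qf (unit_mx 0 i, 0); rewrite JJ_unit_S ?addr0 //; lia.
have u2 j : Q (unit2 1 j).
  have [jm|mj] := ltnP j m; last by apply: out2; rewrite negb_and -!leqNgt mj orbT.
  by have := Qf (0, unit_mx 0 j); rewrite JJ_unit_R ?addr0.
have up1 k i j : (i + k.*2 < n)%N -> (j + k.*2 < m)%N -> Q (unit1 i j) -> Q (unit1 (i + k.*2) (j + k.*2)).
  elim: k => [|k IH] ik jk H; first by rewrite !addn0.
  rewrite doubleS !addnS; apply/e2; first by lia.
  by apply/e1; [lia | apply: IH => //; lia].
have up2 k i j : (i + k.*2 < n)%N -> (j + k.*2 < m)%N -> Q (unit2 i j) -> Q (unit2 (i + k.*2) (j + k.*2)).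
  elim: k => [|k IH] ik jk H; first by rewrite !addn0.
  rewrite doubleS !addnS; apply/e1; first by lia.
  by apply/e2; [lia | apply: IH => //; lia].
have last1 j : (j < m)%N -> Q (unit1 n.-1 j).
  move=> jm; have [jn|nj] := ltnP j n.
    have [ev|od] := boolP (~~ odd j).
      case: Q1 => Q1; last by have := Q1 j./2; rewrite (_ : j./2.*2 = j) //; [exact | lia].
      have := up1 j./2 (n.-1 - j)%N 0%N; rewrite (_ : j./2.*2 = j); last by lia.
      rewrite (_ : n.-1 - j + j = n.-1)%N ?add0n; last by lia.
      apply; [lia | lia |]; have := Q1 j./2; rewrite (_ : j./2.*2 = j); last by lia.
      exact.
    have := up1 j.-1./2 (n - j)%N 1%N; rewrite (_ : j.-1./2.*2 = j.-1)%N; last by lia.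
    rewrite (_ : n - j + j.-1 = n.-1)%N; last by lia.
    rewrite (_ : 1 + j.-1 = j)%N; last by lia.
    by apply; [lia | lia | exact: u1].
  case on: (odd n).
    have [nj'|jn] := ltnP n j; first exact: QP.
    have := up1 n.-1./2 0%N 1%N; rewrite (_ : n.-1./2.*2 = n.-1)%N; last by lia.
    rewrite add0n add1n prednK // (_ : n = j); last by lia.
    by apply; [lia | lia | exact: u1].
  have := up1 n.-2./2 1%N (j - n).+2; rewrite (_ : n.-2./2.*2 = n.-2)%N; last by lia.
  rewrite (_ : 1 + n.-2 = n.-1)%N; last by lia.
  rewrite (_ : (j - n).+2 + n.-2 = j)%N; last by lia.
  by apply; [lia | lia |]; apply/e2; [lia | exact: u2].
have last2 i : (i < n)%N -> Q (unit2 i m.-1).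
  move=> im; have [ev|od] := boolP (~~ odd i).
    case: Q2 => Q2; first by have := Q2 i./2; rewrite (_ : i./2.*2 = i) //; [exact | lia].
    have := up2 i./2 0%N (m.-1 - i)%N; rewrite (_ : i./2.*2 = i); last by lia.
    rewrite (_ : m.-1 - i + i = m.-1)%N ?add0n; last by lia.
    apply; [lia | lia |]; have := Q2 i./2; rewrite (_ : i./2.*2 = i); last by lia.
    exact.
  have := up2 i.-1./2 1%N (m - i)%N; rewrite (_ : i.-1./2.*2 = i.-1)%N; last by lia.
  rewrite (_ : m - i + i.-1 = m.-1)%N; last by lia.
  rewrite (_ : 1 + i.-1 = i)%N; last by lia.
  by apply; [lia | lia | exact: u2].
have all d : forall i j, (n + m - (i + j) <= d)%N -> (i < n)%N -> (j < m)%N -> Q (unit1 i j) /\ Q (unit2 i j).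
  elim: d => [|d IH] i j dij im jm; first lia.
  split.
    have [im'|mi] := ltnP i.+1 n; last by rewrite (_ : i = n.-1); [exact: last1 | lia].
    apply/e1 => //; have [ii|ii] := ltnP i.+2 n; last by apply: out2; rewrite negb_and -leqNgt ii.
    by have [] // := IH i.+2 j; lia.
  have [jm'|mj] := ltnP j.+1 m; last by rewrite (_ : j = m.-1); [exact: last2 | lia].
  apply/e2 => //; have [jj|jj] := ltnP j.+2 m; last by apply: out1; rewrite negb_and -!leqNgt jj orbT.
  by have [] // := IH i j.+2; lia.
have all1 i j : (i < n)%N -> (j < m)%N -> Q (unit1 i j) by move=> im jm; case: (all _ i j (leqnn _) im jm).
have all2 i j : (i < n)%N -> (j < m)%N -> Q (unit2 i j) by move=> im jm; case: (all _ i j (leqnn _) im jm).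
move=> [U V].
have -> : (U, V) = \sum_(ij : 'I_n * 'I_m) U ij.1 ij.2 *: unit1 ij.1 ij.2 +
    \sum_(ij : 'I_n * 'I_m) V ij.2 ij.1 *: unit2 ij.1 ij.2.
  have fs (F : 'I_n * 'I_m -> 'M[K]_(n, m) * 'M[K]_(m, n)) : \sum_ij F ij = (\sum_ij (F ij).1, \sum_ij (F ij).2).
    by rewrite [LHS]surjective_pairing !raddf_sum.
  rewrite !fs; apply/eqP; rewrite -pair_eqE /=; apply/andP; split; apply/eqP/matrixP => a b; rewrite mxE !summxE.
    rewrite [X in _ + X]big1 ?addr0 => [|ij _]; last by rewrite !mxE mulr0.
    rewrite (bigD1 (a, b)) //= !mxE !eqxx mulr1 big1 ?addr0 // => -[i j] /= ij; rewrite !mxE.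
    case: andP => [[/eqP ai /eqP bj]|_]; rewrite ?mulr0 //; case/eqP: ij; congr (_, _); exact: val_inj.
  rewrite [X in X + _]big1 ?add0r => [|ij _]; last by rewrite !mxE mulr0.
  rewrite (bigD1 (b, a)) //= !mxE !eqxx mulr1 big1 ?addr0 // => -[i j] /= ij; rewrite !mxE.
  case: andP => [[/eqP ai /eqP bj]|_]; rewrite ?mulr0 //; case/eqP: ij; congr (_, _); exact: val_inj.
by apply: lin_closedD => //; apply: lin_closed_sum => // ij _; apply: lin_closedZ => //; [apply: all1 | apply: all2].
Qed.

End NilpotentPair.

Section Paths.
Local Open Scope nat_scope.
Variable K : fieldType.
Variables (m n : nat) (u v r s : nat -> nat -> K).
Hypothesis n0 : (0 < n)%N.
Hypothesis nm : (n <= m)%N.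
Hypothesis uE : forall i j, (i < n)%N -> (j < m)%N -> u i j = (s i j + r i.+2 j)%R.
Hypothesis vE : forall i j, (i < n)%N -> (j < m)%N -> v i j = (r i j + s i j.+2)%R.
Hypothesis s0 : forall i, s i 0%N = 0%R.
Hypothesis r0 : forall j, r 0%N j = 0%R.
Hypothesis sm : forall i, s i m.+1 = 0%R.
Hypothesis rn : forall j, r n.+1 j = 0%R.

(** Here [u] and [v] are the entries of the image of a pair of matrices whose
    entries are the edge variables [r] and [s].  If two consecutive edge
    variables meet at a vertex that is no star and one of them is zero, so is
    the other; the four lemmas follow a path in either direction, starting from
    either kind of edge. *)
Lemma walk_up_s i j k : (i + k.*2 < n)%N -> (j + k.*2 < m)%N -> s i j = 0%R ->
  (forall l, (l < k)%N -> u (i + l.*2) (j + l.*2) = 0%R /\ v (i + l.*2).+2 (j + l.*2) = 0%R) ->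
  s (i + k.*2) (j + k.*2) = 0%R.
Proof.
elim: k => [|k IH] ik jk sij z; first by rewrite !addn0.
have [uz vz] := z k (ltnSn k).
have sz : s (i + k.*2) (j + k.*2) = 0%R.
  by apply: IH => [| | |l lk]; [lia | lia | | apply: z; lia].
have := @uE (i + k.*2) (j + k.*2) ltac:(lia) ltac:(lia); rewrite uz sz add0r => /esym rz.
have := @vE (i + k.*2).+2 (j + k.*2) ltac:(lia) ltac:(lia); rewrite vz rz add0r => /esym.
by rewrite doubleS !addnS.
Qed.

Lemma walk_up_r i j k : (i + k.*2 < n)%N -> (j + k.*2 < m)%N -> r i j = 0%R ->
  (forall l, (l < k)%N -> v (i + l.*2) (j + l.*2) = 0%R /\ u (i + l.*2) (j + l.*2).+2 = 0%R) ->
  r (i + k.*2) (j + k.*2) = 0%R.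
Proof.
elim: k => [|k IH] ik jk sij z; first by rewrite !addn0.
have [vz uz] := z k (ltnSn k).
have rz : r (i + k.*2) (j + k.*2) = 0%R.
  by apply: IH => [| | |l lk]; [lia | lia | | apply: z; lia].
have := @vE (i + k.*2) (j + k.*2) ltac:(lia) ltac:(lia); rewrite vz rz add0r => /esym sz.
have := @uE (i + k.*2) (j + k.*2).+2 ltac:(lia) ltac:(lia); rewrite uz sz add0r => /esym.
by rewrite doubleS !addnS.
Qed.

Lemma walk_down_r i j k : (i + k.*2 < n)%N -> (j + k.*2 < m)%N -> r (i + k.*2).+2 (j + k.*2) = 0%R ->
  (forall l, (l < k)%N -> u (i + l.*2).+2 (j + l.*2).+2 = 0%R /\ v (i + l.*2).+2 (j + l.*2) = 0%R) ->
  r i.+2 j = 0%R.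
Proof.
elim: k i j => [|k IH] i j ik jk; first by rewrite !addn0.
rewrite doubleS !addnS => rz z.
have rz' : r i.+4 j.+2 = 0%R.
  apply: IH => [| | |l lk]; [lia | lia | by rewrite !addSn | ].
  by have := z l.+1 lk; rewrite doubleS !addnS !addSn.
have [] := z 0%N isT; rewrite !addn0 => uz vz.
have := @uE i.+2 j.+2 ltac:(lia) ltac:(lia); rewrite uz rz' addr0 => /esym sz.
by have := @vE i.+2 j ltac:(lia) ltac:(lia); rewrite vz sz addr0 => /esym.
Qed.

Lemma walk_down_s i j k : (i + k.*2 < n)%N -> (j + k.*2 < m)%N -> s (i + k.*2) (j + k.*2).+2 = 0%R ->
  (forall l, (l < k)%N -> v (i + l.*2).+2 (j + l.*2).+2 = 0%R /\ u (i + l.*2) (j + l.*2).+2 = 0%R) ->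
  s i j.+2 = 0%R.
Proof.
elim: k i j => [|k IH] i j ik jk; first by rewrite !addn0.
rewrite doubleS !addnS => sz z.
have sz' : s i.+2 j.+4 = 0%R.
  apply: IH => [| | |l lk]; [lia | lia | by rewrite !addSn | ].
  by have := z l.+1 lk; rewrite doubleS !addnS !addSn.
have [] := z 0%N isT; rewrite !addn0 => vz uz.
have := @vE i.+2 j.+2 ltac:(lia) ltac:(lia); rewrite vz sz' addr0 => /esym rz.
by have := @uE i j.+2 ltac:(lia) ltac:(lia); rewrite uz rz addr0 => /esym.
Qed.

Variables col1 col2 : bool.
Hypothesis tie1 : ~~ col1 -> n = m.
Hypothesis tie2 : ~~ col2 -> n = m.

(** The two shapes are the two ends at which the stars of a square block can
    be put; [col1] and [col2] stand for the outer line being a column. *)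
Definition star1 i j : bool :=
  (if col1 then (j == 0%N) && odd (n - i) else (i == n.-1) && ~~ odd j)
  || [&& odd n, i == n.-1 & (n < j)%N].

Definition star2 i j : bool :=
  if col2 then (j == m.-1) && ~~ odd i else (i == 0%N) && odd (m - j).

Hypothesis u0 : forall i j, (i < n)%N -> (j < m)%N -> ~~ star1 i j -> u i j = 0%R.
Hypothesis v0 : forall i j, (i < n)%N -> (j < m)%N -> ~~ star2 i j -> v i j = 0%R.

(** A path without loose end contains only one star.  Walking towards it from
    both ends shows that the variables of its adjacent edges are zero, hence the
    star entry, which is their sum, is zero too. *)
Lemma path_indep i j : (i < n)%N -> (j < m)%N -> u i j = 0%R /\ v i j = 0%R.
Proof.
have tie1' := tie1; have tie2' := tie2.
move=> im jm; split.
  have [st|] := boolP (star1 i j); last exact: u0.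
  rewrite uE //.
  have [/and3P[on /eqP ie nj]|P] := boolP [&& odd n, i == n.-1 & (n < j)%N].
    rewrite ie (_ : n.-1.+2 = n.+1) ?rn ?addr0; last by lia.
    (* the other end of this path is in the first row, where r vanishes *)
    have rz : r (0 + n.-1./2.*2) (j - n.-1.+2 + n.-1./2.*2) = 0%R.
      apply: walk_up_r; [lia | lia | exact: r0 | move=> l lk; split].
        by apply: v0; rewrite /star2; [lia | lia |]; case: col2 tie2' => t; lia.
      by apply: u0; rewrite /star1; [lia | lia |]; case: col1 tie1' => t; lia.
    have := @vE n.-1 (j - 2) ltac:(lia) ltac:(lia); rewrite v0; [| lia | lia |]; last first.
      by rewrite /star2; case: col2 tie2' => t; lia.
    rewrite (_ : r _ _ = 0%R) ?add0r; last first.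
      by rewrite -{}[RHS]rz; congr (r _ _); lia.
    by move=> ->; congr (s _ _); lia.
  move: st; rewrite /star1 (negPf P) orbF; case cE: col1 => /andP[/eqP].
    move=> -> od; rewrite s0 add0r.
    apply: (@walk_down_r _ _ (n.-1 - i)./2); [lia | lia | |].
      by rewrite -{}[RHS](rn (0 + (n.-1 - i)./2.*2)); congr (r _ _); lia.
    move=> l lk; split.
      by apply: u0; rewrite /star1 ?cE; [lia | lia | lia].
    by apply: v0; rewrite /star2; [lia | lia |]; case: col2 tie2' => t; lia.
  have nmE : n = m by apply: tie1; rewrite cE.
  move=> -> od; rewrite (_ : n.-1.+2 = n.+1) ?rn ?addr0; last by lia.
  have := @walk_up_s (n.-1 - j)%N 0%N j./2; rewrite (_ : n.-1 - j + _ = n.-1)%N; last by lia.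
  rewrite (_ : 0 + _ = j)%N; last by lia.
  apply; [lia | lia | exact: s0 | move=> l lk; split].
    by apply: u0; rewrite /star1 ?cE; [lia | lia | lia].
  by apply: v0; rewrite /star2; [lia | lia |]; case: col2 tie2' => t; lia.
have [st|] := boolP (star2 i j); last exact: v0.
rewrite vE //; move: st; rewrite /star2; case cE: col2 => /andP[/eqP].
  move=> -> od; rewrite (_ : m.-1.+2 = m.+1) ?sm ?addr0; last by lia.
  have := @walk_up_r 0%N (m.-1 - i)%N i./2; rewrite (_ : m.-1 - i + _ = m.-1)%N; last by lia.
  rewrite (_ : 0 + _ = i)%N; last by lia.
  apply; [lia | lia | exact: r0 | move=> l lk; split].
    by apply: v0; rewrite /star2 ?cE; [lia | lia | lia].
  by apply: u0; rewrite /star1; [lia | lia |]; case: col1 tie1' => t; lia.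
have nmE : n = m by apply: tie2; rewrite cE.
move=> -> od; rewrite r0 add0r.
apply: (@walk_down_s _ _ (m.-1 - j)./2); [lia | lia | |].
  by rewrite -{}[RHS](sm (0 + (m.-1 - j)./2.*2)); congr (s _ _); lia.
move=> l lk; split.
  by apply: v0; rewrite /star2 ?cE; [lia | lia | lia].
by apply: u0; rewrite /star1; [lia | lia |]; case: col1 tie1' => t; lia.
Qed.

End Paths.

Section NilpotentBlocks.
Variable K : numClosedFieldType.

Lemma D_JJ1E m n o21 o12 (i : 'I_n) (j : 'I_m) : (n <= m)%N ->
  (D_off o21 o12 (SumJ K m) (SumJ K n)).1 i j =
  star1 n ((n < m)%N || tie_col o21 SW) i j.
Proof.
move=> nm; have im := ltn_ord i; have jm := ltn_ord j.
have E : (zs_odd SW o21 : 'M_(n, m)) i j = if (n < m)%N || tie_col o21 SW then (j == 0%N :> nat) && odd (n - i) else (i == n.-1 :> nat) && ~~ odd j.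
  rewrite mxE /= (_ : (n < m)%N || (n == m) && tie_col o21 SW = (n < m)%N || tie_col o21 SW); last by lia.
  case: ifP => _; lia.
have -> : (D_off o21 o12 (SumJ K m) (SumJ K n)).1 =
    if odd n then zs_add (zs_odd SW o21) zs_P else zs_odd SW o21 by rewrite /D_off; case: ifP.
rewrite /star1 -E; case: ifP => on; last by rewrite orbF.
rewrite [LHS]mxE; congr (_ || _); rewrite [LHS]mxE /=; apply/idP/idP; lia.
Qed.

Lemma D_JJ2E m n o21 o12 (i : 'I_n) (j : 'I_m) : (n <= m)%N ->
  (D_off o21 o12 (SumJ K m) (SumJ K n)).2 j i =
  star2 m (~~ ((n == m) && tie_col o12 SW)) i j.
Proof.
move=> nm; have im := ltn_ord i; have jm := ltn_ord j.
have -> : (D_off o21 o12 (SumJ K m) (SumJ K n)).2 = zs_odd SW o12 by rewrite /D_off; case: ifP.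
rewrite mxE /= /star2 (_ : (m < n)%N || (m == n) && tie_col o12 SW = (n == m) && tie_col o12 SW); last by lia.
by case: ifP => _ /=; lia.
Qed.

Lemma pair_JJ m n o21 o12 : (0 < n)%N -> (n <= m)%N ->
  complementary (pair_map (Jordan m (0 : K)) (Jordan n 0)) (pair_supported (D_off o21 o12 (SumJ K m) (SumJ K n))).
Proof.
move=> n0 nm; set D := D_off _ _ _ _.
set c1 := (n < m)%N || tie_col o21 SW; set c2 := ~~ ((n == m) && tie_col o12 SW).
have D1 i j : D.1 i j = star1 n c1 i j := D_JJ1E o21 o12 i j nm.
have D2 i j : D.2 j i = star2 m c2 i j := D_JJ2E o21 o12 i j nm.
have Dl : lin_closed (pair_supported D : 'M[K]_(n, m) * 'M[K]_(m, n) -> Prop).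
  split=> [|a u v [u1 u2] [v1 v2]].
    by split; [case: (supported_lin (K := K) D.1) | case: (supported_lin (K := K) D.2)].
  by split; [case: (supported_lin (K := K) D.1) | case: (supported_lin (K := K) D.2)] => _; apply.
have fl := @pair_map_linear K m n (Jordan m 0) (Jordan n 0).
have f0 : pair_map (Jordan m (0 : K)) (Jordan n 0) 0 = 0.
  by have := fl (-1) 0 0; rewrite scaler0 addr0 scaleN1r addNr.
split.
  have sD1 i j : star1 n c1 i j -> exists w, pair_supported D (unit1 K m n i j - pair_map (Jordan m 0) (Jordan n 0) w).
    move=> st; exists 0; rewrite f0 subr0; split=> /=; last by case: (supported_lin (K := K) D.2).
    by move=> a b; rewrite D1 mxE; case: eqP => [->|] //; case: eqP => [->|] //; rewrite st.
  have sD2 i j : star2 m c2 i j -> exists w, pair_supported D (unit2 K m n i j - pair_map (Jordan m 0) (Jordan n 0) w).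
    move=> st; exists 0; rewrite f0 subr0; split=> /=; first by case: (supported_lin (K := K) D.1).
    by move=> a b; rewrite D2 mxE; case: eqP => [->|] //; case: eqP => [->|] //; rewrite st.
  apply: (JJ_span n0 nm (range_lin fl Dl)).
  - by move=> SR; exists SR; rewrite subrr; case: Dl.
  - have [c|c] := boolP c1; [left | right] => k kn; apply: sD1; rewrite /star1.
    + by rewrite c; lia.
    + by rewrite (negPf c); lia.
  - by move=> on j nj jm; apply: sD1; rewrite /star1 on nj eqxx orbT.
  - have [c|c] := boolP c2; [left | right] => k kn; apply: sD2; rewrite /star2.
    + by rewrite c; lia.
    + by rewrite (negPf c); lia.
move=> [S R]; case F : (pair_map _ _ (S, R)) => [U V] [/= DU DV].
have UE i j : (i < n)%N -> (j < m)%N -> entry U i j = prd j (fun j' => entry S j' i) + entry R i.+1 j.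
  by move=> im jm; rewrite -entry_JJ1 // F.
have VE i j : (i < n)%N -> (j < m)%N -> entry V j i = prd i (fun i' => entry R i' j) + entry S j.+1 i.
  by move=> im jm; rewrite -entry_JJ2 // F.
have indep i j : (i < n)%N -> (j < m)%N -> entry U i j = 0 /\ entry V j i = 0.
  apply: (@path_indep K m n (fun i j => entry U i j) (fun i j => entry V j i)
    (fun i j => prd i (fun i' => entry R i' j)) (fun i j => prd j (fun j' => entry S j' i)) n0 nm
    UE VE _ _ _ _ c1 c2) => //=.
  - by move=> {}i; rewrite entry_out // negb_and -leqNgt leqnn.
  - by move=> {}j; rewrite entry_out // negb_and -leqNgt leqnn.
  - by rewrite /c1; lia.
  - by rewrite /c2; lia.
  - by move=> {}i {}j im jm st; rewrite (entry_in _ im jm) DU // D1.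
  - by move=> {}i {}j im jm st; rewrite (entry_in _ jm im) DV // D2.
have -> : U = 0 by apply: entryP => i j im jm; rewrite entry0; case: (indep i j im jm).
by have -> : V = 0 by apply: entryP => j i jm im; rewrite entry0; case: (indep i j im jm).
Qed.

(** By symmetry, a solution [(S, R)] of the problem for the pair [(U, U)]
    can be replaced by the mean [(S + R) / 2] of its components. *)
Lemma diag_of_pair n (A : 'M[K]_n) (D : 'M[bool]_n) :
  complementary (pair_map A A) (pair_supported (D, D)) -> complementary (diag_map A) (supported D).
Proof.
move=> [span indep]; split=> [U|X DX].
  have [[S R] [/= D1 D2]] := span (U, U); exists (2%:R^-1 *: (S + R)).
  have E : diag_map A (2%:R^-1 *: (S + R)) = 2%:R^-1 *: ((S^T *m A + A *m R) + (R^T *m A + A *m S)).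
    rewrite /diag_map linearZ /= -scalemxAl -scalemxAr -scalerDr [(S + R)^T]raddfD /= mulmxDl mulmxDr.
    by rewrite [A *m S + _]addrC addrACA.
  have UE : U = 2%:R^-1 *: (U + U) by rewrite half_double.
  rewrite E {1}UE -scalerBr opprD addrACA scalerDr.
  have Dl := supported_lin (K := K) D.
  exact: (lin_closedD Dl (lin_closedZ 2%:R^-1 Dl D1) (lin_closedZ 2%:R^-1 Dl D2)).
exact: (congr1 fst (indep (X, X) (conj DX DX))).
Qed.

Lemma diag_J n o : (0 < n)%N -> complementary (diag_map (Jordan n (0 : K))) (supported (D_diag o (SumJ K n))).
Proof.
move=> n0; apply: diag_of_pair; have := pair_JJ o o n0 (leqnn n); rewrite /D_off.
rewrite (_ : zs_add _ zs_P = zs_odd SW o); first by case: ifP.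
by apply/matrixP => i j; rewrite mxE [zs_P _ _]mxE (_ : _ && _ = false) ?orbF //; have := ltn_ord j; lia.
Qed.

End NilpotentBlocks.

(** * Direct sums *)

Section Blocks.
Variable K : numFieldType.
Variables (t : nat) (d : 'I_t -> nat).
Variables (A : forall i, 'M[K]_(d i)) (D : forall i j, 'M[bool]_(d i, d j)).

Lemma submxblock_diag_map X i j : submxblock (diag_map (\mxdiag_i A i) X) i j =
  (submxblock X j i)^T *m A j + A i *m submxblock X i j.
Proof.
rewrite /diag_map -{1 2}[X]submxblockK tr_mxblock mul_mxblock_mxdiag mul_mxdiag_mxblock.
by rewrite submxblockD !mxblockK.
Qed.

Lemma supported_mxblock (U : 'M[K]_(\sum_i d i)) :
  supported (\mxblock_(i, j) D i j) U <-> forall i j, supported (D i j) (submxblock U i j).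
Proof.
split=> [DU i j a b|DU a b].
  have /matrixP/(_ a b) := mxblockK D i j; rewrite mxE => <- st.
  by rewrite mxE; apply: DU.
by rewrite mxE => st; rewrite -[U]submxblockK mxE; apply: DU.
Qed.

(** The block [(i, j)] of [X^T A + A X] is [X_ji^T A_j + A_i X_ij], so that
    the unknown [X] can be found, and the image shown to vanish, one pair of
    blocks at a time. *)
Lemma complementary_blocks :
  (forall i, complementary (diag_map (A i)) (supported (D i i))) ->
  (forall i j : 'I_t, (i < j)%N -> complementary (pair_map (A i) (A j)) (pair_supported (D j i, D i j))) ->
  complementary (diag_map (\mxdiag_i A i)) (supported (\mxblock_(i, j) D i j)).
Proof.
move=> diag off; split=> [U|X].
  pose P i j (SR : 'M[K]_(d i, d j) * 'M[K]_(d j, d i)) := (i < j)%N ->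
    pair_supported (D j i, D i j) ((submxblock U j i, submxblock U i j) - pair_map (A i) (A j) SR).
  have ex i j : exists SR, P i j SR.
    rewrite /P; case: (boolP (i < j)%N) => [ij|_]; last by exists 0.
    by have [SR H] := (off i j ij).1 (submxblock U j i, submxblock U i j); exists SR.
  pose W i j := sval (cid (ex i j)); have WP i j : P i j (W i j) := svalP (cid (ex i j)).
  have exd i : exists Y, supported (D i i) (submxblock U i i - diag_map (A i) Y) := (diag i).1 _.
  pose Y i := sval (cid (exd i)); have YP i := svalP (cid (exd i)).
  (* conform_mx only transports Y i to the type of the block (i, j) when i = j *)
  pose X i j : 'M[K]_(d i, d j) := if (i < j)%N then (W i j).1 else if (j < i)%N then (W j i).2
    else conform_mx 0 (Y i).
  exists (\mxblock_(i, j) X i j); apply/supported_mxblock => i j.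
  rewrite submxblockB submxblock_diag_map !mxblockK.
  case: (ltngtP i j) => ij.
  - rewrite /X ij ltnNge (ltnW ij) /=; exact: (WP i j ij).2.
  - rewrite /X ij ltnNge (ltnW ij) /=; exact: (WP j i ij).1.
  - have {ij} ij : i = j by exact: val_inj.
    by rewrite -ij /X ltnn conform_mx_id; exact: YP.
move=> /supported_mxblock DX; apply/mxblockP => i j; rewrite submxblock0.
have DX' k l : supported (D k l) ((submxblock X l k)^T *m A l + A k *m submxblock X k l).
  by rewrite -submxblock_diag_map.
have pair0 (k l : 'I_t) : (k < l)%N ->
  pair_map (A k) (A l) (submxblock X k l, submxblock X l k) = 0.
  by move=> kl; apply: (off k l kl).2; split; exact: DX'.
rewrite submxblock_diag_map; case: (ltngtP i j) => ij.
- exact: (congr1 snd (pair0 i j ij)).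
- exact: (congr1 fst (pair0 j i ij)).
- have <- : i = j by exact: val_inj.
  by apply: (diag i).2; exact: DX'.
Qed.

End Blocks.

(** * Canonical matrices *)

Section Canonical.
Variable K : numClosedFieldType.
Variables (hs : seq (nat * K)) (gs js : seq nat).
Hypothesis can : canonical_data hs gs js.
Local Notation s := (summands hs gs js).

Definition valid_summand (x : summand K) :=
  match x with SumH m l => l != 0 | SumG n => (0 < n)%N | SumJ n => (0 < n)%N end.

(** What the order of the summands of a canonical matrix guarantees. *)
Definition valid_order (x y : summand K) :=
  match x, y with
  | SumG _, SumH _ _ | SumJ _, SumH _ _ | SumJ _, SumG _ => False
  | SumJ m, SumJ n => (n <= m)%N
  | _, _ => True
  end.

Lemma complementary_diag x o : valid_summand x -> complementary (diag_map (smx x)) (supported (D_diag o x)).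
Proof. by case: x => [m l|n|n] /=; [exact: diag_H | exact: diag_G | exact: diag_J]. Qed.

Lemma complementary_pair x y o21 o12 : valid_summand x -> valid_summand y -> valid_order x y ->
  complementary (pair_map (smx x) (smx y)) (pair_supported (D_off o21 o12 x y)).
Proof.
case: x y => [m l|m|m] [n mu|n|n] //= vx vy vxy.
- exact: pair_HH.
- exact: pair_HG.
- exact: pair_HJ.
- exact: pair_GG.
- exact: pair_GJ.
- exact: pair_JJ.
Qed.

Lemma nth_summands x0 k : nth x0 s k =
  if (k < size hs)%N then let h := nth (0%N, 0) hs k in SumH h.1 h.2
  else if (k < size hs + size gs)%N then SumG K (nth 0%N gs (k - size hs))
  else if (k < size s)%N then SumJ K (nth 0%N js (k - (size hs + size gs))) else x0.
Proof.
rewrite /summands !nth_cat !size_cat !size_map.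
case: ltnP => k1; first by rewrite (nth_map (0%N, 0)).
rewrite ltn_subLR // ; case: ltnP => k2; first by rewrite (nth_map 0%N) // ltn_subLR.
rewrite -subnDA; case: ltnP => k3; first by rewrite (nth_map 0%N) //; lia.
by rewrite nth_default // size_map; lia.
Qed.

Lemma valid_nth x0 k : (k < size s)%N -> valid_summand (nth x0 s k).
Proof.
have [hH hG hJ _] := can; move=> ks; rewrite nth_summands.
have ss : size s = (size hs + size gs + size js)%N by rewrite !size_cat !size_map addnA.
case: ltnP => k1.
  have := mem_nth (0%N, 0) k1; case: (nth _ _ _) => p l /= /hH[] //.
case: ltnP => k2; first by apply: hG; apply: mem_nth; rewrite ltn_subLR.
by rewrite ks; apply: hJ; apply: mem_nth; rewrite ltn_subLR // -ss.
Qed.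

Lemma valid_order_nth x0 k l : (k < l)%N -> (l < size s)%N -> valid_order (nth x0 s k) (nth x0 s l).
Proof.
have [_ _ _ srt] := can; move=> kl ls; rewrite !nth_summands.
have ss : size s = (size hs + size gs + size js)%N by rewrite !size_cat !size_map addnA.
rewrite ls (ltn_trans kl ls).
case: (ltnP k (size hs)) => k1 /=; first by case: (ltnP l (size hs)) => // _; case: (ltnP l (size hs + size gs)).
rewrite (leq_gtF (leq_trans k1 (ltnW kl))).
case: (ltnP k (size hs + size gs)) => k2 /=; first by case: (ltnP l (size hs + size gs)).
rewrite (leq_gtF (leq_trans k2 (ltnW kl))) /=.
have tr : transitive geq by move=> a b c ba ac; exact: leq_trans ac ba.
have := @sorted_leq_nth _ geq tr leqnn 0%N js srt (k - (size hs + size gs))%N (l - (size hs + size gs))%N.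
by rewrite !inE !ltn_subLR ?(leq_trans k2 (ltnW kl)) // -ss ls (ltn_trans kl ls) leq_sub2r ?(ltnW kl) //; apply.
Qed.

Lemma complementary_canonical (o : 'I_(size s) -> 'I_(size s) -> choices) :
  complementary (diag_map (A_can s)) (supported (D_can o)).
Proof.
have E x0 (i : 'I_(size s)) : nth_summand i = nth x0 s i by exact: tnth_nth.
have valid i : valid_summand (@nth_summand K s i) by rewrite (E (SumG K 0)); exact: valid_nth.
apply: complementary_blocks => [i|i j ij].
  by rewrite /D_block !ltnn conform_mx_id; exact: complementary_diag.
rewrite /D_block ij ltnNge (ltnW ij) /=.
have := @complementary_pair (nth_summand i) (nth_summand j) (o j i) (o i j) (valid i) (valid j).
rewrite -surjective_pairing; apply.
rewrite !(E (SumG K 0)); exact: valid_order_nth.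
Qed.

End Canonical.

(** * Summable families *)

#[local] Existing Instance totally_filter.

Section Sums.
Variable K : numClosedFieldType.
Implicit Types I J : choiceType.
Local Open Scope fset_scope.
Local Open Scope ring_scope.

(** Convergence of the net of finite partial sums, without topology; the
    link is [has_sumP]. *)
Definition has_sum I (u : I -> K) (s : K) :=
  forall e : K, 0 < e -> exists A : {fset I}, forall B : {fset I},
    A `<=` B -> `|\sum_(i <- B) u i - s| < e.

Definition abs_bounded I (u : I -> K) (M : K) :=
  forall A : {fset I}, \sum_(i <- A) `|u i| <= M.

Lemma partial_sumE I (u : I -> K) (A : {fset I}) :
  partial_sum u A = \sum_(i <- A) u i.
Proof. by rewrite /partial_sum [RHS]big_seq_fsetE. Qed.

Lemma has_sumP I (u : I -> K) (s : K) :
  has_sum u s <-> (partial_sum u @ totally --> s)%classic.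
Proof.
split.
- move=> hu; apply/cvgrPdist_lt => e e0; have [A hA] := hu e e0.
  exists A => // B /= AB; rewrite partial_sumE distrC; exact: hA.
- move=> /cvgrPdist_lt hu e e0; have [A _ hA] := hu e e0.
  by exists A => B AB; rewrite distrC -partial_sumE; exact: hA.
Qed.

Lemma has_sum_unique I (u : I -> K) s t : has_sum u s -> has_sum u t -> s = t.
Proof.
move=> hs ht; apply/eqP; apply: contraT => st.
have e0 : 0 < `|s - t| / 2 by rewrite divr_gt0 // normr_gt0 subr_eq0.
have [A hA] := hs _ e0; have [B hB] := ht _ e0.
have h1 := hA (A `|` B) (fsubsetUl _ _); have h2 := hB (A `|` B) (fsubsetUr _ _).
have := ltrD h1 h2; rewrite -splitr distrC.
move=> h; have := le_lt_trans (ler_normD _ _) h.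
by rewrite addrA subrK ltxx.
Qed.

Lemma has_sum0 I : has_sum (fun _ : I => 0) 0.
Proof. by move=> e e0; exists fset0 => B _; rewrite big1 // subrr normr0. Qed.

Lemma has_sumZ I (u : I -> K) s c : has_sum u s -> has_sum (fun i => c * u i) (c * s).
Proof.
move=> hu; have [->|c0] := eqVneq c 0.
  by move=> e e0; exists fset0 => B _; rewrite mul0r big1 ?subrr ?normr0 // => i _; rewrite mul0r.
move=> e e0; have n0 : 0 < `|c| by rewrite normr_gt0.
have [A hA] := hu (e / `|c|) (divr_gt0 e0 n0); exists A => B AB.
by rewrite -mulr_sumr -mulrBr normrM mulrC -ltr_pdivlMr //; exact: hA.
Qed.

Lemma eq_has_sum I (u v : I -> K) s : u =1 v -> has_sum u s -> has_sum v s.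
Proof.
move=> uv hu e e0; have [A hA] := hu e e0; exists A => B AB.
by under eq_bigr do rewrite -uv; exact: hA.
Qed.

Lemma fset_preimage I J (f : I -> J) (B : {fset J}) : injective f ->
  exists A : {fset I}, (forall i, (i \in A) = (f i \in B)) /\
    forall F : J -> K, (forall j, F j != 0 -> exists i, j = f i) ->
      \sum_(j <- B) F j = \sum_(i <- A) F (f i).
Proof.
move=> fi; have [g gK gn] : exists2 g : J -> option I, ocancel g f & pcancel f g.
  pose g j := if pselect (exists i, j = f i) is left h then Some (projT1 (cid h)) else None.
  exists g => [j|i]; rewrite /g.
    by case: pselect => //= h; case: cid.
  case: pselect => [h|[]]; last by exists i.
  by congr Some; case: cid => /= i' /fi.
exists (seq_fset tt (pmap g B)); split=> [i|F F0].
  rewrite seq_fsetE mem_pmap; apply/mapP/idP => [[j jB ij]|fB]; last by exists (f i); rewrite ?gn.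
  by have := gK j; rewrite -ij /= => ->.
transitivity (\sum_(i <- pmap g B) F (f i)); last first.
  apply: perm_big; apply: uniq_perm; rewrite ?fset_uniq ?(pmap_uniq gK) // => i.
  by rewrite seq_fsetE.
elim: (B : seq J) => [|j r IH]; first by rewrite !big_nil.
rewrite /= big_cons IH; have := gK j; case gj: (g j) => [i|] /=.
  by move=> <-; rewrite big_cons.
have [-> _|/F0[i ji]] := eqVneq (F j) 0; first by rewrite add0r.
by move: gj; rewrite ji gn.
Qed.

Lemma has_sum_inj I J (f : I -> J) (u : I -> K) (v : J -> K) s :
  injective f -> (forall i, v (f i) = u i) ->
  (forall j, v j != 0 -> exists i, j = f i) -> has_sum u s -> has_sum v s.
Proof.
move=> fi vf v0 hu e e0; have [A hA] := hu e e0.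
exists (f @` A) => B AB; have [A' [mA' /(_ v v0) ->]] := fset_preimage B fi.
under eq_bigr do rewrite vf; apply: hA.
by apply/fsubsetP => i iA; rewrite mA'; apply: (fsubsetP AB); rewrite in_imfset.
Qed.

Lemma partition_fset I J (pi : I -> J) (F : I -> K) (A : {fset I}) (B : {fset J}) :
  pi @` A `<=` B ->
  \sum_(i <- A) F i = \sum_(j <- B) \sum_(i <- A) (if pi i == j then F i else 0).
Proof.
move=> AB; rewrite exchange_big /=; apply: eq_big_seq => i iA.
have piB : pi i \in B by apply: (fsubsetP AB); rewrite in_imfset.
rewrite (big_fsetD1 (pi i)) //= eqxx big_seq big1 ?addr0 // => j.
by rewrite !inE => /andP[/negPf jp _]; rewrite eq_sym jp.
Qed.

(** Within an error [e / 2], split equally between the finitely many fibres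
    under consideration, each partial sum over a large enough finite set is a
    sum of sums over fibres. *)
Lemma has_sum_fibres I J (pi : I -> J) (u : I -> K) (c : J -> K) s :
  has_sum u s ->
  (forall j, has_sum (fun i => if pi i == j then u i else 0) (c j)) ->
  has_sum c s.
Proof.
move=> hu hc e e0; have e20 : 0 < e / 2 by rewrite divr_gt0.
have [A0 hA0] := hu _ e20; exists (pi @` A0) => B AB.
(* the successor avoids a division by zero when B is empty *)
pose N : K := (size B).+1%:R; have N0 : 0 < N by rewrite ltr0n.
have [a ha] : exists a : J -> {fset I}, forall j A, a j `<=` A ->
    `|\sum_(i <- A) (if pi i == j then u i else 0) - c j| < e / 2 / N.
  suff h j : {a : {fset I} | forall A, a `<=` A ->
      `|\sum_(i <- A) (if pi i == j then u i else 0) - c j| < e / 2 / N}.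
    by exists (fun j => projT1 (cid2 (ex_intro2 _ (fun=> True) _ (projT2 (h j)) Logic.I)))
       => j; case: cid2.
  by apply: cid; exact: (hc j _ (divr_gt0 e20 N0)).
pose A := A0 `|` \bigcup_(j <- B) a j.
have aA j : j \in B -> a j `<=` A.
  move=> jB; apply: fsubset_trans (fsubsetUr _ _).
  by apply: bigfcup_sup.
pose A' := [fset i in A | pi i \in B].
have A0A' : A0 `<=` A'.
  apply/fsubsetP => i iA; rewrite !inE iA /=.
  by apply: (fsubsetP AB); rewrite in_imfset.
have eA' : \sum_(i <- A') u i = \sum_(j <- B) \sum_(i <- A) (if pi i == j then u i else 0).
  rewrite (@partition_fset _ _ pi _ _ B); last first.
    by apply/fsubsetP => j /imfsetP[i /=]; rewrite !inE => /andP[_ iB] ->.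
  apply: eq_big_seq => j jB; rewrite /A' -big_fset_condE /= big_mkcond /=.
  by apply: eq_bigr => i _; case: eqVneq => [->|_]; rewrite ?jB ?if_same.
have -> : \sum_(j <- B) c j - s = (\sum_(i <- A') u i - s)
   - \sum_(j <- B) (\sum_(i <- A) (if pi i == j then u i else 0) - c j).
  by rewrite eA' sumrB; ring.
rewrite (splitr e); apply: le_lt_trans (ler_normB _ _) _.
apply: ltr_leD; first exact: hA0.
apply: le_trans (ler_norm_sum _ _ _) _.
apply: (@le_trans _ _ (\sum_(j <- B) (e / 2 / N))).
  by rewrite !big_seq; apply: ler_sum => j jB; apply/ltW/ha/aA.
rewrite big_const_seq count_predT iter_addr_0.
have -> : e / 2 / N *+ size B = e / 2 * ((size B)%:R / N) by rewrite -mulr_natr; ring.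
by rewrite ler_piMr ?(ltW e20) // ler_pdivrMr // mul1r ler_nat.
Qed.

Lemma abs_bounded_ge0 I (u : I -> K) M : abs_bounded u M -> 0 <= M.
Proof. by move=> /(_ fset0); rewrite big_seq_fset0. Qed.

Lemma abs_bounded_le I (u v : I -> K) M :
  (forall i, `|v i| <= `|u i|) -> abs_bounded u M -> abs_bounded v M.
Proof. by move=> uv hu A; apply: le_trans (hu A); apply: ler_sum. Qed.

Lemma abs_boundedZ I (u : I -> K) M c :
  abs_bounded u M -> abs_bounded (fun i => c * u i) (`|c| * M).
Proof.
move=> hu A; under eq_bigr do rewrite normrM.
by rewrite -mulr_sumr ler_wpM2l.
Qed.

Lemma abs_bounded_fibres I J (pi : I -> J) (u : I -> K) (m : J -> K) M :
  (forall j A, \sum_(i <- A : {fset I}) (if pi i == j then `|u i| else 0) <= m j) ->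
  (forall B : {fset J}, \sum_(j <- B) m j <= M) -> abs_bounded u M.
Proof.
move=> hu hm A; rewrite (@partition_fset _ _ pi _ A _ (fsubset_refl _)).
by apply: le_trans (hm _); apply: ler_sum => j _; exact: hu.
Qed.

Lemma has_sum_norm_le I (u : I -> K) s M :
  abs_bounded u M -> has_sum u s -> `|s| <= M.
Proof.
move=> hM hs; apply/ler_addgt0Pr => e e0; have [A hA] := hs _ e0.
have := hA _ (fsubset_refl _) => h.
have -> : s = \sum_(i <- A) u i - (\sum_(i <- A) u i - s) by ring.
apply: le_trans (ler_normB _ _) _; apply: lerD; last exact: ltW.
by apply: le_trans (ler_norm_sum _ _ _) _.
Qed.

Lemma has_sumD I (u v : I -> K) s t :
  has_sum u s -> has_sum v t -> has_sum (fun i => u i + v i) (s + t).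
Proof.
move=> hu hv e e0; have e20 : 0 < e / 2 by rewrite divr_gt0.
have [A hA] := hu _ e20; have [B hB] := hv _ e20.
exists (A `|` B) => C; rewrite fsubUset => /andP[AC BC].
rewrite big_split /= opprD addrACA (splitr e).
by apply: le_lt_trans (ler_normD _ _) (ltrD (hA _ AC) (hB _ BC)).
Qed.

Lemma has_sum_fin (I : finType) (u : I -> K) : has_sum u (\sum_i u i).
Proof.
move=> e e0; exists [fset i in I]%fset => B /fsubsetP IB.
have -> : \sum_(i <- B) u i = \sum_i u i.
  apply: perm_big; apply: uniq_perm; rewrite ?fset_uniq ?index_enum_uniq // => i.
  by rewrite mem_index_enum IB // inE.
by rewrite subrr normr0.
Qed.

Lemma abs_bounded_embed I (X : choiceType) (e : I -> X) (P : pred X) (w : X -> K) m :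
  injective e -> (forall x, P x -> exists i, x = e i) ->
  abs_bounded (fun i => w (e i)) m ->
  forall A : {fset X}, \sum_(x <- A) (if P x then `|w x| else 0) <= m.
Proof.
move=> ei Pe hw A; have [B [_ ->]] := fset_preimage A ei; last first.
  by move=> x; case: ifP => [/Pe //|]; rewrite eqxx.
by apply: le_trans (hw B); apply: ler_sum => i _; case: ifP.
Qed.

Lemma sum_fsetU I (F : I -> K) (A B : {fset I}) : [disjoint A & B] ->
  \sum_(i <- A `|` B) F i = \sum_(i <- A) F i + \sum_(i <- B) F i.
Proof.
move=> AB; rewrite -big_cat; apply: perm_big; apply: uniq_perm; rewrite ?fset_uniq //.
  rewrite cat_uniq !fset_uniq andbT /=; apply/hasPn => i iB.
  by apply/negP => iA; have /fdisjointP/(_ i iA) := AB; rewrite iB.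
by move=> i; rewrite mem_cat inE.
Qed.

(** Away from a finite set all partial sums are at most 2 in absolute value.
    Selecting the terms with real part of a given sign bounds the sum of the
    absolute values of the real parts, and likewise for the imaginary parts. *)
Lemma has_sum_abs_bounded I (u : I -> K) s :
  has_sum u s -> exists M, abs_bounded u M.
Proof.
move=> hu; have [A hA] := hu 1 ltr01.
have hB (B : {fset I}) : [disjoint A & B]%fset -> `|\sum_(i <- B) u i| <= 2.
  move=> AB; have hAB := hA _ (fsubsetUl A B); have hA0 := hA _ (fsubset_refl A).
  have -> : \sum_(i <- B) u i = (\sum_(i <- A `|` B) u i - s) - (\sum_(i <- A) u i - s).
    by rewrite (sum_fsetU _ AB); ring.
  by apply: le_trans (ler_normB _ _) _; rewrite -[2]/(1 + 1); apply: lerD; apply: ltW.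
pose re (T : K -> K) := forall B : {fset I}, [disjoint A & B]%fset -> \sum_(i <- B) `|T (u i)| <= 4.
have reT (T : {additive K -> K}) : (forall z, T z \is Num.real) -> (forall z, `|T z| <= `|z|) -> re T.
  move=> Tr Tn B AB.
  rewrite (bigID (fun i => 0 <= T (u i))) /=.
  have sgn (P : pred I) : `|\sum_(i <- B | P i) T (u i)| <= 2.
    rewrite big_fset_condE /= -raddf_sum; apply: le_trans (Tn _) _; apply: hB.
    apply/fdisjointP => i iA; rewrite !inE /= negb_and.
    by rewrite (fdisjointP AB).
  have -> : 4 = 2 + 2 :> K by rewrite -natrD.
  apply: lerD.
    apply: le_trans (sgn (fun i => 0 <= T (u i))).
    rewrite (eq_bigr (fun i => T (u i))); last by move=> i; exact: ger0_norm.
    by rewrite ger0_norm // sumr_ge0.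
  apply: le_trans (sgn (fun i => ~~ (0 <= T (u i)))).
  rewrite (eq_bigr (fun i => - T (u i))); last first.
    by move=> i; rewrite -real_ltNge // => /ltW; exact: ler0_norm.
  by rewrite sumrN ler0_norm // -oppr_ge0 -sumrN sumr_ge0 // => i; rewrite -real_ltNge // oppr_ge0 => /ltW.
have rRe : re (fun z => 'Re z).
  apply: (reT (@numfield.Num.Theory.Re K)) => z; first exact: Creal_Re.
  by have [] := leif_normC_Re_Creal z.
have rIm : re (fun z => 'Im z).
  apply: (reT (@numfield.Num.Theory.Im K)) => z; first exact: Creal_Im.
  rewrite -(@ler_pXn2r _ 2) ?nnegrE // [leRHS]normC2_Re_Im real_normK ?Creal_Im //.
  by rewrite lerDr; apply: real_exprn_even_ge0; rewrite ?Creal_Re.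
exists (\sum_(i <- A) `|u i| + (4 + 4)) => B.
have -> : \sum_(i <- B) `|u i| = \sum_(i <- B `&` A) `|u i| + \sum_(i <- B `\` A) `|u i|.
  rewrite -sum_fsetU; last first.
    by apply/fdisjointP => i; rewrite !inE => /andP[_ ->].
  by rewrite fsetID.
apply: lerD.
  have -> : \sum_(i <- A) `|u i| = \sum_(i <- B `&` A) `|u i| + \sum_(i <- A `\` B) `|u i|.
    rewrite -sum_fsetU; first by rewrite fsetIC fsetID.
    by apply/fdisjointP => i; rewrite !inE => /andP[->].
  by rewrite lerDl sumr_ge0.
have AB : [disjoint A & B `\` A]%fset.
  by apply/fdisjointP => i iA; rewrite !inE iA.
apply: le_trans (lerD (rRe _ AB) (rIm _ AB)).
rewrite -big_split /=; apply: ler_sum => i _.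
rewrite {1}[u i]Crect; apply: le_trans (ler_normD _ _) _.
by rewrite normrM normCi mul1r.
Qed.

End Sums.

(** The only form of completeness needed to sum power series, stated for
    an arbitrary field so that the theory of power series does not have to
    mention real and imaginary parts. *)
Definition sum_complete (K : numClosedFieldType) :=
  (forall (I : choiceType) (u : I -> K) M,
      abs_bounded u M -> exists s, has_sum u s).
Section Complex.
Variable R : realType.

Lemma normc_i : `|'i%C : R[i]| = 1.
Proof. by rewrite normc_def /= expr0n add0r expr1n sqrtr1. Qed.

Local Open Scope fset_scope.
Local Open Scope ring_scope.
Local Notation K := (R[i] : numClosedFieldType).

(** The sum is the supremum of the finite partial sums. *)
Lemma nneg_real_sum (I : choiceType) (v : I -> R) (M : R) :
  (forall i, 0 <= v i) -> (forall A : {fset I}, \sum_(i <- A) v i <= M) ->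
  exists s : R, forall e : R, 0 < e -> exists A : {fset I}, forall B : {fset I},
    A `<=` B -> `|\sum_(i <- B) v i - s| < e.
Proof.
move=> v0 vM.
pose E := [set x | exists A : {fset I}, x = \sum_(i <- A) v i]%classic.
have supE : has_sup E.
  split; first by exists 0, fset0; rewrite big_seq_fset0.
  by exists M => _ [A ->].
exists (sup E) => e e0; have [_ [A ->] hA] := sup_adherent e0 supE.
exists A => B AB; have Bs : \sum_(i <- B) v i <= sup E.
  by apply: sup_ubound; [case: supE | exists B].
have ABs : \sum_(i <- A) v i <= \sum_(i <- B) v i.
  rewrite (big_fsetID _ (mem A) B) /= -[leLHS]addr0; apply: lerD; last first.
    by apply: sumr_ge0.
  rewrite le_eqVlt; apply/orP; left; apply/eqP; congr bigop.body.
  congr enum_fset; apply/fsetP => i; rewrite !inE.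
  by case iA: (i \in A); rewrite ?andbF ?andbT // (fsubsetP AB).
by rewrite ler0_norm ?subr_le0 // opprB; lra.
Qed.

(** [v] is the difference of the nonnegative families [v + |v|] and [|v|]. *)
Lemma real_sum (I : choiceType) (v : I -> R) (M : R) :
  (forall A : {fset I}, \sum_(i <- A) `|v i| <= M) ->
  exists s : R, forall e : R, 0 < e -> exists A : {fset I}, forall B : {fset I},
    A `<=` B -> `|\sum_(i <- B) v i - s| < e.
Proof.
move=> vM; have [s hs] := nneg_real_sum (fun i => normr_ge0 (v i)) vM.
have [t ht] : exists s : R, forall e : R, 0 < e -> exists A : {fset I}, forall B : {fset I},
    A `<=` B -> `|\sum_(i <- B) (v i + `|v i|) - s| < e.
  apply: (@nneg_real_sum _ _ (M + M)) => [i|A].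
    by have := ler_norm (- v i); rewrite normrN -subr_ge0 opprK addrC.
  rewrite big_split; apply: lerD; last exact: vM.
  by apply: le_trans (vM A); apply: ler_sum => i _; exact: ler_norm.
exists (t - s) => e e0; have e20 : 0 < e / 2 by rewrite divr_gt0.
have [A hA] := hs _ e20; have [B hB] := ht _ e20.
exists (A `|` B) => C; rewrite fsubUset => /andP[AC BC].
have -> : \sum_(i <- C) v i - (t - s) =
  (\sum_(i <- C) (v i + `|v i|) - t) - (\sum_(i <- C) `|v i| - s).
  by rewrite big_split /=; ring.
by rewrite (splitr e); apply: le_lt_trans (ler_normB _ _) (ltrD (hB _ BC) (hA _ AC)).
Qed.

Lemma complex_sum_complete : sum_complete K.
Proof.
move=> I u M uM.
have M0 := abs_bounded_ge0 uM.
have MR : (complex.Re M)%:C%C = M := RRe_real (ger0_real M0).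
have reb (A : {fset I}) : \sum_(i <- A) `|complex.Re (u i)| <= complex.Re M.
  rewrite -lecR MR; apply: le_trans (uM A); rewrite rmorph_sum /=.
  by apply: ler_sum => i _; exact: normc_ge_Re.
have imb (A : {fset I}) : \sum_(i <- A) `|complex.Im (u i)| <= complex.Re M.
  rewrite -lecR MR; apply: le_trans (uM A); rewrite rmorph_sum /=.
  apply: ler_sum => i _; rewrite -normrN -ReiNIm; apply: le_trans (normc_ge_Re _) _.
  by rewrite normrM normc_i mulr1.
have [a ha] := real_sum reb; have [b hb] := real_sum imb.
exists (a +i* b)%C => e e0.
have eR : (complex.Re e)%:C%C = e := RRe_real (gtr0_real e0).
have e20 : 0 < complex.Re e / 2 by rewrite divr_gt0 // -ltcR eR.
have [A hA] := ha _ e20; have [B hB] := hb _ e20.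
exists (A `|` B) => C; rewrite fsubUset => /andP[AC BC].
have -> : \sum_(i <- C) u i - (a +i* b)%C =
   ((\sum_(i <- C) complex.Re (u i) - a)%:C%C
     + 'i%C * (\sum_(i <- C) complex.Im (u i) - b)%:C%C)%R.
  rewrite (eq_bigr _ (fun i _ => complexE (u i))) big_split -mulr_sumr /=.
  by rewrite !rmorphB !rmorph_sum /= [(a +i* b)%C]complexE /=; ring.
apply: le_lt_trans (ler_normD _ _) _; rewrite normrM normc_i mul1r.
have nR (x : R) : `|x%:C%C| = `|x|%:C%C by rewrite normc_def /= expr0n addr0 sqrtr_sqr.
rewrite !nR -rmorphD -eR ltcR (splitr (complex.Re e)).
by apply: ltrD; [exact: hA | exact: hB].
Qed.

End Complex.

(** * Power series bounded on a polydisc *)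

Section PowerSeries.
Variable K : numClosedFieldType.
Hypothesis Kc : sum_complete K.
Variable k : nat.
Local Open Scope fset_scope.
Local Open Scope ring_scope.
Local Notation mi := {ffun 'I_k -> nat}.
Implicit Types (r M N : K) (h w : 'rV[K]_k) (f g : 'rV[K]_k -> K) (a b : mi).

Definition mi_add a b : mi := [ffun i => (a i + b i)%N].

Definition polydisc (r : K) h := forall i, `|h 0 i| <= r.

(** The largest absolute value of a monomial on the polydisc of radius [r]. *)
Definition weight (r : K) a : K := monomial (const_mx r) a.

Lemma monomialD h a b : monomial h (mi_add a b) = monomial h a * monomial h b.
Proof. by rewrite /monomial -big_split; apply: eq_bigr => i _; rewrite ffunE exprD. Qed.

Lemma weight_ge0 r a : 0 <= r -> 0 <= weight r a.
Proof. by move=> r0; apply: prodr_ge0 => i _; rewrite mxE exprn_ge0. Qed.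

Lemma weight_gt0 r a : 0 < r -> 0 < weight r a.
Proof. by move=> r0; apply: prodr_gt0 => i _; rewrite mxE exprn_gt0. Qed.

Lemma norm_monomial r h a : polydisc r h -> `|monomial h a| <= weight r a.
Proof.
move=> hr; rewrite /monomial normr_prod; apply: ler_prod => i _.
by rewrite normr_ge0 normrX mxE lerXn2r ?nnegrE // ?(le_trans _ (hr i)) // hr.
Qed.

Lemma polydisc_le r r' h : r' <= r -> polydisc r' h -> polydisc r h.
Proof. by move=> rr hr i; apply: le_trans (hr i) rr. Qed.

Lemma polydisc0 r : 0 <= r -> polydisc r 0.
Proof. by move=> r0 i; rewrite mxE normr0. Qed.

Lemma polydisc_const r : 0 <= r -> polydisc r (const_mx r).
Proof. by move=> r0 i; rewrite mxE ger0_norm. Qed.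

(** [f] is the sum on a polydisc of an absolutely convergent series of
    monomials, of norm at most [M].  The family of terms is indexed by an
    arbitrary type and may repeat exponents: products, sums and translates then
    need no rearrangement, which is done once and for all in
    [power_series_at_of_bounded]. *)
Definition bounded_series (r : K) f (M : K) :=
  exists (I : choiceType) (u : I -> K) (p : I -> mi),
    abs_bounded (fun i => u i * weight r (p i)) M /\
    forall h, polydisc r h -> has_sum (fun i => u i * monomial h (p i)) (f h).

Lemma abs_bounded_terms (I : choiceType) (u : I -> K) (p : I -> mi) r M h :
  0 <= r -> polydisc r h -> abs_bounded (fun i => u i * weight r (p i)) M ->
  abs_bounded (fun i => u i * monomial h (p i)) M.
Proof.
move=> r0 hr; apply: abs_bounded_le => i.
rewrite !normrM ler_wpM2l // [leRHS]ger0_norm ?weight_ge0 //.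
exact: norm_monomial.
Qed.

Lemma bounded_series_norm r f M h : 0 <= r ->
  bounded_series r f M -> polydisc r h -> `|f h| <= M.
Proof.
move=> r0 [I [u [p [uM hf]]]] hr.
exact: has_sum_norm_le (abs_bounded_terms r0 hr uM) (hf h hr).
Qed.

Lemma bounded_series_ge0 r f M : bounded_series r f M -> 0 <= M.
Proof. by move=> [I [u [p [uM _]]]]; exact: abs_bounded_ge0 uM. Qed.

Lemma bounded_series_weaken r r' f g M N :
  0 <= r' -> r' <= r -> M <= N -> (forall h, polydisc r' h -> f h = g h) ->
  bounded_series r f M -> bounded_series r' g N.
Proof.
move=> r0 rr MN fg [I [u [p [uM hf]]]]; exists I, u, p; split=> [A|h hr].
  apply: le_trans MN; move: A; apply: abs_bounded_le uM => i.
  rewrite !normrM ler_wpM2l // !ger0_norm ?weight_ge0 ?(le_trans r0) //.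
  by apply: ler_prod => j _; rewrite !mxE exprn_ge0 // lerXn2r ?nnegrE // (le_trans r0).
by rewrite -fg //; apply: hf; apply: polydisc_le hr.
Qed.

(** The terms of all the series together form one family, indexed by the
    disjoint union of their index types. *)
Lemma bounded_series_sum (J : choiceType) r (f : J -> 'rV[K]_k -> K) (m : J -> K) g M :
  0 <= r ->
  (forall j, bounded_series r (f j) (m j)) ->
  (forall B : {fset J}, \sum_(j <- B) m j <= M) ->
  (forall h, polydisc r h -> has_sum (fun j => f j h) (g h)) ->
  bounded_series r g M.
Proof.
move=> r0 hf mM hg.
have [I hI] := choice hf.
pose u j := projT1 (cid (hI j)); pose p j := projT1 (cid (projT2 (cid (hI j)))).
have hp j : abs_bounded (fun i => u j i * weight r (p j i)) (m j) /\
    forall h, polydisc r h -> has_sum (fun i => u j i * monomial h (p j i)) (f j h).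
  exact: projT2 (cid (projT2 (cid (hI j)))).
pose X := {j : J & I j}.
pose w (x : X) := u (tag x) (tagged x); pose q (x : X) := p (tag x) (tagged x).
have inj j : injective (fun i : I j => Tagged I i : X).
  by move=> i i' /eqP; rewrite eq_Tagged => /eqP.
have fib j (x : X) : tag x == j -> exists i : I j, x = Tagged I i.
  by case: x => j' i /= /eqP jj; move: i; rewrite jj => i; exists i.
have wM : abs_bounded (fun x => w x * weight r (q x)) M.
  apply: (@abs_bounded_fibres _ _ _ (fun x : X => tag x) _ m) => // j A.
  have [uM _] := hp j.
  exact: (abs_bounded_embed (w := fun x : X => w x * weight r (q x)) (inj j) (fib j) uM).
exists X, w, q; split=> // h hr.
have [S hS] := Kc (abs_bounded_terms r0 hr wM).
suff -> : g h = S by [].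
apply: has_sum_unique (hg h hr) _.
apply: (has_sum_fibres (pi := fun x : X => tag x) hS) => j.
apply: (@has_sum_inj _ _ _ _ _ _ _ (inj j)) (proj2 (hp j) h hr).
  by move=> i; rewrite /= eqxx.
by move=> x; case: ifP => [/fib //|]; rewrite eqxx.
Qed.

Lemma bounded_series_fin (J : finType) r (f : J -> 'rV[K]_k -> K) (m : J -> K) :
  0 <= r -> (forall j, bounded_series r (f j) (m j)) ->
  bounded_series r (fun h => \sum_j f j h) (\sum_j m j).
Proof.
move=> r0 hf; have m0 j : 0 <= m j by exact: bounded_series_ge0 (hf j).
apply: bounded_series_sum hf _ _ => // [B|h _]; last exact: has_sum_fin.
apply: (@le_trans _ _ (\sum_(j in mem B) m j)).
  by rewrite -big_enum /= le_eqVlt; apply/orP; left; apply/eqP; apply: perm_big; apply: uniq_perm; rewrite ?fset_uniq ?enum_uniq // => j; rewrite mem_enum.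
by rewrite [leRHS](bigID (mem B)) /= lerDl sumr_ge0.
Qed.

Lemma bounded_seriesD r f g M N : 0 <= r ->
  bounded_series r f M -> bounded_series r g N ->
  bounded_series r (fun h => f h + g h) (M + N).
Proof.
move=> r0 hf hg.
have := @bounded_series_fin bool r (fun c : bool => if c then f else g) (fun c : bool => if c then M else N) r0.
by rewrite big_bool /= => H; apply: (bounded_series_weaken r0 (lexx r) (lexx _)) (H _) => [h _|[]//]; rewrite big_bool.
Qed.

Lemma bounded_series_monomialM r f M c a : 0 <= r ->
  bounded_series r f M ->
  bounded_series r (fun h => c * monomial h a * f h) (`|c| * weight r a * M).
Proof.
move=> r0 [I [u [p [uM hf]]]]; exists I, (fun i => c * u i), (fun i => mi_add a (p i)).
split=> [|h hr].
  have := abs_boundedZ (c * weight r a) uM.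
  rewrite normrM (ger0_norm (weight_ge0 a r0)); apply: abs_bounded_le => i.
  by rewrite /weight monomialD -/(weight r a) mulrACA.
apply: eq_has_sum (has_sumZ (c * monomial h a) (hf h hr)) => i.
by rewrite monomialD mulrACA.
Qed.

Lemma bounded_seriesM r f g M N : 0 <= r ->
  bounded_series r f M -> bounded_series r g N ->
  bounded_series r (fun h => f h * g h) (M * N).
Proof.
move=> r0 [I [u [p [uM hf]]]] hg.
apply: (@bounded_series_sum I r (fun i h => u i * monomial h (p i) * g h)
          (fun i => `|u i| * weight r (p i) * N)) => // [i|B|h hr].
- exact: bounded_series_monomialM.
- rewrite -mulr_suml ler_wpM2r ?(bounded_series_ge0 hg) //.
  apply: le_trans (uM B); apply: ler_sum => i _.
  by rewrite normrM (ger0_norm (weight_ge0 _ r0)).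
- rewrite mulrC; apply: eq_has_sum (has_sumZ (g h) (hf h hr)) => i.
  by rewrite mulrC.
Qed.

Lemma bounded_series_cst r c : bounded_series r (fun=> c) `|c|.
Proof.
exists unit, (fun=> c), (fun=> [ffun=> 0%N]).
have m0 h : monomial h [ffun=> 0%N] = 1.
  by rewrite /monomial big1 // => i _; rewrite ffunE.
split=> [A|h _].
  rewrite /weight m0 mulr1; apply: le_trans (_ : \sum_(i : unit) `|c| <= _); last first.
    by rewrite big_const card_unit /= addr0.
  rewrite [leRHS](bigID (mem A)) /= -[leLHS]addr0 lerD ?sumr_ge0 //.
  rewrite le_eqVlt; apply/orP; left; apply/eqP; rewrite -big_enum /=; apply: perm_big; apply: uniq_perm; rewrite ?fset_uniq ?enum_uniq // => j; rewrite mem_enum //.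
have := has_sum_fin (fun _ : unit => c * monomial h [ffun=> 0%N]).
by rewrite big_const card_unit /= addr0 m0 mulr1.
Qed.

Definition mi_delta (i : 'I_k) : mi := [ffun j => (j == i) : nat].

Lemma monomial_delta h i : monomial h (mi_delta i) = h 0 i.
Proof.
rewrite /monomial (bigD1 i) //= ffunE eqxx expr1 big1 ?mulr1 // => j /negPf ji.
by rewrite ffunE ji.
Qed.

Lemma bounded_series_coord r (i : 'I_k) : 0 <= r -> bounded_series r (fun h => h 0 i) r.
Proof.
move=> r0; have := bounded_series_monomialM 1 (mi_delta i) r0 (bounded_series_cst r 1).
rewrite normr1 mulr1 mul1r /weight monomial_delta mxE.
by apply: bounded_series_weaken => // h _; rewrite monomial_delta mul1r mulr1.
Qed.

Lemma bounded_series_prod (J : Type) (l : seq J) r (f : J -> 'rV[K]_k -> K) (m : J -> K) :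
  0 <= r -> (forall j, bounded_series r (f j) (m j)) ->
  bounded_series r (fun h => \prod_(j <- l) f j h) (\prod_(j <- l) m j).
Proof.
move=> r0 hf; elim: l => [|j l IH].
  rewrite big_nil -[X in bounded_series _ _ X]normr1.
  apply: bounded_series_weaken (bounded_series_cst r 1) => // h _; by rewrite big_nil.
rewrite big_cons; apply: bounded_series_weaken (bounded_seriesM r0 (hf j) IH) => // h _.
by rewrite big_cons.
Qed.

Lemma bounded_seriesX r f M n : 0 <= r -> bounded_series r f M ->
  bounded_series r (fun h => f h ^+ n) (M ^+ n).
Proof.
move=> r0 hf; elim: n => [|n IH].
  rewrite expr0 -[X in bounded_series _ _ X]normr1; exact: bounded_series_cst.
rewrite exprS; apply: bounded_series_weaken (bounded_seriesM r0 hf IH) => // h _.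
by rewrite exprS.
Qed.

(** Each term, translated by [w], is a polynomial in [h] that satisfies the
    same bound on the polydisc which is smaller by the size of [w]. *)
Lemma bounded_series_shift s t f M w :
  0 <= s -> 0 <= t -> bounded_series (s + t) f M -> polydisc s w ->
  bounded_series t (fun h => f (w + h)) M.
Proof.
move=> s0 t0 [I [u [p [uM hf]]]] ws; have st0 : 0 <= s + t by rewrite addr_ge0.
apply: (@bounded_series_sum I t (fun i h => u i * monomial (w + h) (p i))
          (fun i => `|u i * weight (s + t) (p i)|)) => // [i|h ht]; last first.
  apply: hf => j; rewrite mxE; apply: le_trans (ler_normD _ _) _.
  by rewrite lerD.
rewrite normrM (ger0_norm (weight_ge0 _ st0)).
apply: bounded_seriesM => //; first exact: bounded_series_cst.
apply: bounded_series_prod => // j.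
apply: bounded_series_weaken (bounded_seriesX (p i j) t0
  (bounded_seriesD t0 (bounded_series_cst t (w 0 j)) (bounded_series_coord j t0))) => //.
  by rewrite mxE lerXn2r ?nnegrE ?addr_ge0 // lerD.
by move=> h _; rewrite mxE.
Qed.

Lemma near_polydisc r : 0 < r -> \forall h \near (0 : 'rV[K]_k), polydisc r h.
Proof.
move=> r0; apply/nbhs_ballP; exists r => //= h hr i.
by have [_ /(_ 0 i)] := hr; rewrite /ball /= mxE sub0r normrN => /ltW.
Qed.

Lemma near_polydiscP (P : 'rV[K]_k -> Prop) :
  (\forall h \near (0 : 'rV[K]_k), P h) -> exists2 r, 0 < r & forall h, polydisc r h -> P h.
Proof.
move=> /nbhs_ballP[r /= r0 hr]; exists (r / 2); first by rewrite divr_gt0.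
move=> h hh; apply: hr; split=> // i j; rewrite ord1 /ball /= mxE sub0r normrN.
by apply: le_lt_trans (hh j) _; rewrite ltr_pdivrMr // ltr_pMr // ltr1n.
Qed.

(** Collecting the terms with the same exponent. *)
Lemma power_series_at_of_bounded r f M w : 0 < r ->
  bounded_series r (fun h => f (w + h)) M -> power_series_at f w.
Proof.
move=> r0 [I [u [p [uM hf]]]]; have r0' := ltW r0.
have fib a : exists s, has_sum (fun i => if p i == a then u i else 0) s.
  apply: (Kc (M := `|(weight r a)^-1| * M)); have wa := weight_gt0 a r0.
  apply: abs_bounded_le (abs_boundedZ (weight r a)^-1 uM) => i.
  case: eqP => [->|_]; last by rewrite normr0.
  by rewrite mulrCA mulVf ?mulr1 // gt_eqF.
have [c hc] := choice fib; exists c.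
near=> h; apply/has_sumP.
have hr : polydisc r h by near: h; exact: near_polydisc.
apply: (has_sum_fibres (pi := p) (hf h hr)) => a.
rewrite mulrC; apply: eq_has_sum (has_sumZ (monomial h a) (hc a)) => i.
by case: eqP => [->|_]; rewrite ?mulr0 // mulrC.
Unshelve. all: by end_near. Qed.

(** Convergence at the one point with all coordinates equal to [r] bounds
    the sum of the absolute values of the terms there, hence on the polydisc. *)
Lemma power_series_bounded f : power_series_at f 0 ->
  exists (c : mi -> K) (r M : K), [/\ 0 < r, abs_bounded (fun a => c a * weight r a) M &
    forall h, polydisc r h -> has_sum (fun a => c a * monomial h a) (f h)].
Proof.
move=> [c /near_polydiscP[r r0 hr]]; exists c, r.
have hc h : polydisc r h -> has_sum (fun a => c a * monomial h a) (f h).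
  by move=> /hr/has_sumP; rewrite add0r.
have [M hM] := has_sum_abs_bounded (hc _ (polydisc_const (ltW r0))).
by exists M.
Qed.

Lemma monomial0 a : monomial (0 : 'rV[K]_k) a = (a == [ffun=> 0%N])%:R.
Proof.
rewrite /monomial; case: eqP => [->|/eqP a0].
  by rewrite big1 // => i _; rewrite ffunE.
have [i ai] : exists i, a i != 0%N.
  apply: contrapT => h; move/eqP: a0; apply; apply/ffunP => i; rewrite ffunE.
  by apply/eqP; apply: contraT => ai; case: h; exists i.
by rewrite (bigD1 i) //= mxE expr0n (negPf ai) mul0r.
Qed.

Lemma coef0_value (c : mi -> K) s :
  has_sum (fun a => c a * monomial (0 : 'rV[K]_k) a) s -> c [ffun=> 0%N] = s.
Proof.
move=> hs; apply: has_sum_unique hs.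
have inj : injective (fun _ : unit => [ffun=> 0%N] : mi) by move=> [] [].
apply: (has_sum_inj (f := fun _ : unit => [ffun=> 0%N] : mi) inj (u := fun=> c [ffun=> 0%N])).
- by move=> _; rewrite monomial0 eqxx mulr1.
- move=> a; rewrite monomial0; have [-> _|_] := eqVneq a [ffun=> 0%N]; first by exists tt.
  by rewrite mulr0 eqxx.
- have := has_sum_fin (fun _ : unit => c [ffun=> 0%N]).
  by rewrite big_const card_unit /= addr0.
Qed.

Lemma weightZ t r a : weight (t * r) a = t ^+ (\sum_i a i) * weight r a.
Proof.
rewrite /weight /monomial expr_sum -big_split; apply: eq_bigr => i _.
by rewrite !mxE exprMn.
Qed.

(** All terms have positive degree, so shrinking the radius by a factor [d]
    multiplies their norms by at most [d]. *)
Lemma power_series_small f e : power_series_at f 0 -> f 0 = 0 -> 0 < e ->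
  exists2 r, 0 < r & forall t, 0 < t -> t <= r -> bounded_series t f e.
Proof.
move=> /power_series_bounded[c [r [M [r0 cM hf]]]] f0 e0.
have M0 := abs_bounded_ge0 cM; have M1 : 0 < M + e by rewrite ltr_wpDl.
have c0 : c [ffun=> 0%N] = 0.
  by rewrite (coef0_value (hf 0 (polydisc0 (ltW r0)))) f0.
have [d [d0 d1 dM]] : exists d : K, [/\ 0 < d, d <= 1 & d * M <= e].
  exists (e / (M + e)); split; first by rewrite divr_gt0.
    by rewrite ler_pdivrMr // mul1r lerDr.
  by rewrite mulrAC ler_pdivrMr // ler_pM2l // lerDl ltW.
exists (d * r) => [|t t0 tr]; first by rewrite mulr_gt0.
have dr0 : 0 < d * r by rewrite mulr_gt0.
apply: (bounded_series_weaken (r := d * r) (f := f) (M := d * M)) => //; first exact: ltW.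
exists mi, c, id; split=> [|h hd]; last first.
  by apply: hf; apply: polydisc_le hd; rewrite ger_pMl.
have := abs_boundedZ d cM; rewrite (ger0_norm (ltW d0)); apply: abs_bounded_le => a.
have [->|a0] := eqVneq a [ffun=> 0%N]; first by rewrite c0 !mul0r mulr0.
have [i ai] : exists i, a i != 0%N.
  apply: contrapT => h; move/eqP: a0; apply; apply/ffunP => i; rewrite ffunE.
  by apply/eqP; apply: contraT => ai; case: h; exists i.
have [n an] : exists n, (\sum_i a i)%N = n.+1.
  exists (\sum_i a i).-1; rewrite prednK // (bigD1 i) //=.
  by apply: leq_trans (leq_addr _ _); rewrite lt0n.
rewrite weightZ an mulrCA !normrM ler_wpM2r ?mulr_ge0 //.
by rewrite exprS normrM ler_piMr // normrX (ger0_norm (ltW d0)) exprn_ile1 // ltW.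
Qed.

Lemma mi_degree1 a : (\sum_i a i)%N = 1%N -> exists i, a = mi_delta i.
Proof.
move=> a1; have [i ai] : exists i, a i != 0%N.
  apply: contrapT => h; move: a1; rewrite big1 // => i _.
  by apply/eqP; apply: contraT => ai; case: h; exists i.
move: a1; rewrite (bigD1 i) //=; case ai1: (a i) ai => [//|n] _.
rewrite addSn => -[] /eqP; rewrite addn_eq0 => /andP[/eqP n0 /eqP s0].
exists i; apply/ffunP => j; rewrite ffunE; case: eqVneq => [->|ji]; first by rewrite ai1 n0.
by apply/eqP; rewrite -leqn0 -s0 (bigD1 j) //= leq_addr.
Qed.

Lemma mi_degree0 a : (\sum_i a i)%N = 0%N -> a = [ffun=> 0%N].
Proof.
move=> a0; apply/ffunP => i; rewrite ffunE; apply/eqP.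
by rewrite -leqn0 -a0 (bigD1 i) //= leq_addr.
Qed.

(** The terms of degree at least 2 decrease by a factor [(t / r) ^+ 2] at
    least between the radii [r] and [t]. *)
Lemma power_series_first_order f : power_series_at f 0 ->
  exists (d : 'I_k -> K) (C r : K), [/\ 0 < r, 0 <= C &
    forall t h, 0 <= t -> t <= r -> polydisc t h ->
      `|f h - f 0 - \sum_i d i * h 0 i| <= C * t ^+ 2].
Proof.
move=> /power_series_bounded[c [r [M [r0 cM hf]]]].
have M0 := abs_bounded_ge0 cM.
have c0 := coef0_value (hf 0 (polydisc0 (ltW r0))).
pose deg a := (\sum_i a i)%N.
exists (fun i => c (mi_delta i)), (M / r ^+ 2), r; split=> //.
  by rewrite divr_ge0 // exprn_ge0 // ltW.
move=> t h t0 tr ht; have hr := polydisc_le tr ht.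
pose low n a := if deg a == n then c a * monomial h a else 0.
have s0 : has_sum (low 0%N) (f 0).
  have inj : injective (fun _ : unit => [ffun=> 0%N] : mi) by move=> [] [].
  apply: (has_sum_inj (f := fun _ : unit => [ffun=> 0%N] : mi) inj (u := fun=> f 0)).
  - move=> _; rewrite /low /deg big1 => [|i _]; last by rewrite ffunE.
    by rewrite eqxx c0 /monomial big1 ?mulr1 // => i _; rewrite ffunE.
  - move=> a; rewrite /low; have [d0 _|_] := eqVneq (deg a) 0%N; last by rewrite eqxx.
    by exists tt; exact: mi_degree0 d0.
  - have := has_sum_fin (fun _ : unit => f 0).
    by rewrite big_const card_unit /= addr0.
have s1 : has_sum (low 1%N) (\sum_i c (mi_delta i) * h 0 i).
  have inj : injective mi_delta.
    move=> i j /ffunP/(_ i); rewrite !ffunE eqxx; by case: eqP.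
  apply: (has_sum_inj inj) (has_sum_fin _).
  - move=> i; rewrite /low /deg (bigD1 i) //= ffunE eqxx big1 ?addn0 => [|j /negPf ji].
      by rewrite eqxx monomial_delta.
    by rewrite ffunE ji.
  - by move=> a; rewrite /low; have [d1 _|_] := eqVneq (deg a) 1%N; [exact: mi_degree1 d1|rewrite eqxx].
have := has_sumD (hf h hr) (has_sumZ (-1) (has_sumD s0 s1)).
rewrite mulN1r opprD addrA; apply: has_sum_norm_le.
have ri0 : 0 <= r^-1 by rewrite invr_ge0 ltW.
have q0 : 0 <= t / r by rewrite mulr_ge0.
have := abs_boundedZ ((t / r) ^+ 2) cM; rewrite ger0_norm ?exprn_ge0 //.
have -> : (t / r) ^+ 2 * M = M / r ^+ 2 * t ^+ 2.
  by rewrite expr_div_n [LHS]mulrC mulrA mulrAC.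
apply: abs_bounded_le => a; rewrite mulN1r /low.
have [/eqP d0|d0] := eqVneq (deg a) 0%N.
  by rewrite (eqP d0) /= addr0 subrr normr0.
have [d1|d1] := eqVneq (deg a) 1%N; first by rewrite add0r subrr normr0.
rewrite addr0 oppr0 addr0 mulrCA [leLHS]normrM [leRHS]normrM ler_wpM2l //.
rewrite [leRHS]ger0_norm ?mulr_ge0 ?exprn_ge0 ?weight_ge0 ?(ltW r0) //.
apply: le_trans (norm_monomial a ht) _.
have [n an] : exists n, deg a = n.+2.
  by case: (deg a) d0 d1 => [//|[//|n]] _ _; exists n.
have -> : weight t a = (t / r) ^+ n.+2 * weight r a.
  by rewrite -an /deg -weightZ divfK // gt_eqF.
rewrite ler_wpM2r ?weight_ge0 ?(ltW r0) // -[n.+2]addn2 exprD.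
by rewrite ler_piMl ?exprn_ge0 // exprn_ile1 // ler_pdivrMr ?mul1r.
Qed.

End PowerSeries.

Arguments bounded_series_cst {K k} r c.
Arguments polydisc0 {K k} [r].
Arguments polydisc_const {K k} [r].
Arguments near_polydisc {K k} [r].

(** * Power series with matrix values *)

Section MatrixSeries.
Variable K : numClosedFieldType.
Hypothesis Kc : sum_complete K.
Variable l : nat.
Implicit Types r M N : K.

Definition bounded_mx p q r (F : 'rV[K]_l -> 'M[K]_(p, q)) M :=
  forall i j, bounded_series r (fun h => F h i j) M.

Lemma bounded_mx_weaken p q r (F G : 'rV[K]_l -> 'M[K]_(p, q)) M N :
  0 <= r -> M <= N -> (forall h, polydisc r h -> F h = G h) ->
  bounded_mx r F M -> bounded_mx r G N.
Proof.
move=> r0 MN FG hF i j; apply: bounded_series_weaken (hF i j) => // h hr.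
by rewrite FG.
Qed.

Lemma bounded_mxD p q r (F G : 'rV[K]_l -> 'M[K]_(p, q)) M N : 0 <= r ->
  bounded_mx r F M -> bounded_mx r G N -> bounded_mx r (fun h => F h + G h) (M + N).
Proof.
move=> r0 hF hG i j.
by apply: bounded_series_weaken (bounded_seriesD Kc r0 (hF i j) (hG i j)) => // h _; rewrite mxE.
Qed.

Lemma bounded_mxM p q s r (F : 'rV[K]_l -> 'M[K]_(p, q)) (G : 'rV[K]_l -> 'M[K]_(q, s)) M N :
  0 <= r -> bounded_mx r F M -> bounded_mx r G N ->
  bounded_mx r (fun h => F h *m G h) (q%:R * (M * N)).
Proof.
move=> r0 hF hG i j.
have H x := bounded_seriesM Kc r0 (hF i x) (hG x j).
apply: bounded_series_weaken (bounded_series_fin Kc r0 H) => //.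
  by rewrite sumr_const card_ord mulr_natl.
by move=> h _; rewrite mxE.
Qed.

Lemma bounded_mx_tr p q r (F : 'rV[K]_l -> 'M[K]_(p, q)) M : 0 <= r ->
  bounded_mx r F M -> bounded_mx r (fun h => (F h)^T) M.
Proof.
by move=> r0 hF i j; apply: bounded_series_weaken (hF j i) => // h _; rewrite mxE.
Qed.

Lemma bounded_mx_cst p q (B : 'M[K]_(p, q)) :
  exists M, 0 <= M /\ forall r, 0 <= r -> bounded_mx r (fun=> B) M.
Proof.
exists (\sum_i \sum_j `|B i j|); split=> [|r r0 i j]; first by do 2![apply: sumr_ge0 => ? _].
apply: bounded_series_weaken (bounded_series_cst r (B i j)) => //.
rewrite (bigD1 i) //= (bigD1 j) //= -addrA lerDl addr_ge0 ?sumr_ge0 // => ? _.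
exact: sumr_ge0.
Qed.

(** A linear map between spaces of matrices is given by finitely many
    coefficients. *)
Lemma bounded_mx_linear p q s t (X : {linear 'M[K]_(p, q) -> 'M[K]_(s, t)}) :
  exists2 C, 0 <= C & forall r (F : 'rV[K]_l -> 'M[K]_(p, q)) M, 0 <= r ->
    bounded_mx r F M -> bounded_mx r (fun h => X (F h)) (C * M).
Proof.
pose x ij := X (delta_mx ij.1 ij.2).
have XE U a b : X U a b = \sum_(ij : 'I_p * 'I_q) U ij.1 ij.2 * x ij a b.
  rewrite {1}[U]matrix_sum_delta pair_big linear_sum summxE /=.
  by apply: eq_bigr => ij _; rewrite linearZ mxE.
have Cx ij := bounded_mx_cst (x ij).
have [C hC'] := choice Cx.
have C0 ij : 0 <= C ij by have [] := hC' ij.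
have hC ij r : 0 <= r -> bounded_mx r (fun=> x ij) (C ij) by have [_] := hC' ij; exact.
exists (\sum_ij C ij) => [|r F M r0 hF a b]; first exact: sumr_ge0.
have H ij := bounded_seriesM Kc r0 (hF ij.1 ij.2) (hC ij r r0 a b).
apply: bounded_series_weaken (bounded_series_fin Kc r0 H) => //.
  by rewrite -mulr_sumr mulrC.
Qed.

End MatrixSeries.

Section Geometric.
Variable K : numClosedFieldType.
Hypothesis Kc : sum_complete K.
Variable e : K.
Hypothesis e0 : 0 <= e.

Let g (j : nat) := e / 2 ^+ j.

Lemma geom_ge0 j : 0 <= g j. Proof. by rewrite divr_ge0 ?exprn_ge0. Qed.

Lemma geomS j : g j = 2 * g j.+1.
Proof. by rewrite /g exprS invfM mulrCA (mulrA 2) divff ?mul1r // pnatr_eq0. Qed.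

Lemma geom_sum k m : \sum_(k <= j < k + m) g j + 2 * g (k + m)%N = 2 * g k.
Proof.
elim: m => [|m IH]; first by rewrite addn0 big_geq // add0r.
rewrite addnS big_nat_recr ?leq_addr //= -IH -addrA; congr (_ + _).
by rewrite -geomS mulr_natl mulr2n.
Qed.

Lemma geom_fset k (B : {fset nat}) :
  \sum_(j <- B) (if (k <= j)%N then g j else 0) <= 2 * g k.
Proof.
pose m := (\max_(j <- B) j).+1.
have jm j : j \in B -> (j < m)%N by move=> jB; rewrite ltnS; apply: leq_bigmax_seq.
apply: (@le_trans _ _ (\sum_(k <= j < k + m) g j)); last first.
  by rewrite -(geom_sum k m) lerDl mulr_ge0 // geom_ge0.
rewrite -big_mkcond -big_filter [leLHS](perm_big [seq j <- index_iota k (k + m) | j \in B]) /=.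
  rewrite big_filter [leRHS](bigID (mem B)) /= lerDl sumr_ge0 // => *; exact: geom_ge0.
apply: uniq_perm; rewrite ?filter_uniq ?fset_uniq ?iota_uniq // => j.
rewrite !mem_filter mem_index_iota; case jB: (j \in B); rewrite ?andbF //=.
by rewrite !andbT; have := jm j jB; lia.
Qed.

(** An arbitrary [K] need not be archimedean; that powers of 1/2 tend to 0
    follows from the convergence of the geometric series. *)
Lemma geom_small c : 0 < c -> exists k, g k < c.
Proof.
move=> c0; have [s hs] : exists s, has_sum g s.
  apply: (Kc (M := 2 * g 0)) => B; apply: le_trans (geom_fset 0 B).
  by apply: ler_sum => j _; rewrite ger0_norm ?geom_ge0.
have c20 : 0 < c / 2 by rewrite divr_gt0.
have [A hA] := hs _ c20; pose k := (\max_(j <- A) j).+1; exists k.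
have kA : k \notin A.
  apply/negP => kA; have : (k <= \max_(j <- A) j)%N by apply: leq_bigmax_seq.
  by rewrite ltnn.
have h1 := hA _ (fsubset_refl A); have h2 := hA (k |` A)%fset (fsubsetU1 _ _).
have : `|g k| < c; last by rewrite ger0_norm ?geom_ge0.
have -> : g k = (\sum_(j <- (k |` A)%fset) g j - s) - (\sum_(j <- A) g j - s).
  by rewrite big_fsetU1 //=; ring.
by rewrite (splitr c); apply: le_lt_trans (ler_normB _ _) (ltrD h2 h1).
Qed.

End Geometric.

(** * Solving for the transforming matrix *)

Section Versal.
Variable K : numClosedFieldType.
Hypothesis Kc : sum_complete K.
Variables (l n : nat) (A : 'M[K]_n) (X : {linear 'M[K]_n -> 'M[K]_n}).
Implicit Types r M N : K.

(** The terms of [(1 + X Y)^T (A + E) (1 + X Y)] other than those of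
    [A + (X Y)^T A + A (X Y)]; see [newton_congr]. *)
Definition newton (E Y : 'M[K]_n) :=
  E + (X Y)^T *m E + E *m X Y + (X Y)^T *m (A + E) *m X Y.

Lemma tr_add p q (P Q : 'M[K]_(p, q)) : (P + Q)^T = P^T + Q^T.
Proof. by apply/matrixP => i j; rewrite !mxE. Qed.

Lemma newton_congr E Y : newton E Y = Y ->
  (1%:M + X Y)^T *m (A + E) *m (1%:M + X Y) = A + (Y + (X Y)^T *m A + A *m X Y).
Proof.
move=> NY.
have -> : Y + (X Y)^T *m A + A *m X Y = newton E Y + (X Y)^T *m A + A *m X Y by rewrite NY.
rewrite /newton tr_add trmx1.
rewrite !(mulmxDl, mulmxDr, mul1mx, mulmx1).
by apply/matrixP => i j; rewrite ![in LHS]mxE ![in RHS]mxE; ring.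
Qed.

Lemma newton0 E : newton E 0 = E.
Proof. by rewrite /newton raddf0 trmx0 !mul0mx mulmx0 !addr0. Qed.

Lemma newtonB E Y Z : newton E Y - newton E Z =
  (X (Y - Z))^T *m E + E *m X (Y - Z) +
  (X (Y - Z))^T *m (A + E) *m X Y + (X Z)^T *m (A + E) *m X (Y - Z).
Proof.
have [D ->] : exists D, Y = D + Z by exists (Y - Z); rewrite subrK.
rewrite addrK /newton [X (D + Z)]linearD tr_add.
rewrite !(mulmxDl, mulmxDr).
by apply/matrixP => i j; rewrite ![in LHS]mxE ![in RHS]mxE; ring.
Qed.

(** By [newtonB] the difference of two values is linear in [Y - Z], with
    coefficients that are small together with [E], [Y] and [Z]. *)
Lemma newton_contracts :
  exists2 e0 : K, 0 < e0 & forall e r (E Y Z : 'rV[K]_l -> 'M[K]_n) d,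
    0 < e -> e <= e0 -> 0 <= r -> 0 <= d ->
    bounded_mx r E e -> bounded_mx r Y (2 * e) -> bounded_mx r Z (2 * e) ->
    bounded_mx r (fun h => Y h - Z h) (2 * d) ->
    bounded_mx r (fun h => newton (E h) (Y h) - newton (E h) (Z h)) d.
Proof.
have [C C0 hX] := bounded_mx_linear Kc l X.
have [a [a0 hA]] := bounded_mx_cst l A.
pose m : K := n%:R; have m0 : 0 <= m by rewrite ler0n.
(* b is kept abstract: it bounds the coefficients of [newtonB], divided by e *)
have [b bE] : exists b : K, b = m * C + m * C
    + (m * (m * C * (a + 1)) * (C * 2) + m * (m * (C * 2) * (a + 1)) * C) by eexists.
have b0 : 0 <= b by rewrite bE !addr_ge0 ?mulr_ge0 ?addr_ge0.
have b1 : 0 < 2 * b + 1 by rewrite ltr_wpDl ?mulr_ge0.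
exists ((2 * b + 1)^-1) => [|e r E Y Z d e0 ee r0 d0 hE hY hZ hD].
  by rewrite invr_gt0.
have e1 : e <= 1.
  by apply: le_trans ee _; rewrite invf_le1 // lerDr mulr_ge0.
have eb : 2 * b * e <= 1.
  apply: (@le_trans _ _ ((2 * b + 1) * e)); first by rewrite (mulrDl (2 * b)) lerDl mul1r ltW.
  by rewrite -[leRHS](divff (lt0r_neq0 b1)) ler_wpM2l // ltW.
have XD := hX _ _ _ r0 hD; have XY := hX _ _ _ r0 hY; have XZ := hX _ _ _ r0 hZ.
have XDt := bounded_mx_tr r0 XD; have XZt := bounded_mx_tr r0 XZ.
have AE : bounded_mx r (fun h => A + E h) (a + 1).
  by apply: bounded_mx_weaken (bounded_mxD Kc r0 (hA _ r0) hE) => //; rewrite lerD2l.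
have H := bounded_mxD Kc r0 (bounded_mxD Kc r0 (bounded_mxD Kc r0
   (bounded_mxM Kc r0 XDt hE) (bounded_mxM Kc r0 hE XD))
   (bounded_mxM Kc r0 (bounded_mxM Kc r0 XDt AE) XY))
   (bounded_mxM Kc r0 (bounded_mxM Kc r0 XZt AE) XD).
apply: bounded_mx_weaken r0 _ _ H => [|h _]; last by rewrite newtonB.
apply: (@le_trans _ _ (2 * b * e * d)); last by rewrite ler_piMl.
by rewrite le_eqVlt; apply/orP; left; apply/eqP; rewrite bE -/m; ring.
Qed.

Fixpoint picard (E : 'M[K]_n) (k : nat) : 'M[K]_n :=
  if k is k'.+1 then newton E (picard E k') else 0.

Lemma picard0 k : picard 0 k = 0.
Proof. by elim: k => //= k ->; rewrite newton0. Qed.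

(** Picard iteration from 0.  The increments are bounded by a geometric
    series, for the norms of power series on one fixed polydisc, so the limit
    exists pointwise and is again the sum of such a series. *)
Lemma newton_fixed_point (E : 'rV[K]_l -> 'M[K]_n) :
  (forall i j, power_series_at (fun h => E h i j) 0) -> E 0 = 0 ->
  exists (r M : K) (Y : 'rV[K]_l -> 'M[K]_n),
    [/\ 0 < r, bounded_mx r Y M, Y 0 = 0 & forall h, polydisc r h -> newton (E h) (Y h) = Y h].
Proof.
move=> hE E0; have [e e0 contr] := newton_contracts; have e0' := ltW e0.
have [r r0 Er] : exists2 r, 0 < r & bounded_mx r E e.
  have small ij : exists r, 0 < r /\ forall t, 0 < t -> t <= r ->
      bounded_series t (fun h => E h ij.1 ij.2) e.
    have Ez : E 0 ij.1 ij.2 = 0 by rewrite E0 mxE.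
    by have [r r0 hr] := power_series_small (hE ij.1 ij.2) Ez e0; exists r.
  have [rho hrho] := choice small.
  pose s := \sum_(ij : 'I_n * 'I_n) (rho ij)^-1.
  have rp ij : 0 < (rho ij)^-1 by rewrite invr_gt0; have [] := hrho ij.
  have s0 : 0 <= s by apply: sumr_ge0 => ij _; exact: ltW.
  have r0 : 0 < (s + 1)^-1 by rewrite invr_gt0 ltr_wpDl.
  exists (s + 1)^-1 => // i j; have [_] := hrho (i, j); apply => //.
  rewrite -[rho _]invrK lef_pV2 ?posrE ?ltr_wpDl //.
  rewrite /s (bigD1 (i, j)) //= -addrA lerDl addr_ge0 // sumr_ge0 // => ij _; exact: ltW.
have r0' := ltW r0.
pose g j := e / 2 ^+ j; have g0 j : 0 <= g j by exact: geom_ge0.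
have gS j : g j = 2 * g j.+1 by exact: geomS.
pose y k h := picard (E h) k; pose d k h := y k.+1 h - y k h.
have step k : bounded_mx r (d k) (g k) /\ bounded_mx r (y k) (\sum_(0 <= j < k) g j).
  elim: k => [|k [hd hy]].
    split; rewrite /d /y /=.
      apply: bounded_mx_weaken Er => // [|h _]; last by rewrite newton0 subr0.
      by rewrite /g expr0 divr1.
    rewrite big_geq // => i j; apply: bounded_series_weaken (bounded_series_cst r 0) => //.
      by rewrite normr0.
    by move=> h _; rewrite mxE.
  have hyS : bounded_mx r (y k.+1) (\sum_(0 <= j < k.+1) g j).
    rewrite big_nat_recr //=; apply: bounded_mx_weaken (bounded_mxD Kc r0' hy hd) => // h _.
    by rewrite /d addrC subrK.
  have le2 m : \sum_(0 <= j < m) g j <= 2 * e.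
    have := geom_sum e 0 m; rewrite add0n -/(g m) -/(g 0) => Hg.
    have -> : e = g 0%N by rewrite /g expr0 divr1.
    by rewrite -Hg lerDl mulr_ge0.
  split=> //; apply: (contr e) => //.
  - exact: bounded_mx_weaken (le2 _) _ hyS.
  - exact: bounded_mx_weaken (le2 _) _ hy.
  - by rewrite -gS.
have summable hab : exists s, polydisc r hab.1.1 -> has_sum (fun j => d j hab.1.1 hab.1.2 hab.2) s.
  have [hr|nhr] := pselect (polydisc r hab.1.1); last by exists 0.
  have [s hs] : exists s, has_sum (fun j => d j hab.1.1 hab.1.2 hab.2) s; last by exists s.
  apply: (Kc (M := 2 * g 0%N)) => B; apply: le_trans (geom_fset e0' 0 B).
  apply: ler_sum => j _; have [hd _] := step j.
  exact: bounded_series_norm r0' (hd _ _) hr.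
have [Yf hYf] := choice summable.
pose Y h := \matrix_(a < n, b < n) Yf (h, a, b).
have tail k h a b : polydisc r h ->
    has_sum (fun j => if (k <= j)%N then d j h a b else 0) ((Y h - y k h) a b).
  move=> hr; have := hYf (h, a, b) hr => /= hs.
  have hk : has_sum (fun j => if (j < k)%N then d j h a b else 0) (y k h a b).
    have -> : y k h a b = \sum_(j < k) d j h a b.
      rewrite -(big_mkord xpredT (fun j => d j h a b)) /d.
      rewrite (eq_bigr (fun j => y j.+1 h a b - y j h a b)) => [|j _]; last by rewrite !mxE.
      by rewrite telescope_sumr // [y 0%N h a b]mxE subr0.
    apply: (has_sum_inj (f := @nat_of_ord k)) (has_sum_fin _); first exact: ord_inj.
      by move=> j; rewrite ltn_ord.
    move=> j; case: ifP => [jk _|_]; last by rewrite eqxx.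
    by exists (Ordinal jk).
  rewrite !mxE -mulN1r; apply: eq_has_sum (has_sumD hs (has_sumZ (-1) hk)) => j.
  by rewrite mulN1r; case: (leqP k j) => _; rewrite ?oppr0 ?addr0 ?subrr.
have Ytail k : bounded_mx r (fun h => Y h - y k h) (2 * g k).
  move=> a b; apply: (@bounded_series_sum _ Kc _ _ r
     (fun j h => if (k <= j)%N then d j h a b else 0) (fun j => if (k <= j)%N then g j else 0)) => //.
  - move=> j; case: leqP => _; first by have [hd _] := step j.
    by rewrite -[X in bounded_series _ _ X](@normr0 K K); exact: bounded_series_cst.
  - exact: geom_fset.
  - by move=> h hr; exact: tail.
have Yb : bounded_mx r Y (2 * e).
  apply: bounded_mx_weaken (Ytail 0%N) => // [|h _]; last by rewrite subr0.
  by rewrite /g expr0 divr1.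
have yb k : bounded_mx r (y k) (2 * e).
  have [_ hy] := step k; apply: bounded_mx_weaken hy => //.
  have := geom_sum e 0 k; rewrite add0n -/(g k) -/(g 0) => Hg.
  have -> : e = g 0%N by rewrite /g expr0 divr1.
  by rewrite -Hg lerDl mulr_ge0.
exists r, (2 * e), Y; split=> //.
  apply/matrixP => a b; have := tail 0%N 0 a b (polydisc0 r0').
  rewrite subr0 [RHS]mxE => hs; apply: has_sum_unique hs _.
  apply: eq_has_sum (@has_sum0 K nat) => j.
  by rewrite leq0n /d /y E0 !picard0 subr0 mxE.
move=> h hr; apply/esym/eqP; rewrite -subr_eq0; apply/eqP/matrixP => a b; rewrite [RHS]mxE.
apply/eqP; apply: contraT; rewrite -normr_gt0 => c0.
have [k] := geom_small Kc e0' c0; rewrite -/(g k) => gk.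
pose c := `|(Y h - newton (E h) (Y h)) a b|.
have [k' gk'] : exists k, 2 * g k < c.
  exists k.+1; by rewrite -gS.
suff : c <= 2 * g k' by move=> /le_lt_trans/(_ gk'); rewrite ltxx.
have h1 := bounded_series_norm r0' (Ytail k'.+1 a b) hr.
have h2 := bounded_series_norm r0'
  (contr e r E Y (y k') (g k') e0 (lexx _) r0' (g0 _) Er Yb (yb _) (Ytail k') a b) hr.
have -> : c = `|(Y h - y k'.+1 h) a b - (newton (E h) (Y h) - newton (E h) (y k' h)) a b|.
  by rewrite /c /y /= !mxE; congr `|_|; ring.
apply: le_trans (ler_normB _ _) _; rewrite mulr_natl mulr2n.
by apply: lerD => //; rewrite gS.
Qed.

End Versal.

(** * Versality *)

Section Simplest.
Variable K : numClosedFieldType.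
Hypothesis Kc : sum_complete K.

Lemma sum_stars n (D : 'M[bool]_n) (U : 'M[K]_n) : supported D U ->
  \sum_(p < #|stars D|) U (enum_val p).1 (enum_val p).2 *: delta_mx (enum_val p).1 (enum_val p).2 = U.
Proof.
move=> DU; rewrite [RHS]matrix_sum_delta pair_big /=.
rewrite (bigID (mem (stars D))) /= [X in _ + X]big1 => [|ij]; last first.
  by rewrite inE => /DU ->; rewrite scale0r.
by rewrite addr0 [RHS]big_enum_val.
Qed.

Lemma simplest_deformation n (A : 'M[K]_n) (D : 'M[bool]_n) :
  deformation A (simplest A D).
Proof.
split.
  by rewrite /simplest big1 ?addr0 // => p _; rewrite mxE scale0r.
exists setT; first by split => //; exact: openT.
move=> w _ i j; have e01 : (0 : K) <= 1 by [].
have H p := bounded_seriesM Kc e01 (bounded_seriesD Kc e01 (bounded_series_cst 1 (w 0 p)) (bounded_series_coord p e01))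
  (bounded_series_cst 1 (delta_mx (enum_val p).1 (enum_val p).2 i j : K)).
have := bounded_seriesD Kc e01 (bounded_series_cst 1 (A i j)) (bounded_series_fin Kc e01 H).
move=> H1; apply: (power_series_at_of_bounded Kc ltr01).
apply: bounded_series_weaken H1 => // h _; rewrite /simplest [RHS]mxE summxE.
by congr (_ + _); apply: eq_bigr => p _; rewrite !mxE.
Qed.

Lemma bounded_power_series l (f : 'rV[K]_l -> K) r M : 0 < r ->
  bounded_series r f M -> power_series_at f 0.
Proof.
move=> r0 hf; apply: (power_series_at_of_bounded Kc r0).
by apply: bounded_series_weaken hf => // [|h _]; [exact: ltW | rewrite add0r].
Qed.

Lemma power_series_bounded_series l (f : 'rV[K]_l -> K) : power_series_at f 0 ->
  exists r M, 0 < r /\ bounded_series r f M.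
Proof.
move=> /power_series_bounded[c [r [M [r0 cM hf]]]]; exists r, M; split=> //.
by exists {ffun 'I_l -> nat}, c, id.
Qed.

(** The choice of [X] on matrix units extends to a linear map [X], for which
    the fixed point equation [newton E Y = Y] produces a transforming matrix
    [1 + X Y] that is a power series in the parameters. *)
Lemma versal_simplest n (A : 'M[K]_n) (D : 'M[bool]_n) :
  (forall B, exists X, supported D (B - (X^T *m A + A *m X))) ->
  versal A (simplest A D).
Proof.
move=> span; split=> [|l G [G0 [L [oL L0] hG]]]; first exact: simplest_deformation.
have [x hx] := choice (fun ij : 'I_n * 'I_n => span (delta_mx ij.1 ij.2)).
pose Xf (Y : 'M[K]_n) := - \sum_ij Y ij.1 ij.2 *: x ij.
have Xlin : linear Xf.
  move=> c U V; rewrite /Xf scalerN -opprD scaler_sumr -big_split /=; congr (- _).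
  by apply: eq_bigr => ij _; rewrite !mxE scalerDl scalerA.
have [X XE] : exists X : {linear 'M[K]_n -> 'M[K]_n}, forall Y, X Y = Xf Y.
  by exists (HB.pack_for {linear 'M[K]_n -> 'M[K]_n} Xf
    (GRing.isLinear.Build K 'M[K]_n 'M[K]_n *:%R Xf Xlin)).
pose Dl Y := Y + (X Y)^T *m A + A *m X Y.
have DlD Y : supported D (Dl Y).
  suff -> : Dl Y = \sum_ij Y ij.1 ij.2 *: (delta_mx ij.1 ij.2 - ((x ij)^T *m A + A *m x ij)).
    by move=> a b Dab; rewrite summxE big1 // => ij _; rewrite mxE (hx ij) // mulr0.
  have h1 : (X Y)^T *m A = - \sum_ij Y ij.1 ij.2 *: ((x ij)^T *m A).
    rewrite XE /Xf linearN /= linear_sum /= mulNmx mulmx_suml; congr (- _).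
    by apply: eq_bigr => ij _; rewrite linearZ /= scalemxAl.
  have h2 : A *m X Y = - \sum_ij Y ij.1 ij.2 *: (A *m x ij).
    rewrite XE /Xf mulmxN mulmx_sumr; congr (- _).
    by apply: eq_bigr => ij _; rewrite scalemxAr.
  rewrite /Dl h1 h2 {1}[Y]matrix_sum_delta pair_big /=.
  under [RHS]eq_bigr do rewrite scalerBr scalerDr.
  by rewrite sumrB big_split /= opprD addrA.
pose E h := G h - A.
have E0 : E 0 = 0 by rewrite /E G0 subrr.
have hE i j : power_series_at (fun h => E h i j) 0.
  have [r [M [r0 hr]]] := power_series_bounded_series (hG 0 L0 i j).
  have := bounded_seriesD Kc (ltW r0) hr (bounded_series_cst r (- A i j)) => /(bounded_power_series r0).
  by congr power_series_at; apply/funext => h; rewrite !mxE.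
have [r [M [Y [r0 hY Y0 NY]]]] := newton_fixed_point Kc A X hE E0; have r0' := ltW r0.
have [C C0 hX] := bounded_mx_linear Kc l X.
have XY := hX _ _ _ r0' hY.
have DlY : exists M', bounded_mx r (fun h => Dl (Y h)) M'.
  have [a [a0 hA]] := bounded_mx_cst l A; have hAr := hA r r0'.
  have t1 := bounded_mxM Kc r0' (bounded_mx_tr r0' XY) hAr.
  have t2 := bounded_mxD Kc r0' (bounded_mxD Kc r0' hY t1) (bounded_mxM Kc r0' hAr XY).
  by eexists; exact: t2.
have [a [a0 h1]] := bounded_mx_cst l (1%:M : 'M[K]_n).
have hS := bounded_mxD Kc r0' (h1 r r0') XY.
have r20 : 0 < r / 2 by rewrite divr_gt0.
exists (fun h => \row_p Dl (Y h) (enum_val p).1 (enum_val p).2); split.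
- move=> p; have [M' hM'] := DlY.
  have := bounded_power_series r0 (hM' (enum_val p).1 (enum_val p).2).
  by congr power_series_at; apply/funext => h; rewrite [RHS]mxE.
- by apply/rowP => p; rewrite Y0 /Dl raddf0 trmx0 mul0mx mulmx0 !addr0 !mxE.
exists (fun h => 1%:M + X (Y h)).
  split; first by rewrite Y0 raddf0 addr0.
  have [B [oB B0] hB] : exists2 B, open_nbhs (0 : 'rV[K]_l) B & (B `<=` polydisc (r / 2))%classic.
    have : nbhs (0 : 'rV[K]_l) (polydisc (r / 2)) by exact: near_polydisc.
    by rewrite nbhsE.
  exists B => // w /hB hw i j; have := hS i j; rewrite {1}(splitr r) => H.
  have H' := bounded_series_shift Kc (ltW r20) (ltW r20) H hw.
  exact: (power_series_at_of_bounded Kc r20 H').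
near=> z; have zr : polydisc r z by near: z; exact: near_polydisc.
have -> : G z = A + E z by rewrite /E addrC subrK.
rewrite newton_congr ?NY // /simplest; congr (_ + _).
rewrite -/(Dl (Y z)) -[RHS](sum_stars (DlD (Y z))).
by apply: eq_bigr => p _; rewrite mxE.
Unshelve. all: by end_near. Qed.

End Simplest.

(** * First order expansions and minimality *)

Section FirstOrder.
Variable K : numClosedFieldType.
Hypothesis Kc : sum_complete K.

Lemma pos_lower2 (a b : K) : 0 < a -> 0 < b -> exists c, [/\ 0 < c, c <= a & c <= b].
Proof.
move=> a0 b0; have a0' : 0 < a^-1 by rewrite invr_gt0.
have b0' : 0 < b^-1 by rewrite invr_gt0.
have ab : 0 < a^-1 + b^-1 by rewrite addr_gt0.
exists (a^-1 + b^-1)^-1; split; first by rewrite invr_gt0.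
  by rewrite -[leRHS]invrK lef_pV2 ?posrE // lerDl ltW.
by rewrite -[leRHS]invrK lef_pV2 ?posrE // lerDr ltW.
Qed.

(** [f t = a + b t + O(t^2)] as [t] tends to 0 along the positive axis.  This
    substitute for a derivative is uniquely determined, and is all that the
    first order argument for minimality requires. *)
Definition jet1 (f : K -> K) (a b : K) :=
  exists C r, [/\ 0 < r, 0 <= C & forall t, 0 < t -> t <= r -> `|f t - (a + b * t)| <= C * t ^+ 2].

Lemma jet1_unique f a b b' : jet1 f a b -> jet1 f a b' -> b = b'.
Proof.
move=> [C [r [r0 C0 h]]] [C' [r' [r0' C0' h']]].
apply/eqP; rewrite -subr_eq0; apply: contraT; rewrite -normr_gt0 => c0.
pose M := C + C' + 1; have M0 : 0 < M by rewrite ltr_wpDl ?addr_ge0.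
have [s [s0 sr sr']] := pos_lower2 r0 r0'.
have [t [t0 ts tc]] := pos_lower2 s0 (divr_gt0 c0 M0).
have := lerD (h t t0 (le_trans ts sr)) (h' t t0 (le_trans ts sr')).
move=> /(le_trans (ler_normB _ _)).
have -> : f t - (a + b * t) - (f t - (a + b' * t)) = - (b - b') * t by ring.
rewrite normrM normrN (gtr0_norm t0) -mulrDl expr2 mulrA ler_pM2r // => bt.
have : `|b - b'| < M * t.
  by apply: le_lt_trans bt _; rewrite ltr_pM2r // ltrDl.
by move=> /lt_le_trans; move=> /(_ `|b - b'|); rewrite mulrC -ler_pdivlMr // ltxx => /(_ tc).
Qed.

Lemma jet1_ext f g a b s : 0 < s -> (forall t, 0 < t -> t <= s -> f t = g t) ->
  jet1 f a b -> jet1 g a b.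
Proof.
move=> s0 fg [C [r [r0 C0 h]]]; have [q [q0 qr qs]] := pos_lower2 r0 s0.
exists C, q; split=> // t t0 tq.
by rewrite -fg // ?h // (le_trans tq).
Qed.

Lemma jet1_cst a : jet1 (fun=> a) a 0.
Proof.
exists 0, 1; split=> // t t0 _.
by rewrite mul0r addr0 subrr normr0 mul0r.
Qed.

Lemma jet1D f g a b a' b' : jet1 f a b -> jet1 g a' b' ->
  jet1 (fun t => f t + g t) (a + a') (b + b').
Proof.
move=> [C [r [r0 C0 h]]] [C' [r' [r0' C0' h']]].
have [s [s0 sr sr']] := pos_lower2 r0 r0'.
exists (C + C'), s; split=> //; first by rewrite addr_ge0.
move=> t t0 ts.
have -> : f t + g t - (a + a' + (b + b') * t) = (f t - (a + b * t)) + (g t - (a' + b' * t)) by ring.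
rewrite mulrDl; apply: le_trans (ler_normD _ _) _.
by apply: lerD; [apply: h | apply: h'] => //; apply: le_trans ts _.
Qed.

Lemma jet1M f g a b a' b' : jet1 f a b -> jet1 g a' b' ->
  jet1 (fun t => f t * g t) (a * a') (b * a' + a * b').
Proof.
move=> [C [r [r0 C0 h]]] [C' [r' [r0' C0' h']]].
have [s [s0 sr sr']] := pos_lower2 r0 r0'.
have [q [q0 qs q1]] := pos_lower2 s0 ltr01.
pose M := C * (`|a'| + `|b'| + C') + ((`|a| + `|b|) * C' + `|b * b'|).
exists M, q; split=> //; first by rewrite !addr_ge0 // !mulr_ge0 // !addr_ge0.
move=> t t0 tq; have tl1 := le_trans tq q1; have ts := le_trans tq qs.
have hf := h t t0 (le_trans ts sr); have hg := h' t t0 (le_trans ts sr').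
have lin x y : `|x + y * t| <= `|x| + `|y|.
  apply: le_trans (ler_normD _ _) _; rewrite lerD2l normrM (gtr0_norm t0).
  by rewrite ler_piMr.
have t2 : t ^+ 2 <= 1 by rewrite exprn_ile1 // ltW.
have t20 : 0 <= t ^+ 2 by rewrite exprn_ge0 // ltW.
have gb : `|g t| <= `|a'| + `|b'| + C'.
  have -> : g t = (a' + b' * t) + (g t - (a' + b' * t)) by ring.
  apply: le_trans (ler_normD _ _) _; apply: lerD; first exact: lin.
  by apply: le_trans hg _; rewrite ler_piMr.
have -> : f t * g t - (a * a' + (b * a' + a * b') * t) =
   (f t - (a + b * t)) * g t + ((a + b * t) * (g t - (a' + b' * t)) + b * b' * t ^+ 2) by ring.
rewrite /M (mulrDl (C * _)); apply: le_trans (ler_normD _ _) _; apply: lerD.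
  rewrite normrM mulrAC; apply: ler_pM => //.
apply: le_trans (ler_normD _ _) _; rewrite (mulrDl (_ * C')); apply: lerD.
  rewrite normrM -mulrA; apply: ler_pM => //.
by rewrite normrM (ger0_norm t20).
Qed.

Lemma jet1_sum n (f : 'I_n -> K -> K) (a b : 'I_n -> K) :
  (forall i, jet1 (f i) (a i) (b i)) ->
  jet1 (fun t => \sum_i f i t) (\sum_i a i) (\sum_i b i).
Proof.
move=> h; elim: (index_enum _) => [|i s IH].
  rewrite !big_nil; apply: jet1_ext ltr01 _ (jet1_cst 0) => t _ _.
  by rewrite big_nil.
rewrite !big_cons; apply: jet1_ext ltr01 _ (jet1D (h i) IH) => t _ _.
by rewrite big_cons.
Qed.

Definition jet1_mx m n (F : K -> 'M[K]_(m, n)) (A B : 'M[K]_(m, n)) :=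
  forall i j, jet1 (fun t => F t i j) (A i j) (B i j).

Lemma jet1_mxM m n p (F : K -> 'M[K]_(m, n)) (G : K -> 'M[K]_(n, p)) A B A' B' :
  jet1_mx F A B -> jet1_mx G A' B' ->
  jet1_mx (fun t => F t *m G t) (A *m A') (B *m A' + A *m B').
Proof.
move=> hF hG i j.
have H k := jet1M (hF i k) (hG k j).
have := jet1_sum H; rewrite !mxE -big_split /=; apply: jet1_ext ltr01 _ => t _ _.
by rewrite mxE.
Qed.

Lemma polydisc_bound k (h : 'rV[K]_k) : exists2 m, 0 < m & polydisc m h.
Proof.
exists (\sum_i `|h 0 i| + 1) => [|i]; first by rewrite ltr_wpDl ?sumr_ge0.
by rewrite (bigD1 i) //= -addrA lerDl addr_ge0 // sumr_ge0.
Qed.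

Lemma polydiscZ k (h : 'rV[K]_k) m t : 0 <= t -> polydisc m h -> polydisc (t * m) (t *: h).
Proof. by move=> t0 hm i; rewrite mxE normrM (ger0_norm t0) ler_wpM2l. Qed.

Lemma power_series_jet1 k (f : 'rV[K]_k -> K) : power_series_at f 0 ->
  exists d : 'I_k -> K, forall h, jet1 (fun t => f (t *: h)) (f 0) (\sum_i d i * h 0 i).
Proof.
move=> /power_series_first_order [d [C [r [r0 C0 hf]]]]; exists d => h.
have [m m0 hm] := polydisc_bound h.
exists (C * m ^+ 2), (r / m); split=> [||t t0 tr]; first by rewrite divr_gt0.
  by rewrite mulr_ge0 // exprn_ge0 // ltW.
have t0' := ltW t0.
have := hf (t * m) (t *: h); rewrite mulr_ge0 ?(ltW m0) // -ler_pdivlMr // => /(_ isT tr (polydiscZ t0' hm)).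
rewrite exprMn [t ^+ 2 * _]mulrC mulrA.
suff -> : \sum_i d i * (t *: h) 0 i = (\sum_i d i * h 0 i) * t by rewrite opprD addrA.
by rewrite mulr_suml; apply: eq_bigr => i _; rewrite mxE mulrCA mulrC.
Qed.

(** Only the linear part of [f] could contribute to first order, and its
    arguments are of second order. *)
Lemma power_series_jet1_comp k l (f : 'rV[K]_k -> K) (phi : 'rV[K]_l -> 'rV[K]_k) h :
  power_series_at f 0 -> phi 0 = 0 ->
  (forall i, jet1 (fun t => phi (t *: h) 0 i) 0 0) ->
  jet1 (fun t => f (phi (t *: h))) (f 0) 0.
Proof.
move=> /power_series_first_order [d [C [r [r0 C0 hf]]]] phi0 hphi.
have [Cf hC] := choice hphi; have [rf hr] := choice hC.
pose M := \sum_i Cf i + 1; pose s := (\sum_i (rf i)^-1 + 1)^-1.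
have Cf0 i : 0 <= Cf i by have [] := hr i.
have rf0 i : 0 < (rf i)^-1 by rewrite invr_gt0; have [] := hr i.
have M0 : 0 < M by rewrite ltr_wpDl // sumr_ge0.
have S0 : 0 < \sum_i (rf i)^-1 + 1 by rewrite ltr_wpDl // sumr_ge0 // => i _; exact: ltW.
have s0 : 0 < s by rewrite invr_gt0.
have [q [q0 qs qr]] := pos_lower2 s0 (divr_gt0 r0 M0).
have [p [p0 pq p1]] := pos_lower2 q0 ltr01.
have D0 : 0 <= \sum_i `|d i| by exact: sumr_ge0.
exists (C * M ^+ 2 + (\sum_i `|d i|) * M), p; split=> //.
  by rewrite addr_ge0 // mulr_ge0 // ?exprn_ge0 // ltW.
move=> t t0 tp; have t1 := le_trans tp p1; have tq := le_trans tp pq.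
have t20 : 0 < t ^+ 2 by rewrite exprn_gt0.
have t21 : t ^+ 2 <= t by rewrite expr2 ger_pMr.
have wt : polydisc (M * t ^+ 2) (phi (t *: h)).
  move=> i; have [_ _ /(_ t t0)] := hr i; rewrite mul0r addr0 subr0 => H.
  apply: le_trans (H _) _.
    apply: le_trans tq (le_trans qs _); rewrite /s -[leRHS]invrK lef_pV2 ?posrE //.
    by rewrite (bigD1 i) //= -addrA lerDl addr_ge0 // sumr_ge0 // => j _; exact: ltW.
  by rewrite ler_pM2r // /M (bigD1 i) //= -addrA lerDl addr_ge0 // sumr_ge0.
have Mt0 : 0 <= M * t ^+ 2 by rewrite mulr_ge0 ?ltW.
have Mtr : M * t ^+ 2 <= r.
  apply: (@le_trans _ _ (M * t)); first by rewrite ler_pM2l.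
  by rewrite mulrC -ler_pdivlMr // (le_trans tq).
have H := hf _ _ Mt0 Mtr wt.
rewrite mul0r addr0.
have -> : f (phi (t *: h)) - f 0 = (f (phi (t *: h)) - f 0 - \sum_i d i * phi (t *: h) 0 i)
   + \sum_i d i * phi (t *: h) 0 i by rewrite subrK.
rewrite mulrDl; apply: le_trans (ler_normD _ _) _; apply: lerD.
  apply: le_trans H _; rewrite exprMn mulrA ler_wpM2l ?mulr_ge0 ?exprn_ge0 ?(ltW M0) //.
  by rewrite expr2 ger_pMr // (le_trans t21).
apply: le_trans (ler_norm_sum _ _ _) _; rewrite -mulrA mulr_suml.
by apply: ler_sum => i _; rewrite normrM ler_wpM2l.
Qed.

Lemma holomorphic_jet1 k m n (L : set 'rV[K]_k) (F : 'rV[K]_k -> 'M[K]_(m, n)) h :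
  open_nbhs (0 : 'rV[K]_k) L -> holomorphic_on L F ->
  exists B, jet1_mx (fun t => F (t *: h)) (F 0) B.
Proof.
move=> [_ L0] hF.
have H (ij : 'I_m * 'I_n) : exists b, jet1 (fun t => F (t *: h) ij.1 ij.2) (F 0 ij.1 ij.2) b.
  have [d hd] := power_series_jet1 (hF 0 L0 ij.1 ij.2).
  by exists (\sum_i d i * h 0 i).
have [b hb] := choice H; exists (\matrix_(i, j) b (i, j)) => i j.
by rewrite mxE; exact: (hb (i, j)).
Qed.

Lemma near_line k (h : 'rV[K]_k) (P : 'rV[K]_k -> Prop) :
  (\forall z \near (0 : 'rV[K]_k), P z)%classic ->
  exists2 s, 0 < s & forall t, 0 < t -> t <= s -> P (t *: h).
Proof.
move=> /near_polydiscP[r r0 hr]; have [m m0 hm] := polydisc_bound h.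
exists (r / m) => [|t t0 tr]; first by rewrite divr_gt0.
by apply: hr; apply: polydisc_le (polydiscZ (ltW t0) hm); rewrite -ler_pdivlMr.
Qed.

Lemma simplest_scale n (A : 'M[K]_n) (D : 'M[bool]_n) (h : 'rV[K]_#|stars D|) t :
  simplest A D (t *: h) = A + t *: (simplest A D h - A).
Proof.
rewrite /simplest [A + _ - A]addrC addKr; congr (_ + _).
by rewrite scaler_sumr; apply: eq_bigr => p _; rewrite mxE scalerA.
Qed.

(** With fewer parameters than stars, the derivative at 0 of the map [phi]
    between the parameter spaces has a nonzero vector [h] in its kernel.
    Comparing the terms of first order in [t] of
    [F (phi (t h)) = S^T (A + t D(h)) S], whose left hand side has none, shows
    that [D(h)] is tangent to the orbit of [A]. *)
Lemma simplest_minimal n (A : 'M[K]_n) (D : 'M[bool]_n) :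
  (forall X, supported D (X^T *m A + A *m X) -> X^T *m A + A *m X = 0) ->
  forall (k' : nat) (F : 'rV[K]_k' -> 'M[K]_n), versal A F -> (#|stars D| <= k')%N.
Proof.
move=> indep k' F [[F0 [L oL hF]] vF].
have [phi [hphi phi0 [S [S0 [L' oL' hS]] eqS]]] := vF _ _ (simplest_deformation Kc A D).
rewrite leqNgt; apply/negP => k'k; set k := #|stars D| in k'k phi hphi phi0 S S0 L' oL' hS eqS *.
have hd i := power_series_jet1 (hphi i).
have [d hd'] := choice hd.
pose P : 'M[K]_(k, k') := \matrix_(j, i) d i j.
(* P is the Jacobian matrix of phi; it has more rows than columns *)
have [h /sub_kermxP hP h0] : exists2 h : 'rV[K]_k, (h <= kermx P)%MS & h != 0.
  apply/rowV0Pn; rewrite -mxrank_eq0 mxrank_ker subn_eq0 -ltnNge.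
  by apply: leq_ltn_trans (rank_leq_col _) k'k.
have phi2 i : jet1 (fun t => phi (t *: h) 0 i) 0 0.
  have := hd' i h; rewrite phi0 mxE.
  suff -> : \sum_j d i j * h 0 j = 0 by [].
  have := congr1 (fun M : 'rV[K]_k' => M 0 i) hP; rewrite !mxE => hPi; rewrite -[RHS]hPi.
  by apply: eq_bigr => j _; rewrite mxE mulrC.
have jF : jet1_mx (fun t => F (phi (t *: h))) A 0.
  move=> i j; rewrite -F0 mxE.
  apply: (power_series_jet1_comp (f := fun z => F z i j)) => //.
  by case: oL => _ L0; exact: hF.
have [X hX] := holomorphic_jet1 h oL' hS; rewrite S0 in hX.
have hXt : jet1_mx (fun t => (S (t *: h))^T) 1%:M X^T.
  by move=> i j; have := hX j i; rewrite !mxE eq_sym; apply: jet1_ext ltr01 _ => t _ _; rewrite mxE.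
pose Dh := simplest A D h - A.
have hG : jet1_mx (fun t => simplest A D (t *: h)) A Dh.
  move=> i j; exists 0, 1; split=> // t t0 _.
  by rewrite simplest_scale -/Dh !mxE mulrC subrr normr0 mul0r.
have := jet1_mxM (jet1_mxM hXt hG) hX.
rewrite !mulmx1 !mul1mx => H.
have [s s0 hs] := near_line h eqS.
have T0 : X^T *m A + A *m X = - Dh.
  apply/eqP; rewrite -addr_eq0 addrAC; apply/eqP/matrixP => i j.
  apply: jet1_unique (jF i j); apply: jet1_ext s0 _ (H i j) => t t0 ts.
  by rewrite hs.
have DhE : Dh = \sum_(p < k) h 0 p *: delta_mx (enum_val p).1 (enum_val p).2.
  by rewrite /Dh /simplest addrC addKr.
have Dh0 : Dh = 0.
  apply/oppr_inj; rewrite oppr0 -T0; apply: indep; rewrite T0 DhE => i j Dij.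
  rewrite mxE summxE big1 ?oppr0 // => p _; rewrite !mxE.
  have Dp : D (enum_val p).1 (enum_val p).2 by have := enum_valP p; rewrite inE.
  case: (i =P _) => [iE|_]; case: (j =P _) => [jE|_]; rewrite ?mulr0 //.
  by move: Dij; rewrite iE jE Dp.
case/negP: h0; apply/eqP/rowP => p.
have := congr1 (fun M : 'M[K]_n => M (enum_val p).1 (enum_val p).2) Dh0.
rewrite DhE summxE (bigD1 p) //= !mxE !eqxx mulr1 big1 ?addr0 // => q /negPf qp.
rewrite !mxE -xpair_eqE -!surjective_pairing (inj_eq enum_val_inj) eq_sym qp.
by rewrite mulr0.
Qed.

End FirstOrder.

(** * Miniversal deformations *)

Lemma simplest_miniversal (K : numClosedFieldType) (Kc : sum_complete K) n
    (A : 'M[K]_n) (D : 'M[bool]_n) :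
  (forall B, exists X, supported D (B - (X^T *m A + A *m X))) ->
  (forall X, supported D (X^T *m A + A *m X) -> X^T *m A + A *m X = 0) ->
  miniversal A (simplest A D).
Proof.
by move=> span indep; split; [exact: versal_simplest | exact: simplest_minimal].
Qed.

Theorem theorem3p1 (R : realType)
    (hs : seq (nat * (R[i] : numClosedFieldType))) (gs js : seq nat)
    (o : 'I_(size (summands hs gs js)) -> 'I_(size (summands hs gs js)) ->
         choices) :
  canonical_data hs gs js ->
  miniversal (A_can (summands hs gs js))
             (simplest (A_can (summands hs gs js)) (D_can o)).
Proof.
move=> can; have [span indep] := complementary_canonical can o.
exact: (simplest_miniversal (@complex_sum_complete R) span indep).
Qed.
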